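(* Let $F$ be a field of characteristic different from $2$ and let $(A,\sigma)$ be an $F$-algebra with involution. Consider the property (PS') for every $u\in\mathrm{Sym}(A,\sigma)$, the form $T_{(A,\sigma,u)}$ is positive semidefinite at all $P\in\widetilde X_F$ if and only if $u\in D_{(A,\sigma)}(2^s\times\langle1\rangle_\sigma)$ for some $s\in\mathbb{N}$. Property (PS') holds if and only if $\widetilde X_F=X_\sigma$.
   Context: Algebras. $X_F$ is the space of orderings of $F$ (possibly empty), and $F_P$ is a real closure of $F$ at $P\in X_F$. An $F$-algebra with involution $(A,\sigma)$ is a finite-dimensional simple $F$-algebra $A$ whose centre is a field $K$, with an involution $\sigma$ on $A$ such that $F=K\cap\mathrm{Sym}(A,\sigma)$, where $\mathrm{Sym}(A,\sigma)=\{x\in A\mid\sigma(x)=x\}$. Put $\iota=\sigma|_K$. Forms. $\langle1\rangle_\sigma$ is the hermitian form $(x,y)\mapsto\sigma(x)y$ on $A$, $r\times h$ is the orthogonal sum of $r$ copies of $h$, and for a hermitian form $(M,h)$ over $(A,\sigma)$, $D_{(A,\sigma)}(h)=\{h(x,x)\mid x\in M\}$. Thus $u\in D_{(A,\sigma)}(2^s\times\langle1\rangle_\sigma)$ for some $s$ means that $u$ is a finite sum of hermitian squares $\sigma(x)x$, $x\in A$. $W(A,\sigma)$ is the Witt group of nonsingular hermitian forms over $(A,\sigma)$ (on finitely generated right $A$-modules). Nil-orderings. For $P\in X_F$ define $s_{\mu_P}:W(A,\sigma)\to\mathbb{Z}$ as follows. If there is an isomorphism of $F_P$-algebras with involution $(A\otimes_FF_P,\sigma\otimes\mathrm{id})\cong(M_r(D_P),\mathrm{Int}(\Phi_P)\circ\overline{\phantom{x}}^{\,t})$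 with $(D_P,\overline{\phantom{x}})$ one of $(F_P,\mathrm{id})$, $(F_P(\sqrt{-1}),\text{conjugation})$, $((-1,-1)_{F_P},\text{conjugation})$, $\Phi_P$ invertible and $\overline{\Phi_P}^{\,t}=\Phi_P$ (where $\mathrm{Int}(\Phi)(x)=\Phi x\Phi^{-1}$), then for a nonsingular form $h$ view $h\otimes F_P$ as a form over $(M_r(D_P),\mathrm{Int}(\Phi_P)\circ\overline{\phantom{x}}^{\,t})$; then $\Phi_P^{-1}(h\otimes F_P)$ is a hermitian form over $(M_r(D_P),\overline{\phantom{x}}^{\,t})$, isometric to $(X,Y)\mapsto\overline{X}^{\,t}BY$ on $M_{k,r}(D_P)$ for some $B=\overline{B}^{\,t}\in M_k(D_P)$, and $s_{\mu_P}(h)$ is the Sylvester signature of $B$. If there is no such isomorphism, $s_{\mu_P}=0$. The map $s_{\mu_P}$ is well defined up to sign. Put $\mathrm{Nil}[A,\sigma]=\{P\in X_F\mid s_{\mu_P}=0\}$ and $\widetilde X_F=X_F\setminus\mathrm{Nil}[A,\sigma]$. Trace forms. $T_{(A,\sigma)}(x,y)=\mathrm{Trd}_A(\sigma(x)y)$ and, for $u\in\mathrm{Sym}(A,\sigma)$, $T_{(A,\sigma,u)}(x,y)=\mathrm{Trd}_A(\sigma(x)uy)$, for $x,y\in A$, where $\mathrm{Trd}_A:A\to K$ is the reduced trace. These are symmetric bilinear over $F$ if $K=F$ and hermitian over $(K,\iota)$ otherwise; $T(x,x)\in F$. Such a form $T$ is positive semidefinite at $P\in X_F$ if $T(x,x)\geq0$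 with respect to $P$ for all $x\in A$. $X_\sigma$ is the set of $P\in X_F$ at which $T_{(A,\sigma)}$ is positive semidefinite (''$\sigma$ is positive at $P$''). *)

(* Defs.v *)
From HB Require Import structures.
From mathcomp Require Import all_boot all_order all_algebra all_field.
From mathcomp Require Import classical_sets complex ring.

Set Implicit Arguments.
Unset Strict Implicit.
Unset Printing Implicit Defensive.

Import Order.TTheory GRing.Theory Num.Theory.
Local Open Scope ring_scope.
Local Open Scope classical_set_scope.

(* [Quat a b c d] stands for a + b i + c j + d ij, with i^2 = j^2 = -1 and
   ij = - ji. *)
Record quaternion (R : Type) := Quat { qre : R; qi : R; qj : R; qk : R }.

Section QuaternionChoice.
Variable R : choiceType.
Definition quaternion_prod (x : quaternion R) :=
  (qre x, qi x, qj x, qk x).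
Definition prod_quaternion (x : R * R * R * R) :=
  let: (a, b, c, d) := x in Quat a b c d.
Lemma quaternion_prodK : cancel quaternion_prod prod_quaternion.
Proof. by case. Qed.
HB.instance Definition _ :=
  Choice.copy (quaternion R) (can_type quaternion_prodK).
End QuaternionChoice.

Section QuaternionRing.
Variable R : comNzRingType.
Implicit Types x y z : quaternion R.

Definition addq x y :=
  Quat (qre x + qre y) (qi x + qi y) (qj x + qj y) (qk x + qk y).
Definition oppq x := Quat (- qre x) (- qi x) (- qj x) (- qk x).
Definition mulq x y :=
  Quat (qre x * qre y - qi x * qi y - qj x * qj y - qk x * qk y)
       (qre x * qi y + qi x * qre y + qj x * qk y - qk x * qj y)
       (qre x * qj y - qi x * qk y + qj x * qre y + qk x * qi y)
       (qre x * qk y + qi x * qj y - qj x * qi y + qk x * qre y).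
Definition scalarq (a : R) := Quat a 0 0 0.
Definition conjq x := Quat (qre x) (- qi x) (- qj x) (- qk x).

Lemma addqA : associative addq.
Proof. by move=> [? ? ? ?] [? ? ? ?] [? ? ? ?]; rewrite /addq /= !addrA. Qed.
Lemma addqC : commutative addq.
Proof. by move=> [? ? ? ?] [? ? ? ?]; congr Quat; rewrite /= addrC. Qed.
Lemma add0q : left_id (scalarq 0) addq.
Proof. by move=> [? ? ? ?]; rewrite /addq /= !add0r. Qed.
Lemma addNq : left_inverse (scalarq 0) oppq addq.
Proof. by move=> [? ? ? ?]; rewrite /addq /= !addNr. Qed.
HB.instance Definition _ :=
  GRing.isZmodule.Build (quaternion R) addqA addqC add0q addNq.

Lemma mulqA : associative mulq.
Proof. by move=> [? ? ? ?] [? ? ? ?] [? ? ? ?]; congr Quat => /=; ring. Qed.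
Lemma mul1q : left_id (scalarq 1) mulq.
Proof. by move=> [? ? ? ?]; congr Quat => /=; ring. Qed.
Lemma mulq1 : right_id (scalarq 1) mulq.
Proof. by move=> [? ? ? ?]; congr Quat => /=; ring. Qed.
Lemma mulqDl : left_distributive mulq (@GRing.add (quaternion R)).
Proof. by move=> [? ? ? ?] [? ? ? ?] [? ? ? ?]; congr Quat => /=; ring. Qed.
Lemma mulqDr : right_distributive mulq (@GRing.add (quaternion R)).
Proof. by move=> [? ? ? ?] [? ? ? ?] [? ? ? ?]; congr Quat => /=; ring. Qed.
Lemma scalarq1_neq0 : scalarq 1 != 0.
Proof. by apply/eqP => -[] /eqP; rewrite oner_eq0. Qed.
HB.instance Definition _ := GRing.Zmodule_isNzRing.Build (quaternion R)
  mulqA mul1q mulq1 mulqDl mulqDr scalarq1_neq0.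
End QuaternionRing.

Inductive division_kind := RealKind | ComplexKind | QuaternionKind.

Definition divalg (R : rcfType) (t : division_kind) : nzRingType :=
  match t with
  | RealKind => R
  | ComplexKind => R[i]
  | QuaternionKind => quaternion R
  end.

Definition divalg_bar (R : rcfType) (t : division_kind) :
    divalg R t -> divalg R t :=
  match t with
  | RealKind => id
  | ComplexKind => @conjc R
  | QuaternionKind => @conjq R
  end.

Definition divalg_in (R : rcfType) (t : division_kind) : R -> divalg R t :=
  match t with
  | RealKind => id
  | ComplexKind => @real_complex R
  | QuaternionKind => @scalarq R
  end.

Section Matrices.
Variables (R : rcfType) (t : division_kind).

Definition conj_tr m n (X : 'M[divalg R t]_(m, n)) : 'M[divalg R t]_(n, m) :=
  (map_mx (@divalg_bar R t) X)^T.

Definition scale_divalg m n (c : R) (X : 'M[divalg R t]_(m, n)) :=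
  divalg_in t c *: X.

Definition sylvester_signature k (B : 'M[divalg R t]_k) (n : int) : Prop :=
  exists (G G' : 'M[divalg R t]_k) (d : 'rV[R]_k),
    [/\ G *m G' = 1%:M, G' *m G = 1%:M,
        conj_tr G *m B *m G = map_mx (@divalg_in R t) (diag_mx d)
      & n = #|[pred i | 0 < d 0 i]|%:Z - #|[pred i | d 0 i < 0]|%:Z].
End Matrices.

(* [psi : M -> N] exhibits the [T]-module [N] as the extension of scalars
   M (x)_S T along [g : S -> T], i.e. it has the universal property of
   m |-> m (x) 1.  The module structures are given by the actions
   [sM] and [sN]. *)
Definition scalar_extension (S T : pzRingType) (g : S -> T) (M N : zmodType)
    (sM : S -> M -> M) (sN : T -> N -> N) (psi : M -> N) : Prop :=
  [/\ {morph psi : x y / x + y},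
      forall c x, psi (sM c x) = sN (g c) (psi x)
    & forall (V : lmodType T) (theta : M -> V),
        {morph theta : x y / x + y} ->
        (forall c x, theta (sM c x) = g c *: theta x) ->
        exists! thetaN : N -> V,
          [/\ {morph thetaN : x y / x + y},
              forall c y, thetaN (sN c y) = c *: thetaN y
            & forall x, thetaN (psi x) = theta x]].

Section Orderings.
Variable F : fieldType.

Definition X_F : set (set F) :=
  [set P | [/\ forall x y, P x -> P y -> P (x + y),
               forall x y, P x -> P y -> P (x * y),
               forall x, P x \/ P (- x)
             & forall x, P x -> P (- x) -> x = 0]].

Definition real_closure (P : set F) (R : rcfType) (f : {rmorphism F -> R}) :=
  (forall x, P x <-> 0 <= f x) /\ (forall y : R, algebraicOver f y).
End Orderings.

Section AlgebraWithInvolution.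
Variables (F : fieldType) (A : falgType F).

Definition centre := subvs_of 'Z({:A})%AS.
HB.instance Definition _ := Falgebra.on centre.

Definition simple_algebra : Prop :=
  forall I : {vspace A},
    (I * {:A} <= I)%VS -> ({:A} * I <= I)%VS -> I = 0%VS \/ I = {:A}%VS.

Definition centre_is_field : Prop :=
  forall z : A, z \in 'Z({:A})%VS -> z != 0 -> z \is a GRing.unit.

Variable sigma : A -> A.

Definition Sym : set A := [set x | sigma x = x].

Definition algebra_with_involution : Prop :=
  [/\ simple_algebra, centre_is_field,
      [/\ {morph sigma : x y / x + y},
          forall x y, sigma (x * y) = sigma y * sigma x
        & involutive sigma]
    & forall x, (x \in 'Z({:A})%VS /\ Sym x) <-> exists c : F, x = c%:A].

(* A right [A]-module is a left module over the converse ring [A^c]. *)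
Definition ract (M : lmodType A^c) (m : M) (a : A) : M := (a : A^c) *: m.

Record nonsingular_form := NonsingularForm {
  hmod : lmodType A^c;
  hval : hmod -> hmod -> A;
  hmod_fg : exists n (e : 'I_n -> hmod),
    forall m, exists c : 'I_n -> A, m = \sum_i ract (e i) (c i);
  hvalDr : forall x y z, hval x (y + z) = hval x y + hval x z;
  hvalMr : forall x y a, hval x (ract y a) = hval x y * a;
  hval_herm : forall x y, hval y x = sigma (hval x y);
  hval_nonsingular : forall phi : hmod -> A,
    {morph phi : x y / x + y} ->
    (forall x a, phi (ract x a) = phi x * a) ->
    exists! x, forall y, phi y = hval x y
}.

Definition form1 : A -> A -> A := fun x y => sigma x * y.

Definition copies (M : Type) (r : nat) (h : M -> M -> A) :
    ('I_r -> M) -> ('I_r -> M) -> A :=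
  fun x y => \sum_i h (x i) (y i).

Definition represented (M : Type) (h : M -> M -> A) : set A :=
  [set u | exists x, u = h x x].

Section Local.
Variables (R : rcfType) (f : {rmorphism F -> R}).

(* An isomorphism (A (x)_F R, sigma (x) id) -> (M_r(D), Int(Phi) o bar^t),
   given by its restriction [liso] to A: by R-linearity it suffices to check
   on A that the isomorphism is multiplicative and respects involutions. *)
Record local_iso := LocalIso {
  lkind : division_kind;
  ldeg : nat;
  liso : A -> 'M[divalg R lkind]_ldeg;
  lPhi : 'M[divalg R lkind]_ldeg;
  lPhi_inv : 'M[divalg R lkind]_ldeg;
  liso_ext : scalar_extension f *:%R (@scale_divalg R lkind _ _) liso;
  liso1 : liso 1 = 1%:M;
  lisoM : forall a b, liso (a * b) = liso a *m liso b;
  lPhiK : lPhi *m lPhi_inv = 1%:M;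
  lPhiVK : lPhi_inv *m lPhi = 1%:M;
  lPhi_herm : conj_tr lPhi = lPhi;
  liso_sigma : forall a,
    liso (sigma a) = lPhi *m conj_tr (liso a) *m lPhi_inv
}.

(* [psi] is an isometry from Phi^-1 (h (x) R) to (X, Y) |-> bar(X)^t B Y on
   M_{k,r}(D), given by its restriction to the underlying module of h. *)
Definition local_signature (mu : local_iso) (h : nonsingular_form) (n : int) :=
  exists k (psi : hmod h -> 'M[divalg R (lkind mu)]_(k, ldeg mu))
         (B : 'M[divalg R (lkind mu)]_k),
    [/\ scalar_extension f (fun c m => ract m c%:A)
          (@scale_divalg R (lkind mu) _ _) psi,
        forall m a, psi (ract m a) = psi m *m liso mu a,
        forall x y, lPhi_inv mu *m liso mu (hval x y) =
                    conj_tr (psi x) *m B *m psi y,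
        conj_tr B = B
      & sylvester_signature B n].
End Local.

(* [s] is a choice of the map s_{mu_P}, which is determined up to sign; it is
   given on nonsingular forms, which represent all the classes of the Witt
   group. *)
Definition is_signature_map (P : set F) (s : nonsingular_form -> int) : Prop :=
  exists (R : rcfType) (f : {rmorphism F -> R}),
    real_closure P f /\
    ((exists mu : local_iso f, forall h, local_signature mu h (s h)) \/
     (~ inhabited (local_iso f) /\ forall h, s h = 0)).

Definition Nil : set (set F) :=
  [set P | X_F P /\ exists s, is_signature_map P s /\ forall h, s h = 0].

Definition X_tilde : set (set F) := @X_F F `\` Nil.

(* The reduced trace is computed in any field extension L/K splitting A, i.e.
   such that A (x)_K L is isomorphic to M_n(L) as an L-algebra; [phi] is the
   restriction of the isomorphism to A. *)
Definition reduced_trace (Trd : A -> centre) : Prop :=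
  exists (L : fieldType) (g : {rmorphism centre -> L}) (n : nat)
         (phi : A -> 'M[L]_n),
    [/\ scalar_extension g (fun z a => vsval z * a) *:%R phi,
        phi 1 = 1%:M,
        forall a b, phi (a * b) = phi a *m phi b
      & forall a, g (Trd a) = \tr (phi a)].

Variable Trd : A -> centre.

Definition trace_form (x y : A) : centre := Trd (sigma x * y).

Definition trace_form_u (u x y : A) : centre := Trd (sigma x * u * y).

Definition psd_at (P : set F) (T : A -> A -> centre) : Prop :=
  forall x, exists2 c : F, T x x = c%:A & P c.

Definition X_sigma : set (set F) := [set P | X_F P /\ psd_at P trace_form].

Definition PS' : Prop :=
  forall u, Sym u ->
    (forall P, X_tilde P -> psd_at P (trace_form_u u)) <->
    (exists s : nat, represented (copies (r := (2 ^ s)%N) form1) u).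
End AlgebraWithInvolution.

(* Main.v *)
(* For c in F, c is a sum of hermitian squares unless some ordering P
   has -c >= 0 while no form <d_1,...,d_n>_sigma with all d_i > 0 at P embeds its
   negative: this is a Zorn's lemma argument on subgroups of F^* in the style of
   Artin and Schreier.  At a nil-ordering, however, such a form exists: over a
   real closure R the vanishing of all signatures yields an x with
   sigma(x) x = -1, and descending along the trace form of a simple extension of
   F inside R, which has positive signature, gives the form over F.  Hence, when
   the non-nil orderings are those at which sigma is positive, every nonzero c
   that is nonnegative at all of them is a sum of hermitian squares.  A symmetric
   u is a sum of terms b^-1 (u e) sigma(u e), where the b are the nonzero entries
   of a diagonalization of the trace form of u, so it is one too if that form is
   positive semidefinite.  Conversely, applying the trace to an isometric
   embedding of -h into such a form h shows that sigma is never positive at a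
   nil-ordering.

   The reduced trace is replaced by the regular trace, which agrees with it on
   symmetric elements up to a positive rational factor; in characteristic p there
   is no ordering and -1 is a sum of squares. *)
From HB Require Import structures.
Require Import Defs.
From mathcomp Require Import all_boot all_order all_algebra all_field.
From mathcomp Require Import classical_sets boolp complex ring zify.
Import Order.TTheory GRing.Theory Num.Theory.
Local Open Scope ring_scope.
Set Implicit Arguments.
Unset Strict Implicit.
Unset Printing Implicit Defensive.

(** * Orthogonal bases and trace forms *)

(** Forms are compared by isometric embeddings that are only [F]-linear, and Witt cancellation is
    not invoked. Its substitute, [embeds_cancel], removes a common summand at the price of doubling
    what remains; this is harmless, since only the existence of a form with given entries matters.
    It serves twice: to discard the hyperbolic summand <c, -c> that appears when the forms obtained
    from [c] and [-c] are added, and to discard the pairs <1, -1> after the descent. The link with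
    hermitian squares is through similarity factors: if [w d] embeds in a nonempty [d] whose entries
    are squares, then [w] is a sum of hermitian squares. A group of entries maximal for the absence
    of such a [d] is the positive cone of an ordering. Simplicity may be lost over a real closure,
    where the centre can become a product of two fields. Two facts survive, and the structure theory
    rests on them: the trace form has dual bases with Casimir element 1, and symmetric central
    elements are scalars. *)

Lemma label_preserving_injection (I J : finType) (T : eqType) (l : I -> T)
    (l' : J -> T) :
    (forall b, #|[pred i | l i == b]| <= #|[pred j | l' j == b]|)%N ->
  exists f : I -> J, injective f /\ forall i, l' (f i) = l i.
Proof.
(* An element goes to the one at the same position in the fibre of [l'] over its label. *)
move=> le_ll'; pose idx (b : T) := index^~ (enum [pred i | l i == b]).
have /fin_all_exists[f fP] i : exists j, l' j = l i
    /\ index j (enum [pred j | l' j == l i]) = idx (l i) i.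
  have lt_i : (idx (l i) i < size (enum [pred j | l' j == l i]))%N.
    rewrite -cardE; apply: leq_trans (le_ll' _).
    by rewrite cardE index_mem mem_enum inE.
  case E : (enum [pred j | l' j == l i]) lt_i => [|j0 s] // lt_i.
  exists (nth j0 (j0 :: s) (idx (l i) i)).
  have := mem_nth j0 lt_i; rewrite -E mem_enum => /eqP ->; split=> //.
  by rewrite index_uniq ?enum_uniq // E.
exists f; split=> [i i' eq_f|i]; last by case: (fP i).
have [li ii] := fP i; have [li' ii'] := fP i'.
have eq_l : l i = l i' by rewrite -li -li' eq_f.
move: ii; rewrite eq_f eq_l ii' /idx.
move/esym => /(congr1 (nth i (enum [pred k | l k == l i']))).
by rewrite !nth_index // mem_enum inE ?eq_l.
Qed.

Section OrthogonalBasis.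
Variables (F : fieldType) (V : vectType F) (b : V -> V -> F).
Hypothesis F2 : (2%:R : F) != 0.
Hypothesis b_linear : forall x, linear (b x : V -> F^o).
Hypothesis b_sym : forall x y, b x y = b y x.

Let bD x y z : b x (y + z) = b x y + b x z.
Proof. by have := b_linear x 1 y z; rewrite !scale1r. Qed.

Let b0 x : b x 0 = 0.
Proof. by apply: (addrI (b x 0)); rewrite -bD !addr0. Qed.

Let bZ x a y : b x (a *: y) = a * b x y.
Proof. by have := b_linear x a y 0; rewrite b0 !addr0. Qed.

Let bhom x : exists g : 'Hom(V, F^o), forall y, g y = b x y.
Proof.
pose B := GRing.isLinear.Build F V F^o _ (b x) (b_linear x).
pose f : {linear V -> F^o} := HB.pack (b x) B.
by exists (linfun f) => y; rewrite lfunE.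
Qed.

(** By induction on the dimension: split off a [v] with [b v v != 0]. If there is none, polarization
    makes [b] zero on [U] and any basis will do. Degenerate forms are allowed because the trace form
    of [u] is degenerate when [u] is not invertible. *)
Lemma orthogonal_basis_of (U : {vspace V}) : exists X : seq V,
  basis_of U X /\ pairwise (fun x y => b x y == 0) X.
Proof.
have [n] := ubnP (\dim U); elim: n U => // n IHn U; rewrite ltnS => le_Un.
have [[v vU bv]|Uiso] : (exists2 v, v \in U & b v v != 0) \/
    (forall x y, x \in U -> y \in U -> b x y = 0).
  have [/existsP[i bi]|] :=
      boolP [exists i : 'I_(\dim U), exists j : 'I_(\dim U),
               b (vbasis U)`_i (vbasis U)`_j != 0]; last first.
    rewrite negb_exists => /forallP /= bU; right=> x y xU yU.
    rewrite (coord_vbasis xU) b_sym.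
    pose P z := b y z = 0; apply: (big_ind P) => [|z z'|i _]; rewrite /P ?b0 //.
      by rewrite bD => -> ->; rewrite addr0.
    rewrite bZ b_sym (coord_vbasis yU).
    pose P' z := b (vbasis U)`_i z = 0.
    suff -> : P' (\sum_(j < \dim U) coord (vbasis U) j y *: (vbasis U)`_j).
      by rewrite mulr0.
    apply: (big_ind P') => [|z z'|j _]; rewrite /P' ?b0 //.
      by rewrite bD => -> ->; rewrite addr0.
    have := bU i; rewrite negb_exists => /forallP/(_ j); rewrite negbK.
    by rewrite bZ => /eqP->; rewrite mulr0.
  have /existsP[j bij] := bi.
  set x := (vbasis U)`_i in bij; set y := (vbasis U)`_j in bij.
  have xU : x \in U by rewrite vbasis_mem // mem_nth // size_tuple.
  have yU : y \in U by rewrite vbasis_mem // mem_nth // size_tuple.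
  left; have [bxx|] := eqVneq (b x x) 0; last by exists x.
  have [byy|] := eqVneq (b y y) 0; last by exists y.
  exists (x + y); first exact: rpredD.
  rewrite bD b_sym bD bxx add0r (b_sym (x + y)) bD byy addr0 (b_sym y x).
  by rewrite -mulr2n -mulr_natl mulf_neq0.
- have [g gE] := bhom v.
  have vW w : w \in lker g -> b v w = 0 by rewrite memv_ker gE => /eqP.
  have vNker : v \notin (U :&: lker g)%VS.
    by rewrite memv_cap memv_ker gE (negbTE bv) andbF.
  have UE : (<[v]> + (U :&: lker g))%VS = U.
    apply/eqP; rewrite eqEsubv subv_add -memvE vU capvSl /=.
    apply/subvP => w wU; pose a := b v w / b v v.
    rewrite -(subrK (a *: v) w) addrC memv_add ?rpredZ ?memv_line //.
    rewrite memv_cap rpredB ?rpredZ //= memv_ker linearB linearZ /= !gE.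
    by rewrite /a /GRing.scale /= divfK // subrr.
  have [|X [bX oX]] := IHn (U :&: lker g)%VS.
    apply: leq_trans le_Un; rewrite -{2}UE ltn_neqAle dimvS ?addvSr // andbT.
    apply: contra vNker => /eqP eq_dim.
    have /eqP -> : ((U :&: lker g) == (<[v]> + (U :&: lker g)))%VS.
      by rewrite eqEdim addvSr eq_dim leqnn.
    by rewrite (subvP (addvSl _ _)) // memv_line.
  exists (v :: X); split; last first.
    rewrite /= oX andbT; apply/allP => w wX; apply/eqP/vW.
    have : w \in (U :&: lker g)%VS by rewrite (basis_mem bX).
    by rewrite memv_cap => /andP[].
  rewrite -UE -cat1s; apply: cat_basis bX.
    apply/directv_addP/eqP; rewrite -subv0; apply/subvP => w.
    rewrite memv_cap => /andP[/vlineP[a ->]].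
    have [->|a0 avW] := eqVneq a 0; first by move=> _; rewrite scale0r mem0v.
    by case/negP: vNker; rewrite -(scalerK a0 v) rpredZ.
  by apply: seq1_basis; apply: contraNneq bv => ->; rewrite b0.
exists (vbasis U); split; first exact: vbasisP.
have : {subset tval (vbasis U) <= U} by move=> x; apply: vbasis_mem.
elim: (tval (vbasis U)) => //= x s IHs sub.
rewrite IHs ?andbT => [|y ys]; last by apply: sub; rewrite in_cons ys orbT.
apply/allP => y ys.
by rewrite Uiso //; apply: sub; rewrite in_cons ?eqxx ?ys ?orbT.
Qed.

Lemma orthogonal_basis : exists e : 'I_(\dim {:V}) -> V,
  (forall i j, i != j -> b (e i) (e j) = 0) /\
  (forall x, exists c, x = \sum_i c i *: e i).
Proof.
have [X [bX /(pairwiseP 0) oX]] := orthogonal_basis_of fullv.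
have szX : size X = \dim {:V} := esym (size_basis (X := in_tuple X) bX).
exists (fun i => X`_i); split=> [i j ij|x].
  have [ltij|] := ltnP i j; last rewrite leq_eqVlt eq_sym => /orP[/eqP/val_inj ij'|ltij].
  - by apply/eqP/oX; rewrite ?inE ?szX.
  - by rewrite ij' eqxx in ij.
  by rewrite b_sym; apply/eqP/oX; rewrite ?inE ?szX.
have xX : x \in <<in_tuple X>>%VS by rewrite (span_basis bX) memvf.
exists (coord (in_tuple X) ^~ x \o cast_ord (esym szX)).
rewrite {1}(coord_span xX) (reindex (cast_ord (esym szX))) //.
by apply: onW_bij; exists (cast_ord szX) => i; apply: val_inj.
Qed.
End OrthogonalBasis.

(** Over [R[i]] all eigenvalues vanish, so the characteristic polynomial is a power of ['X]. *)
Lemma mxtrace_nilpotent (R : rcfType) n (M : 'M[R]_n.+1) k : M ^+ k = 0 -> \tr M = 0.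
Proof.
move=> Mk; pose f := @real_complex R : {rmorphism R -> R[i]}; pose M' := map_mx f M.
have M'k : M' ^+ k = 0 by rewrite -rmorphXn Mk rmorph0.
have [rs] := closed_field_poly_normal (char_poly M').
rewrite (monicP (char_poly_monic M')) scale1r => chiE.
have rs0 z : z \in rs -> z = 0.
  move=> zrs; have : eigenvalue M' z.
    by rewrite eigenvalue_root_char chiE root_prod_XsubC.
  case/eigenvalueP => v vM v0; have : v *m M' ^+ k = z ^+ k *: v.
    elim: (k) => [|m IHm]; first by rewrite !expr0 mulmx1 scale1r.
    by rewrite exprSr mulmxA IHm -scalemxAl vM scalerA exprSr.
  rewrite M'k mulmx0 => /esym/eqP; rewrite scaler_eq0 (negbTE v0) orbF.
  by rewrite expf_eq0 => /andP[_ /eqP].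
have chiX : char_poly M' = 'X^(n.+1).
  have sz : size rs = n.+1.
    by have := size_char_poly M'; rewrite chiE size_prod_XsubC => -[].
  rewrite chiE -sz big_seq (eq_bigr (fun=> 'X)) => [|z /rs0->]; last by rewrite subr0.
  by rewrite -big_seq big_const_seq count_predT iter_mulr_1.
have := char_poly_trace M' isT; rewrite chiX coefXn ltn_eqF // => /esym/eqP.
rewrite oppr_eq0 => /eqP trM'; apply: (fmorph_inj f).
by rewrite rmorph0 -trM' /mxtrace rmorph_sum; apply: eq_bigr => i _; rewrite mxE.
Qed.

(** * Regular trace forms and the Casimir projection *)

Section TraceForm.
Variables (K : fieldType) (B : algType K) (t : B -> K) (N : nat) (f f' : 'I_N -> B).

(* [f] and [f'] are dual bases for the nondegenerate form [t (x * y)], which is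
   the regular trace form: its Casimir element is 1. *)
Definition regular_trace_data : Prop :=
  [/\ linear (t : B -> K^o), forall x y, t (x * y) = t (y * x),
      forall x, x = \sum_k t (f' k * x) *: f k & \sum_k f k * f' k = 1].

(** A trace-preserving projection of [B] onto its centre. *)
Definition casimir (y : B) : B := \sum_k f k * y * f' k.

Hypothesis tdata : regular_trace_data.

Let tl : linear (t : B -> K^o). Proof. by case: tdata. Qed.

Lemma trD x y : t (x + y) = t x + t y.
Proof. by have := tl 1 x y; rewrite !scale1r. Qed.
Lemma tr0 : t 0 = 0.
Proof. by apply: (addrI (t 0)); rewrite -trD !addr0. Qed.
Lemma trZ a x : t (a *: x) = a * t x.
Proof. by have := tl a x 0; rewrite tr0 !addr0. Qed.
Lemma tr_sum (I : Type) (r : seq I) (P : pred I) (F : I -> B) :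
  t (\sum_(i <- r | P i) F i) = \sum_(i <- r | P i) t (F i).
Proof. exact: (big_morph t trD tr0). Qed.
Lemma trN x : t (- x) = - t x.
Proof. by rewrite -scaleN1r trZ mulN1r. Qed.
Lemma trC x y : t (x * y) = t (y * x).
Proof. by case: tdata. Qed.
Lemma dual_expand x : x = \sum_k t (f' k * x) *: f k.
Proof. by case: tdata => _ _ + _; apply. Qed.
Lemma casimir1 : \sum_k f k * f' k = 1.
Proof. by case: tdata. Qed.

Lemma tr_nondegenerate x : (forall y, t (x * y) = 0) -> x = 0.
Proof.
by move=> tx; rewrite (dual_expand x) big1 // => k _; rewrite trC tx scale0r.
Qed.

Lemma dual_expand' x : x = \sum_k t (x * f k) *: f' k.
Proof.
apply/eqP; rewrite -subr_eq0; apply/eqP/tr_nondegenerate => y.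
rewrite mulrBl trD trN {1}(dual_expand y) mulr_sumr mulr_suml !tr_sum -sumrB big1 // => k _.
by rewrite -scalerAr -scalerAl !trZ mulrC subrr.
Qed.

Lemma casimirE y : casimir y = \sum_k f' k * y * f k.
Proof.
rewrite /casimir; under eq_bigr => m _ do rewrite {1}(dual_expand' (f m)) !mulr_suml.
rewrite exchange_big; apply: eq_bigr => k _ /=.
rewrite [in RHS](dual_expand' (f k)) mulr_sumr; apply: eq_bigr => m _.
by rewrite -!scalerAl -scalerAr trC.
Qed.

(** The expansions of [b * f k] in [f] and of [f' l * b] in [f'] have the same coefficients
    [t (f' l * b * f k)]. *)
Lemma casimir_central y b : b * casimir y = casimir y * b.
Proof.
rewrite /casimir mulr_sumr mulr_suml.
under eq_bigr => k _ do rewrite mulrA (mulrA b) {1}(dual_expand (b * f k)) !mulr_suml.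
rewrite exchange_big; apply: eq_bigr => l _ /=.
rewrite -[RHS]mulrA [in RHS](dual_expand' (f' l * b)) mulr_sumr; apply: eq_bigr => k _.
by rewrite -!scalerAl -scalerAr mulrA.
Qed.

Lemma casimir_one : casimir 1 = 1.
Proof. by rewrite -[RHS]casimir1; apply: eq_bigr => k _; rewrite mulr1. Qed.

Lemma casimir1' : \sum_k f' k * f k = 1.
Proof. by rewrite -casimir_one casimirE; apply: eq_bigr => k _; rewrite mulr1. Qed.

Lemma tr_casimir y : t (casimir y) = t y.
Proof.
rewrite tr_sum -[in RHS](mulr1 y) -casimir1' mulr_sumr tr_sum; apply: eq_bigr => k _.
by rewrite -mulrA trC mulrA.
Qed.

(** The trace of the endomorphism [g], read off from the dual bases. *)
Definition op_tr (g : B -> B) : K := \sum_k t (f' k * g (f k)).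

Lemma op_trC (g h : B -> B) : linear g -> linear h -> op_tr (g \o h) = op_tr (h \o g).
Proof.
have expand (g' h' : B -> B) : linear g' -> op_tr (g' \o h')
    = \sum_k \sum_l t (f' l * h' (f k)) * t (f' k * g' (f l)).
  move=> g'l; pose L := GRing.isLinear.Build K B B _ g' g'l.
  pose G : {linear B -> B} := HB.pack g' L.
  apply: eq_bigr => k _; rewrite /= {1}(dual_expand (h' (f k))) -[g']/(G : B -> B).
  rewrite linear_sum mulr_sumr tr_sum; apply: eq_bigr => l _.
  by rewrite linearZ -scalerAr trZ.
move=> gl hl; rewrite !expand // exchange_big; apply: eq_bigr => k _.
by apply: eq_bigr => l _; rewrite mulrC.
Qed.

Lemma op_tr_mull y : op_tr (fun x => y * x) = t y.
Proof.
rewrite -[in RHS](mulr1 y) -casimir1 mulr_sumr tr_sum; apply: eq_bigr => k _.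
by rewrite trC mulrA.
Qed.

Lemma op_tr_mulr y : op_tr (fun x => x * y) = t y.
Proof.
rewrite -[in RHS](mul1r y) -casimir1' mulr_suml tr_sum; apply: eq_bigr => k _.
by rewrite mulrA.
Qed.

Section Involution.
Variable s : B -> B.
Hypothesis sl : linear s.
Hypothesis sM : forall x y, s (x * y) = s y * s x.
Hypothesis sK : involutive s.

Let sD x y : s (x + y) = s x + s y.
Proof. by have := sl 1 x y; rewrite !scale1r. Qed.
Let s0 : s 0 = 0.
Proof. by apply: (addrI (s 0)); rewrite -sD !addr0. Qed.
Let sZ a x : s (a *: x) = a *: s x.
Proof. by have := sl a x 0; rewrite s0 !addr0. Qed.
Let s_sum n (g : 'I_n -> B) : s (\sum_k g k) = \sum_k s (g k).
Proof. exact: (big_morph s sD s0). Qed.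

(** Conjugation by [s] turns right multiplication by [y] into left multiplication by [s y]; the
    traces of these operators are [t y] and [t (s y)]. *)
Lemma tr_invol y : t (s y) = t y.
Proof.
have yl : linear (fun x : B => x * y) by move=> a u v; rewrite mulrDl scalerAl.
rewrite -(op_tr_mulr y) -(op_tr_mull (s y)).
transitivity (op_tr (s \o (fun x => s x * y))).
  by apply: eq_bigr => k _; rewrite /= sM sK.
rewrite op_trC //; last by move=> a u v; rewrite /= sl yl.
by apply: eq_bigr => k _; rewrite /= sK.
Qed.

(** As [t] is invariant under [s], the families [s (f k)] and [s (f' k)] are again dual, and the
    Casimir projection does not depend on the dual pair. *)
Lemma casimir_invol y : s (casimir y) = casimir (s y).
Proof.
have gexp x : x = \sum_k t (x * s (f k)) *: s (f' k).
  rewrite -[LHS]sK {1}(dual_expand' (s x)) s_sum; apply: eq_bigr => k _.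
  by rewrite sZ -tr_invol sM sK trC.
rewrite {1}/casimir s_sum casimirE.
transitivity (\sum_k s (f' k) * s y * s (f k)).
  by apply: eq_bigr => k _; rewrite !sM mulrA.
under eq_bigr => k _ do rewrite (dual_expand (s (f k))) mulr_sumr.
rewrite exchange_big; apply: eq_bigr => l _ /=.
rewrite [in RHS](gexp (f' l)) !mulr_suml; apply: eq_bigr => k _.
by rewrite -scalerAr !scalerAl.
Qed.

(* If the [b i] are the values of a diagonalization [e] of [t (s x * u * y)],
   then [sum_i (u * e i) (x) (s (e i) * u) / b i] and [sum_k (u * f k) (x) f' k]
   represent the same endomorphism, [x |-> u * x], of [B]. *)
Lemma diagonal_trace_form_sum (u : B) n (e : 'I_n -> B) :
    s u = u -> (forall i j, i != j -> t (s (e i) * u * e j) = 0) ->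
    (forall x, exists c, x = \sum_i c i *: e i) ->
  let b i := t (s (e i) * u * e i) in
  u = \sum_(i | b i != 0) (b i)^-1 *: (u * e i * s (u * e i)).
Proof.
move=> su eo espan b.
(* Such an [e i] is orthogonal to every [e j], so it lies in the radical of the form. *)
have ker i : b i = 0 -> u * e i = 0.
  move=> bi; apply: tr_nondegenerate => y; have [c yE] := espan (s y).
  rewrite trC -[y]sK yE.
  rewrite s_sum mulr_suml tr_sum big1 // => j _.
  rewrite sZ -scalerAl trZ mulrA.
  have [->|ji] := eqVneq j i; first by rewrite -/(b i) bi mulr0.
  by rewrite eo // mulr0.
have ux x : u * x = \sum_(i | b i != 0) ((b i)^-1 * t (s (e i) * u * x)) *: (u * e i).
  have [c ->] := espan x; rewrite mulr_sumr [LHS](bigID (fun i => b i != 0)) /=.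
  rewrite [X in _ + X]big1 ?addr0 => [|i /negPn/eqP/ker uei]; last first.
    by rewrite -scalerAr uei scaler0.
  apply: eq_bigr => i bi; rewrite -scalerAr; congr (_ *: _).
  rewrite mulr_sumr tr_sum (bigD1 i) //= big1 ?addr0 => [|j ji].
    by rewrite -scalerAr trZ -/(b i) mulrCA mulVf ?mulr1.
  by rewrite -scalerAr trZ eo ?mulr0 // eq_sym.
rewrite -[LHS]mulr1 -casimir1 mulr_sumr.
under eq_bigr => k _ do rewrite mulrA ux mulr_suml.
rewrite exchange_big; apply: eq_bigr => i bi /=.
rewrite sM su [in RHS](dual_expand' (s (e i) * u)) mulr_sumr scaler_sumr.
by apply: eq_bigr => k _; rewrite -scalerAl -scalerAr scalerA.
Qed.
End Involution.
End TraceForm.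

Section Nilpotent.
Variables (R : rcfType) (B : algType R) (t : B -> R) (N : nat) (f f' : 'I_N -> B).
Hypothesis tdata : regular_trace_data t f f'.

(** Left multiplication by [x], written with rows and therefore anti-multiplicative. Since [f] is
    not assumed free, [regmx 1] is only an idempotent matrix. *)
Definition regmx (x : B) : 'M[R]_N := \matrix_(i, j) t (f' j * (x * f i)).

Lemma regmxM x y : regmx (x * y) = regmx y *m regmx x.
Proof.
apply/matrixP => i j; rewrite !mxE -mulrA [y * _](dual_expand tdata).
rewrite mulr_sumr mulr_sumr (tr_sum tdata); apply: eq_bigr => k _.
by rewrite !mxE -!scalerAr (trZ tdata).
Qed.

Lemma regmx_inj x : regmx x = 0 -> x = 0.
Proof.
move=> x0; rewrite -[x]mulr1 -(casimir1 tdata) mulr_sumr big1 // => i _.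
rewrite mulrA [x * f i](dual_expand tdata) mulr_suml big1 // => j _.
by move/matrixP/(_ i j): x0; rewrite !mxE => ->; rewrite scale0r mul0r.
Qed.

Lemma regmx_linear : linear regmx.
Proof.
move=> a x y; apply/matrixP => i j.
by rewrite !mxE mulrDl mulrDr (trD tdata) -scalerAl -scalerAr (trZ tdata).
Qed.

Lemma tr_regmx x : \tr (regmx x) = t x.
Proof. by rewrite -(op_tr_mull tdata x); apply: eq_bigr => k _; rewrite mxE. Qed.
End Nilpotent.

(** * Diagonal hermitian forms *)

Section DiagonalForms.
Variables (F : fieldType) (A : falgType F) (sigma : A -> A).
Hypothesis sigmaD : {morph sigma : x y / x + y}.
Hypothesis sigmaZ : forall (c : F) x, sigma (c *: x) = c *: sigma x.

Definition hform (I : finType) (d : I -> F) (x y : {ffun I -> A}) : A :=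
  \sum_i d i *: (sigma (x i) * y i).

(* The isometries are only required to be [F]-linear: neither cancellation nor
   the trace argument uses [A]-linearity. *)
Definition embeds (I J : finType) (d : I -> F) (e : J -> F) : Prop :=
  exists T : {ffun I -> A} -> {ffun J -> A},
    linear T /\ forall x y, hform e (T x) (T y) = hform d x y.

Lemma sigma_sum (I : finType) (P : pred I) (f : I -> A) :
  sigma (\sum_(i | P i) f i) = \sum_(i | P i) sigma (f i).
Proof.
have s0 : sigma 0 = 0 by have := sigmaZ 0 0; rewrite !scale0r.
exact: (big_morph sigma sigmaD s0).
Qed.

Section Hform.
Variables (I : finType) (d : I -> F).
Implicit Types x y z : {ffun I -> A}.

Lemma hformDl x y z : hform d (x + y) z = hform d x z + hform d y z.
Proof.
by rewrite -big_split; apply: eq_bigr => i _; rewrite /= ffunE sigmaD mulrDl scalerDr.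
Qed.

Lemma hformDr x y z : hform d z (x + y) = hform d z x + hform d z y.
Proof.
by rewrite -big_split; apply: eq_bigr => i _; rewrite /= ffunE mulrDr scalerDr.
Qed.

Lemma hformZl c x y : hform d (c *: x) y = c *: hform d x y.
Proof.
rewrite scaler_sumr; apply: eq_bigr => i _.
by rewrite ffunE sigmaZ -scalerAl !scalerA mulrC.
Qed.

Lemma hformZr c x y : hform d x (c *: y) = c *: hform d x y.
Proof.
rewrite scaler_sumr; apply: eq_bigr => i _.
by rewrite ffunE -scalerAr !scalerA mulrC.
Qed.

End Hform.

Lemma embeds_mx (I J : finType) (d : I -> F) (e : J -> F) (M : J -> I -> F) :
    (forall i i', \sum_j e j * (M j i * M j i') = if i == i' then d i else 0) ->
  embeds d e.
Proof.
move=> dM; exists (fun x => [ffun j => \sum_i M j i *: x i]); split.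
  move=> a x y; apply/ffunP => j; rewrite !ffunE scaler_sumr -big_split.
  by apply: eq_bigr => i _; rewrite !ffunE scalerDr !scalerA mulrC.
move=> x y; rewrite /hform.
transitivity (\sum_j \sum_i \sum_i' (e j * (M j i * M j i')) *: (sigma (x i) * y i')).
  apply: eq_bigr => j _; rewrite !ffunE sigma_sum mulr_suml scaler_sumr.
  apply: eq_bigr => i _; rewrite mulr_sumr scaler_sumr.
  apply: eq_bigr => i' _.
  by rewrite sigmaZ -scalerAl -scalerAr !scalerA !mulrA.
rewrite exchange_big; apply: eq_bigr => i _ /=.
rewrite exchange_big (bigD1 i) //= -scaler_suml dM eqxx big1 ?addr0 // => i' /negbTE ii'.
by rewrite -scaler_suml dM eq_sym ii' scale0r.
Qed.

Lemma embeds_reindex (I J : finType) (d : I -> F) (e : J -> F) (phi : I -> J)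
    (s : I -> F) : injective phi -> (forall i, d i = e (phi i) * s i ^+ 2) ->
  embeds d e.
Proof.
move=> phiI ds; apply: (@embeds_mx _ _ _ _ (fun j i => if j == phi i then s i else 0)).
move=> i i'; rewrite (bigD1 (phi i)) //= eqxx big1 ?addr0 => [|j /negbTE->].
  rewrite (inj_eq phiI) ds; case: eqP => [<-|_]; last by rewrite !mulr0.
  by rewrite expr2.
by rewrite mul0r mulr0.
Qed.

Lemma embeds_refl (I : finType) (d : I -> F) : embeds d d.
Proof. by exists id. Qed.

Lemma embeds_trans (I J K : finType) (d : I -> F) (e : J -> F) (g : K -> F) :
  embeds d e -> embeds e g -> embeds d g.
Proof.
move=> [T [Tl hT]] [T' [T'l hT']]; exists (T' \o T); split=> [a x y|x y] /=.
  by rewrite Tl T'l.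
by rewrite hT' hT.
Qed.

Lemma embeds_scale (I J : finType) (d : I -> F) (e : J -> F) c :
  embeds d e -> embeds (fun i => c * d i) (fun j => c * e j).
Proof.
move=> [T [Tl hT]]; exists T; split=> // x y.
have hE (K : finType) (g : K -> F) z t : hform (fun i => c * g i) z t = c *: hform g z t.
  by rewrite scaler_sumr; apply: eq_bigr => i _; rewrite scalerA.
by rewrite !hE hT.
Qed.

Definition dsum (I J : finType) (d : I -> F) (e : J -> F) (k : I + J) : F :=
  match k with inl i => d i | inr j => e j end.

Definition fglue (I J : finType) (x : {ffun I -> A}) (y : {ffun J -> A}) :
    {ffun I + J -> A} :=
  [ffun k => match k with inl i => x i | inr j => y j end].
Definition fsl (I J : finType) (x : {ffun I + J -> A}) : {ffun I -> A} :=
  [ffun i => x (inl i)].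
Definition fsr (I J : finType) (x : {ffun I + J -> A}) : {ffun J -> A} :=
  [ffun i => x (inr i)].

Lemma fslK (I J : finType) (x : {ffun I -> A}) (y : {ffun J -> A}) :
  fsl (fglue x y) = x.
Proof. by apply/ffunP => i; rewrite !ffunE. Qed.
Lemma fsrK (I J : finType) (x : {ffun I -> A}) (y : {ffun J -> A}) :
  fsr (fglue x y) = y.
Proof. by apply/ffunP => i; rewrite !ffunE. Qed.
Lemma fsl_linear (I J : finType) : linear (@fsl I J).
Proof. by move=> a x y; apply/ffunP => i; rewrite !ffunE. Qed.
Lemma fsr_linear (I J : finType) : linear (@fsr I J).
Proof. by move=> a x y; apply/ffunP => i; rewrite !ffunE. Qed.
Lemma fglue_linear (I J : finType) a (x x' : {ffun I -> A}) (y y' : {ffun J -> A}) :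
  fglue (a *: x + x') (a *: y + y') = a *: fglue x y + fglue x' y'.
Proof. by apply/ffunP => -[i|i]; rewrite !ffunE. Qed.

Lemma hform_dsum (I J : finType) (d : I -> F) (e : J -> F) x y :
  hform (dsum d e) x y = hform d (fsl x) (fsl y) + hform e (fsr x) (fsr y).
Proof.
rewrite /hform big_sumType /=.
by congr (_ + _); apply: eq_bigr => i _; rewrite !ffunE.
Qed.

Lemma embeds_dsum (I J I' J' : finType) (d : I -> F) (e : J -> F)
    (d' : I' -> F) (e' : J' -> F) :
  embeds d e -> embeds d' e' -> embeds (dsum d d') (dsum e e').
Proof.
move=> [T [Tl hT]] [T' [T'l hT']].
exists (fun x => fglue (T (fsl x)) (T' (fsr x))); split=> [a x y|x y].
  by rewrite fsl_linear fsr_linear Tl T'l fglue_linear.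
by rewrite !hform_dsum !fslK !fsrK hT hT'.
Qed.

Definition dtensor (I K : finType) (d : I -> F) (g : K -> F) (p : I * K) : F :=
  d p.1 * g p.2.

Lemma embeds_dtensor (I J K : finType) (d : I -> F) (e : J -> F) (g : K -> F) :
  embeds d e -> embeds (dtensor d g) (dtensor e g).
Proof.
move=> [T [Tl hT]].
pose sl (L : finType) (x : {ffun L * K -> A}) k : {ffun L -> A} := [ffun i => x (i, k)].
have slT (L : finType) (c : L -> F) x y :
    hform (dtensor c g) x y = \sum_k g k *: hform c (sl L x k) (sl L y k).
  under [RHS]eq_bigr do rewrite scaler_sumr.
  rewrite exchange_big pair_bigA; apply: eq_bigr => -[i k] _ /=.
  by rewrite !ffunE scalerA mulrC.
exists (fun x => [ffun p => T (sl I x p.2) p.1]); split=> [a x y|x y].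
  apply/ffunP => -[i k]; rewrite !ffunE /=.
  have -> : sl I (a *: x + y) k = a *: sl I x k + sl I y k.
    by apply/ffunP => j; rewrite !ffunE.
  by rewrite Tl !ffunE.
rewrite !slT; apply: eq_bigr => k _; rewrite -hT; congr (_ *: hform e _ _).
  by apply/ffunP => j; rewrite !ffunE.
by apply/ffunP => j; rewrite !ffunE.
Qed.

Lemma embeds_eq (I J : finType) (d d' : I -> F) (e e' : J -> F) :
  d =1 d' -> e =1 e' -> embeds d e -> embeds d' e'.
Proof.
move=> dd' ee' [T [Tl hT]]; exists T; split=> // x y.
transitivity (hform d x y); last by apply: eq_bigr => i _; rewrite dd'.
by rewrite -hT; apply: eq_bigr => i _; rewrite ee'.
Qed.

Definition dbool (a b : F) (x : bool) : F := if x then a else b.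

Lemma embeds_hyperbolic (a b : F) : (2%:R : F) != 0 -> b != 0 ->
  embeds (dbool a (- a)) (dbool b (- b)).
Proof.
move=> F2 b0.
(* In the isotropic coordinates x + y and x - y, the first is multiplied by a / b and the second is
   kept. *)
apply: (@embeds_mx _ _ _ _
  (fun x y => if x == y then (a / b + 1) / 2%:R else (a / b - 1) / 2%:R)).
by move=> [] []; rewrite big_bool /=; field; rewrite b0 F2.
Qed.

(** The vectors (1, 1) and (b, -a) are orthogonal for <a, b>; the second matrix is the inverse of
    the one they form. *)
Lemma embeds_add (a b : F) : a + b != 0 ->
  embeds (dbool (a + b) (a * b * (a + b))) (dbool a b) /\
  (embeds (dbool a b) (dbool (a + b) (a * b * (a + b)))).
Proof.
move=> ab; split.
  apply: (@embeds_mx _ _ _ _ (fun x y => if y then 1 else if x then b else - a)).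
  by move=> [] []; rewrite big_bool /=; ring.
apply: (@embeds_mx _ _ _ _ (fun x y =>
  if x then (if y then a else b) / (a + b) else (if y then 1 else - 1) / (a + b))).
by move=> [] []; rewrite big_bool /=; field.
Qed.

(** * Cancellation up to doubling *)

Section Cancellation.
Hypothesis F0 : [pchar F] =i pred0.

(** For invertible [D], the [w t] would be eigenvectors of D + D^-1 for distinct eigenvalues. The
    usual elimination still works without inverting [D], because [D (w t) = 0] already forces
    [w t = 0]. *)
Lemma pencil_kernel_independent (V : vectType F) (D : 'End(V)) (T : eqType)
    (c : T -> F) (w : T -> V) (s : seq T) :
    injective c -> uniq s -> (forall t, D (D (w t)) + w t = c t *: D (w t)) ->
  \sum_(t <- s) w t = 0 -> forall t, t \in s -> w t = 0.
Proof.
move=> cI; elim: s w => //= t0 s IHs w /andP[t0s us] wE ws0.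
have ker0 t : D (w t) = 0 -> w t = 0.
  by move=> Dw; have := wE t; rewrite Dw linear0 scaler0 add0r.
have s0 t : t \in s -> w t = 0.
  move=> ts; apply: ker0.
  have /eqP : (c t - c t0) *: D (w t) = 0.
    apply: (IHs (fun t => (c t - c t0) *: D (w t))) => // [u|].
      by rewrite !linearZ /= -scalerDr -linearD wE linearZ /= !scalerA mulrC.
    transitivity (\sum_(u <- t0 :: s) (c u - c t0) *: D (w u)).
      by rewrite big_cons subrr scale0r add0r.
    under eq_bigr do rewrite scalerBl -wE.
    rewrite sumrB big_split /= -scaler_sumr -!linear_sum /= ws0.
    by rewrite !linear0 !addr0.
  rewrite scaler_eq0 subr_eq0 (inj_eq cI) => /orP[/eqP tt0|/eqP //].
  by rewrite -tt0 ts in t0s.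
move=> t; rewrite inE => /orP[/eqP->|/s0 //].
by move: ws0; rewrite big_cons big_seq big1 ?addr0.
Qed.

Lemma char0_natf_neq0 n : (n.+1%:R : F) != 0.
Proof. by move/pcharf0P: F0 => ->. Qed.

(** The rational points of the circle with parameter [k] give infinitely many values [c k]. By the
    independence above, at most dim V of them admit a nonzero [x]. *)
Lemma rotation_avoiding_spectrum (V : vectType F) (D : 'End(V)) :
  exists c s : F, c ^+ 2 + s ^+ 2 = 1 /\
    forall x, D (D x) - (2%:R * c) *: D x + x = 0 -> x = 0.
Proof.
pose q (k : nat) : F := 1 + k%:R ^+ 2.
have q0 k : q k != 0 by rewrite /q -natrX addrC natr1 char0_natf_neq0.
pose c k := (1 - k%:R ^+ 2) / q k; pose s k := 2%:R * k%:R / q k.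
have c2 k : c k ^+ 2 + s k ^+ 2 = 1 by rewrite /c /s /q; field; apply: q0.
apply: contrapT => bad.
have /choice[w wP] k : exists x, D (D x) + x = (2%:R * c k) *: D x /\ x <> 0.
  apply: contrapT => nox; apply: bad; exists (c k), (s k); split=> // x Dx.
  apply: contrapT => x0; apply: nox; exists x; split=> //.
  by apply/eqP; rewrite -subr_eq0 addrAC Dx.
have cI : injective (fun k : 'I_(\dim {:V}).+1 => 2%:R * c k).
  move=> k l ckl; apply: val_inj => /=.
  have {}ckl : c k = c l by apply: (mulfI (char0_natf_neq0 1)).
  have : q k = q l.
    have cq m : c m = 2%:R / q m - 1 by rewrite /c /q; field; apply: q0.
    move: ckl; rewrite !cq => /addIr /(mulfI (char0_natf_neq0 1)).
    exact: invr_inj.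
  rewrite /q => /addrI; rewrite -!natrX => /eqP.
  rewrite -subr_eq0; case: (leqP (k ^ 2) (l ^ 2)) => [le_kl|lt_lk].
    rewrite -opprB -natrB // oppr_eq0; case E: (_ - _)%N => [|m]; last first.
      by rewrite (negbTE (char0_natf_neq0 m)).
    move=> _; apply/eqP; rewrite -(eqn_exp2r _ _ (isT : 0 < 2)%N) eqn_leq le_kl.
    by rewrite -subn_eq0 E.
  rewrite -natrB 1?ltnW //; case E: (_ - _)%N => [|m]; last first.
    by rewrite (negbTE (char0_natf_neq0 m)).
  by move/eqP: E; rewrite subn_eq0 leqNgt lt_lk.
have : free [tuple w i | i < (\dim {:V}).+1].
  apply/freeP => a aw0 i; have := @pencil_kernel_independent V D _
    (fun k : 'I_(\dim {:V}).+1 => 2%:R * c k) (fun k => a k *: w k)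
    (index_enum _) cI (index_enum_uniq _) _ _ i (mem_index_enum _).
  move=> /(_ _ _)/eqP; rewrite scaler_eq0 => aiw.
  have /orP[/eqP //|/eqP wi0] : (a i == 0) || (w i == 0); last by case: (wP i).
  apply: aiw => [t|]; last first.
    by rewrite -[RHS]aw0; apply: eq_bigr => j _; rewrite -tnth_nth tnth_mktuple.
  by rewrite !linearZ /= -scalerDr (wP t).1 !scalerA mulrC.
move=> /eqP; rewrite size_tuple => dimX.
by have := dimvS (subvf <<[tuple w i | i < (\dim {:V}).+1]>>%VS); rewrite dimX ltnn.
Qed.

Lemma linear_lfun (V W : vectType F) (T : V -> W) :
  linear T -> exists f : 'Hom(V, W), f =1 T.
Proof.
move=> Tl; pose B := GRing.isLinear.Build F V W _ T Tl.
pose f : {linear V -> W} := HB.pack T B.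
by exists (linfun f) => x; rewrite lfunE.
Qed.

(* Requiring the [g]-components of the images of two vectors to be the rotation
   by [(c, s)] of the [g]-components of the vectors determines the latter. *)
Lemma embeds_cancel (I J U : finType) (d : I -> F) (e : J -> F) (g : U -> F) :
  embeds (dsum d g) (dsum e g) -> embeds (dsum d d) (dsum e e).
Proof.
move=> [T [Tl hT]].
have TD x y : T (x + y) = T x + T y by have := Tl 1 x y; rewrite !scale1r.
have [C CE] : exists f : 'Hom({ffun I -> A}, {ffun U -> A}),
    f =1 (fun x => fsr (T (fglue x 0))).
  apply: linear_lfun => a x y.
  by rewrite -fsr_linear -Tl -fglue_linear scaler0 addr0.
have [D DE] : exists f : 'End({ffun U -> A}), f =1 (fun x => fsr (T (fglue 0 x))).
  apply: linear_lfun => a x y.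
  by rewrite -fsr_linear -Tl -fglue_linear scaler0 addr0.
have TE x y : fsr (T (fglue x y)) = C x + D y.
  have <- : fglue x 0 + fglue 0 y = fglue x y.
    by have := fglue_linear 1 x 0 0 y; rewrite !scale1r addr0 add0r.
  by rewrite TD CE DE; have := fsr_linear 1 (T (fglue x 0)) (T (fglue 0 y)); rewrite !scale1r.
have [c [s [cs ker0]]] := rotation_avoiding_spectrum D.
(* The equations [YE1] and [YE2] below form a linear system for [Y1], [Y2] with determinant (c -
   D)^2 + s^2, which is [Th] since c^2 + s^2 = 1. Cramer's rule gives the formulas for [Y1] and
   [Y2], with [P] standing for (c - D) G. *)
pose Th := (D \o D - (2%:R * c) *: D + \1)%VF.
have ThE x : Th x = D (D x) - (2%:R * c) *: D x + x.
  by rewrite /Th !add_lfunE opp_lfunE scale_lfunE comp_lfunE id_lfunE.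
have Th0 : lker Th == 0%VS.
  apply/lker0P => x y /eqP; rewrite -subr_eq0 -linearB /= ThE => /eqP/ker0/eqP.
  by rewrite subr_eq0 => /eqP.
pose G := (Th^-1 \o C)%VF.
have GE x : D (D (G x)) - (2%:R * c) *: D (G x) + G x = C x.
  by rewrite -ThE /G comp_lfunE lker0_lfunVK.
have [P PE] : exists P, forall x, P x = c *: G x - D (G x) by eexists.
have DB u v : D (u - v) = D u - D v by exact: linearB.
have DD u v : D (u + v) = D u + D v by exact: linearD.
have DZ a v : D (a *: v) = a *: D v by exact: linearZ.
have CxE x : C x = c *: P x - D (P x) + s ^+ 2 *: G x.
  rewrite -GE PE DB DZ scalerBr scalerA -expr2 opprB.
  rewrite mulr_natl mulr2n scalerDl opprD.
  rewrite -[X in _ + X = _]scale1r -cs scalerDl.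
  by rewrite [LHS](AC ((1*2)*2) (((4*2)*(1*3))*5)).
pose Y1 x1 x2 := P x1 + s *: G x2.
pose Y2 x1 x2 := P x2 - s *: G x1.
have YE1 x1 x2 : C x1 + D (Y1 x1 x2) = c *: Y1 x1 x2 - s *: Y2 x1 x2.
  rewrite CxE /Y1 /Y2 (PE x2) DD DZ !(scalerBr, scalerDr, opprB) !scalerA.
  rewrite -expr2 (mulrC s c) [LHS](AC (3*2) ((1*3*5)*(4*2))) /= subrr addr0.
  by rewrite [RHS](AC (2*(1*2)) ((1*3*4)*(2*5))) /= subrr addr0.
have YE2 x1 x2 : C x2 + D (Y2 x1 x2) = s *: Y1 x1 x2 + c *: Y2 x1 x2.
  rewrite CxE /Y1 /Y2 (PE x1) DB DZ !(scalerBr, scalerDr, opprB) !scalerA.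
  rewrite -expr2 (mulrC s c) [LHS](AC (3*2) ((1*3*5)*(4*2))) /= subrr addr0.
  by rewrite [RHS](AC (3*2) ((4*3*2)*(1*5))) /= subrr addr0.
pose T1 z := fsl (T (fglue (fsl z) (Y1 (fsl z) (fsr z)))).
pose T2 z := fsl (T (fglue (fsr z) (Y2 (fsl z) (fsr z)))).
exists (fun z => fglue (T1 z) (T2 z)); split=> [a x y|x y].
  have H u v u' v' : a *: fsl (T (fglue u v)) + fsl (T (fglue u' v'))
      = fsl (T (fglue (a *: u + u') (a *: v + v'))).
    by rewrite fglue_linear Tl fsl_linear.
  rewrite -fglue_linear /T1 /T2 !H !fsl_linear !fsr_linear.
  have GL u v : G (a *: u + v) = a *: G u + G v by rewrite linearP.
  have Plin u v : P (a *: u + v) = a *: P u + P v.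
    rewrite !PE GL DD DZ !(scalerBr, scalerDr) !scalerA (mulrC c) opprD.
    by rewrite [LHS](AC (2*2) ((1*3)*(2*4))).
  congr (fglue (fsl (T (fglue _ _))) (fsl (T (fglue _ _)))).
    rewrite /Y1 Plin GL !scalerDr !scalerA (mulrC s).
    by rewrite [LHS](AC (2*2) ((1*3)*(2*4))).
  rewrite /Y2 Plin GL !(scalerBr, scalerDr) !scalerA (mulrC s) opprD.
  by rewrite [LHS](AC (2*2) ((1*3)*(2*4))).
have hE x1 y1 x2 y2 : hform d x1 x2 + hform g y1 y2
    = hform e (fsl (T (fglue x1 y1))) (fsl (T (fglue x2 y2)))
      + hform g (fsr (T (fglue x1 y1))) (fsr (T (fglue x2 y2))).
  by rewrite -hform_dsum hT hform_dsum !fslK !fsrK.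
rewrite !hform_dsum !fslK !fsrK.
have := hE (fsl x) (Y1 (fsl x) (fsr x)) (fsl y) (Y1 (fsl y) (fsr y)).
have := hE (fsr x) (Y2 (fsl x) (fsr x)) (fsr y) (Y2 (fsl y) (fsr y)).
rewrite !TE !YE1 !YE2 -/(T1 x) -/(T1 y) -/(T2 x) -/(T2 y).
move: (Y1 _ (fsr x)) (Y2 _ (fsr x)) (Y1 _ (fsr y)) (Y2 _ (fsr y)) => y1 y2 y1' y2' e2 e1.
(* The rotation is an isometry of two copies of [g], so the [g]-terms agree on both sides and
   cancel. *)
have rot : hform g (c *: y1 - s *: y2) (c *: y1' - s *: y2')
    + hform g (s *: y1 + c *: y2) (s *: y1' + c *: y2')
    = hform g y1 y1' + hform g y2 y2'.
  rewrite -!scaleNr !(hformDl, hformDr, hformZl, hformZr) ?scalerDr !scalerA.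
  rewrite [LHS](AC ((2*2)*(2*2)) (((1*5)*(4*8))*((2*6)*(3*7)))) /=.
  rewrite -!scalerDl mulrNN [- s * c]mulNr [c * - s]mulrN (mulrC s c).
  by rewrite addNr !scale0r !addr0 [s * s + _]addrC -!expr2 cs !scale1r.
apply: (addIr (hform g y1 y1' + hform g y2 y2')).
by rewrite [RHS]addrACA e1 e2 -rot [LHS]addrACA.
Qed.
End Cancellation.
End DiagonalForms.

(** * Similarity factors and orderings *)

Section SimilarityFactors.
Local Open Scope classical_set_scope.
Variables (F : fieldType) (A : falgType F) (sigma : A -> A).
Hypothesis sigmaD : {morph sigma : x y / x + y}.
Hypothesis sigmaZ : forall (c : F) x, sigma (c *: x) = c *: sigma x.
Hypothesis sigma1 : sigma 1 = 1.
Hypothesis F0 : [pchar F] =i pred0.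

Definition hermitian_sum (u : A) : Prop :=
  exists (I : finType) (x : I -> A), u = \sum_i sigma (x i) * x i.

Variable w : F.
Hypothesis w0 : w != 0.

Let F2 : (2%:R : F) != 0 := char0_natf_neq0 F0 1.

Let sq : set F := [set x | exists2 y, y != 0 & x = y ^+ 2].

Let similar (Q : set F) := exists (I : finType) (d : I -> F),
  [/\ inhabited I, forall i, Q (d i) & embeds sigma (fun i => w * d i) d].

(** Such a [Q] is a subgroup of F^*: inverses come from x^-1 = x (x^-1)^2. *)
Let good (Q : set F) := [/\ ~ Q 0, sq `<=` Q,
  forall x y, Q x -> Q y -> Q (x * y) & ~ similar Q].

Let similar_dtensor (I K : finType) (d : I -> F) (g : K -> F) :
  embeds sigma (fun i => w * d i) d ->
  embeds sigma (fun i => w * dtensor d g i) (dtensor d g).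
Proof.
move=> /(embeds_dtensor g); apply: embeds_eq => // -[i k].
by rewrite /dtensor mulrA.
Qed.

Let similar_transport (I J : finType) (d : I -> F) (e : J -> F) (phi : I -> J)
    (psi : J -> I) (s : I -> F) :
    cancel phi psi -> cancel psi phi -> (forall i, s i != 0) ->
    (forall i, d i = e (phi i) * s i ^+ 2) ->
  embeds sigma (fun i => w * d i) d -> embeds sigma (fun j => w * e j) e.
Proof.
move=> phiK psiK s0 dE wd.
have ed : embeds sigma e d.
  apply: (@embeds_reindex _ _ _ sigmaD sigmaZ _ _ _ _ psi (fun j => (s (psi j))^-1)).
    exact: can_inj psiK.
  by move=> j; rewrite dE psiK exprVn mulfK // expf_neq0.
have de : embeds sigma d e.
  exact: (@embeds_reindex _ _ _ sigmaD sigmaZ _ _ _ _ phi s (can_inj phiK) dE).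
by apply: embeds_trans de; apply: embeds_trans wd; apply: embeds_scale.
Qed.

(** After tensoring with <1, c>, an entry c y may be replaced by y, because c<1, c> is <c, 1> up to
    squares. *)
Let similar_extend (Q : set F) c : sq `<=` Q ->
  (forall x y, Q x -> Q y -> Q (x * y)) -> c != 0 ->
  similar [set x | Q x \/ exists2 y, Q y & x = c * y] ->
  exists (I : finType) (d : I -> F), [/\ inhabited I, forall i, Q (d i) &
    embeds sigma (fun i => w * dtensor d (dbool 1 c) i) (dtensor d (dbool 1 c))].
Proof.
move=> sqQ QM c0 [I [d [I0 Qd wd]]]; exists I.
pose q i := if `[< Q (d i) >] then d i else d i / c.
exists q; split=> // [i|].
  rewrite /q; case: asboolP => // nQ; case: (Qd i) => // -[y Qy ->].
  by rewrite mulrAC divff // mul1r.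
pose phi (p : I * bool) := (p.1, if `[< Q (d p.1) >] then p.2 else ~~ p.2).
have phiK : involutive phi.
  by move=> [i b]; rewrite /phi /=; case: asboolP => //; rewrite negbK.
apply: (similar_transport (d := dtensor d (dbool 1 c)) (phi := phi) (psi := phi)
  (s := fun p => if `[< Q (d p.1) >] then 1 else if p.2 then 1 else c)) => //.
- by move=> p; do !case: ifP; rewrite ?oner_neq0.
- move=> [i b]; rewrite /dtensor /phi /q /=; case: asboolP => _.
    by rewrite expr1n mulr1.
  by case: b => /=; field.
exact: similar_dtensor.
Qed.

(** With D = d d', the forms d<1, c>d' and d'<1, -c>d add up to D + D + <c, -c>D. The last summand
    embeds in its multiple by [w], so it can be cancelled, which doubles D + D. *)
Let similar_split (Q : set F) c : sq `<=` Q ->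
  (forall x y, Q x -> Q y -> Q (x * y)) -> c != 0 ->
  similar [set x | Q x \/ exists2 y, Q y & x = c * y] ->
  similar [set x | Q x \/ exists2 y, Q y & x = - c * y] -> similar Q.
Proof.
move=> sqQ QM c0 /similar_extend[] // I [d [[i0] Qd wd]].
move=> /similar_extend[] //; rewrite ?oppr_eq0 // => I' [d' [[i0'] Qd' wd']].
pose D := dtensor d d'; pose V := dsum D D; pose U := dtensor (dbool c (- c)) D.
have QD j : Q (D j) by apply: QM.
exists _, (dsum V V); split; first by split; left; left; exact: (i0, i0').
  by move=> [] [].
suff: embeds sigma (dsum (fun i => w * V i) (fun i => w * V i)) (dsum V V).
  by apply: embeds_eq => // -[].
apply: (embeds_cancel sigmaD sigmaZ F0 (g := U)).
have UwU : embeds sigma U (fun i => w * U i).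
  have := embeds_dtensor D
    (embeds_hyperbolic sigmaD sigmaZ c F2 (mulf_neq0 w0 c0)).
  by apply: embeds_eq => // -[[] j]; rewrite /dtensor /= ?mulrA ?mulrN.
have := embeds_dsum (embeds_refl _ (fun i => w * V i)) UwU.
move/embeds_trans; apply.
suff: embeds sigma (fun i => w * dsum V U i) (dsum V U).
  by apply: embeds_eq => // -[].
pose E := dsum (dtensor (dtensor d (dbool 1 c)) d') (dtensor (dtensor d' (dbool 1 (- c))) d).
pose phi (x : I * bool * I' + I' * bool * I) : I * I' + I * I' + bool * (I * I') :=
  match x with
  | inl ((i, true), j) => inl (inl (i, j))
  | inl ((i, false), j) => inr (true, (i, j))
  | inr ((i, true), j) => inl (inr (j, i))
  | inr ((i, false), j) => inr (false, (j, i))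
  end.
pose psi (x : I * I' + I * I' + bool * (I * I')) : I * bool * I' + I' * bool * I :=
  match x with
  | inl (inl (i, j)) => inl ((i, true), j)
  | inr (true, (i, j)) => inl ((i, false), j)
  | inl (inr (j, i)) => inr ((i, true), j)
  | inr (false, (j, i)) => inr ((i, false), j)
  end.
apply: (similar_transport (d := E) (phi := phi) (psi := psi) (s := fun=> 1)).
- by move=> [[[i []] j]|[[i []] j]].
- by move=> [[[i j]|[i j]]|[[] [i j]]].
- by move=> _; rewrite oner_neq0.
- by move=> [[[i []] j]|[[i []] j]]; rewrite /E /V /U /D /dtensor /= expr1n; ring.
have := embeds_dsum (similar_dtensor d' wd) (similar_dtensor d wd').
by apply: embeds_eq => // -[].
Qed.

Let similar_hyperbolic (Q : set F) c : c != 0 -> Q c -> Q (- c) -> similar Q.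
Proof.
move=> c0 Qc QNc; exists _, (dbool c (- c)); split; first by split; exact: true.
  by case.
have := embeds_hyperbolic sigmaD sigmaZ (w * c) F2 c0.
by apply: embeds_eq => // -[]; rewrite /= ?mulrN.
Qed.

(** As <a, b> is isometric to <a + b, ab(a + b)>, the form <a, b, -(a + b), -ab(a + b)> is a sum of
    hyperbolic planes, for which every nonzero scalar is a similarity factor. This makes the maximal
    [Q] closed under addition. *)
Let similar_add (Q : set F) a b : a != 0 -> b != 0 -> a + b != 0 ->
  (forall x y, Q x -> Q y -> Q (x * y)) ->
  Q a -> Q b -> Q (- (a + b)) -> similar Q.
Proof.
move=> a0 b0 ab0 QM Qa Qb Qab; pose g := a * b * (a + b).
exists _, (dsum (dbool a b) (dbool (- (a + b)) (- g))); split.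
- by split; left; exact: true.
- by move=> [] [] //=; rewrite /g -mulrN; apply: (QM (a * b)) => //; apply: QM.
have [to_ab of_ab] := embeds_add sigmaD sigmaZ ab0.
pose H := dsum (dbool (a + b) g) (dbool (- (a + b)) (- g)).
suff wH : embeds sigma (fun i => w * H i) H.
  apply: embeds_trans (embeds_dsum to_ab (embeds_refl _ _)).
  apply: embeds_trans wH; apply: embeds_scale.
  exact: embeds_dsum of_ab (embeds_refl _ _).
pose E := dsum (dbool (a + b) (- (a + b))) (dbool g (- g)).
pose phi (x : bool + bool) : bool + bool :=
  match x with
  | inl true => inl true | inl false => inr true
  | inr true => inl false | inr false => inr false
  end.
apply: (similar_transport (d := E) (phi := phi) (psi := phi) (s := fun=> 1)).
- by move=> [] [].
- by move=> [] [].
- by move=> _; rewrite oner_neq0.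
- by move=> [] []; rewrite /= expr1n mulr1.
have g0 : g != 0 by rewrite !mulf_neq0.
have := embeds_dsum (embeds_hyperbolic sigmaD sigmaZ (w * (a + b)) F2 ab0)
          (embeds_hyperbolic sigmaD sigmaZ (w * g) F2 g0).
by apply: embeds_eq => // -[] []; rewrite /= ?mulrN.
Qed.

(** A basis vector has value w s^2 under [w d]; its image expresses this value as a sum of hermitian
    squares with square coefficients. *)
Let good_sq : ~ hermitian_sum w%:A -> good sq.
Proof.
move=> wS; split=> [[y y0 /esym/eqP]||_ _ [x x0 ->] [y y0 ->]|] //.
- by rewrite expf_eq0 (negbTE y0).
- by exists (x * y); rewrite ?mulf_neq0 // exprMn.
move=> [I [d [[i0] dsq [T [Tl hT]]]]].
have /choice[s sP] i : exists y, y != 0 /\ d i = y ^+ 2.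
  by have [y] := dsq i; exists y.
have s0 : s i0 != 0 by case: (sP i0).
apply: wS; pose x : {ffun I -> A} := [ffun j => if j == i0 then 1 else 0].
exists I, (fun j => (s j / s i0) *: T x j).
have := hT x x; rewrite /hform [RHS](bigD1 i0) //= [X in _ + X]big1 ?addr0; last first.
  by move=> i /negbTE ii0; rewrite !ffunE ii0 mulr0 scaler0.
rewrite !ffunE eqxx sigma1 mulr1 (sP i0).2 => /(congr1 (fun a => s i0 ^- 2 *: a)).
rewrite scalerA mulrCA mulVf ?expf_neq0 // mulr1 => <-.
rewrite scaler_sumr; apply: eq_bigr => j _.
rewrite sigmaZ -scalerAl -scalerAr !scalerA (sP j).2; congr (_ *: _).
by rewrite -expr2 exprMn exprVn mulrC.
Qed.

(** Adjoining [sq] takes care of the empty chain. Each condition involves finitely many elements,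
    which lie in one member of the chain together with [sq]. *)
Let good_bigcup (C : set (set F)) : good sq ->
  C `<=` [set X | good (X `|` sq)] -> total_on C subset ->
  good (\bigcup_(X in C) X `|` sq).
Proof.
move=> gsq Cgood Ctot.
pose U := \bigcup_(X in C) X `|` sq.
have common (s : seq F) : (forall x, x \in s -> U x) ->
    exists X, good (X `|` sq) /\ (X = set0 \/ C X) /\ forall x, x \in s -> (X `|` sq) x.
  elim: s => [|x s IHs] sU; first by exists set0; rewrite set0U; split=> //; split; first left.
  have [|X [gX [CX sX]]] := IHs; first by move=> y ys; apply: sU; rewrite inE ys orbT.
  have [|[Y CY Yx]|sqx] := sU x; first by rewrite inE eqxx.
    have [XY|YX] : X `<=` Y \/ Y `<=` X.
    - by case: CX => [->|CX]; [left; exact: sub0set | exact: Ctot].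
    - exists Y; split; [exact: Cgood | split; first by right].
      move=> y; rewrite inE => /orP[/eqP->|/sX[]]; [by left | by left; apply: XY | by right].
    - exists X; split; [by [] | split=> // y].
      by rewrite inE => /orP[/eqP->|/sX //]; left; apply: YX.
  exists X; split; [by [] | split=> // y].
  by rewrite inE => /orP[/eqP->|/sX //]; right.
split.
- move=> U0; have [|X [[X0 _ _ _] [_ XU]]] := common [:: 0]; last by apply/X0/XU; rewrite inE.
  by move=> x; rewrite inE => /eqP->.
- by move=> x sqx; right.
- move=> x y Ux Uy; have [|X [[_ _ XM _] [CX XU]]] := common [:: x; y].
    by move=> z; rewrite !inE => /orP[]/eqP->.
  have [] := XM _ _ (XU x _) (XU y _); rewrite ?inE ?eqxx ?orbT //; last by right.
  by case: CX => [->|CX] // Xxy; left; exists X.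
move=> [I [d [I0 Ud wd]]].
have [|X [[_ _ _ nX] [_ XU]]] := common (codom d); first by move=> x /codomP[i ->]; exact: Ud.
by apply: nX; exists I, d; split=> // i; apply/XU/codom_f.
Qed.

(** The ordering is a maximal [good] subgroup with 0 adjoined: splitting makes it total, hyperbolic
    planes make it antisymmetric, and [similar_add] makes it additive. *)
Lemma nonsimilar_ordering : ~ hermitian_sum w%:A ->
  exists P : set F, [/\ X_F P, P (- w) &
    ~ exists (I : finType) (d : I -> F), [/\ inhabited I,
        forall i, P (d i) /\ d i != 0 & embeds sigma (fun i => - d i) d]].
Proof.
move=> /good_sq gsq.
have [A0 [gA Amax]] := Zorn_bigcup (P := [set X | good (X `|` sq)]) (fun C => good_bigcup gsq).
pose Q := A0 `|` sq; have [Q0 sqQ QM nQ] : good Q := gA.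
have Q1 : Q 1 by apply: sqQ; exists 1; rewrite ?oner_neq0 ?expr1n.
have Qmax c : c != 0 -> ~ Q c -> similar [set x | Q x \/ exists2 y, Q y & x = c * y].
  move=> c0 nQc; apply: contrapT => nsim.
  pose Qc := [set x | Q x \/ exists2 y, Q y & x = c * y].
  have Qcc : Qc c by right; exists 1; rewrite ?mulr1.
  have Qsub : Qc `|` sq = Qc by apply/setUidl => x sqx; left; apply: sqQ.
  apply: (Amax Qc).
    by split=> [x Ax|QcA]; [left; left | apply: nQc; left; apply: QcA].
  rewrite /= Qsub; split=> //.
  - by move=> [//|[y Qy /esym/eqP]]; rewrite mulf_eq0 (negbTE c0) => /eqP y0; rewrite y0 in Qy.
  - by move=> x sqx; left; apply: sqQ.
  - move=> x y [Qx|[x' Qx' ->]] [Qy|[y' Qy' ->]].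
    + by left; apply: QM.
    + by right; exists (x * y'); [apply: QM | ring].
    + by right; exists (x' * y); [apply: QM | ring].
    + left; have -> : c * x' * (c * y') = c ^+ 2 * (x' * y') by ring.
      by apply: (QM); [apply: sqQ; exists c | apply: QM].
have Qtot c : c != 0 -> Q c \/ Q (- c).
  move=> c0; have [Qc|nQc] := pselect (Q c); [by left | right].
  apply: contrapT => nQNc; apply: nQ; apply: (similar_split sqQ QM c0).
    exact: Qmax c c0 nQc.
  by apply: (Qmax (- c) _ nQNc); rewrite oppr_eq0.
have Qpm c : Q c -> ~ Q (- c).
  move=> Qc QNc; have [c0|c0] := eqVneq c 0; first by rewrite c0 in Qc.
  exact: nQ (similar_hyperbolic c0 Qc QNc).
(* If [w] were in [Q], then <1, w> would have similarity factor [w]. *)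
have QNw : Q (- w).
  have [Qw|//] := Qtot w w0; case: nQ; exists _, (dbool 1 w).
  split; [by split; exact: true | by case|].
  apply: (@embeds_reindex _ _ _ sigmaD sigmaZ _ _ _ _ negb (fun b => if b then 1 else w)).
    exact: can_inj negbK.
  by case; rewrite /=; ring.
exists [set x | x = 0 \/ Q x]; split; [split=> /= | by right |].
- move=> x y [->|Qx] [->|Qy]; rewrite ?addr0 ?add0r; [by left | by right | by right |].
  have x0 : x != 0 by apply: contra_notN Q0 => /eqP <-.
  have y0 : y != 0 by apply: contra_notN Q0 => /eqP <-.
  have [xy0|xy0] := eqVneq (x + y) 0; [by left | right].
  have [//|Qxy] := Qtot _ xy0.
  by case: nQ; exact: similar_add x0 y0 xy0 QM Qx Qy Qxy.
- move=> x y [->|Qx] [->|Qy]; rewrite ?mul0r ?mulr0; [by left | by left | by left |].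
  by right; apply: QM.
- move=> x; have [->|x0] := eqVneq x 0; first by left; left.
  by have [Qx|Qx] := Qtot x x0; [left; right | right; right].
- move=> x [//|Qx] [/eqP|QNx]; first by rewrite oppr_eq0 => /eqP.
  by case: (Qpm x Qx).
(* If -d embeds in d, then d + (-w)d has similarity factor w: w d = (-w)(-d) embeds in (-w)d, and
   -w^2 d, which is -d up to squares, embeds in d. *)
move=> [I [d [[i0] dP dd]]]; apply: nQ; exists _, (dsum d (fun i => - w * d i)).
have Qd i : Q (d i) by case: (dP i) => -[->|//]; rewrite eqxx.
split; [by split; left | by case=> i //=; apply: QM|].
pose E := dsum (fun i => - w * d i) d.
apply: (embeds_trans (e := E)).
  have Nww : embeds sigma (fun i => - w ^+ 2 * d i) (fun i => - d i).
    apply: (@embeds_reindex _ _ _ sigmaD sigmaZ _ _ _ _ id (fun=> w)) => // i.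
    by ring.
  apply: embeds_eq (embeds_dsum (embeds_scale (- w) dd) (embeds_trans Nww dd)) => //.
  by case=> i /=; ring.
apply: (@embeds_reindex _ _ _ sigmaD sigmaZ _ _ _ _
  (fun x : I + I => match x with inl i => inr i | inr i => inl i end) (fun=> 1)).
- by move=> [i|i] [j|j] // [->].
- by case=> i /=; rewrite expr1n mulr1.
Qed.
End SimilarityFactors.

(** * Involutions over a real closed field *)

Section Structure.
Variables (R : rcfType) (B : algType R) (s : B -> B).
Variables (t : B -> R) (N : nat) (f f' : 'I_N -> B).
Hypothesis tdata : regular_trace_data t f f'.
Hypothesis sl : linear s.
Hypothesis sM : forall x y, s (x * y) = s y * s x.
Hypothesis sK : involutive s.
(** Symmetric central elements are scalars. Stated through [casimir], the condition is linear in [y]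
    and passes to scalar extensions. *)
Hypothesis s_central : forall y, exists c, casimir f f' y + s (casimir f f' y) = c%:A.

Let sD x y : s (x + y) = s x + s y.
Proof. by have := sl 1 x y; rewrite !scale1r. Qed.
Let s0 : s 0 = 0.
Proof. by apply: (addrI (s 0)); rewrite -sD !addr0. Qed.
Let sZ a x : s (a *: x) = a *: s x.
Proof. by have := sl a x 0; rewrite s0 !addr0. Qed.
Let sN x : s (- x) = - s x.
Proof. by rewrite -scaleN1r sZ scaleN1r. Qed.
Let s1 : s 1 = 1.
Proof. by rewrite -[LHS]mulr1 -{2}(sK 1) -sM mulr1 sK. Qed.
Let sX x k : s (x ^+ k) = s x ^+ k.
Proof. by elim: k => [|k IH]; rewrite ?s1 // exprS sM IH -exprSr. Qed.

Let ev (x : B) : {poly R} -> B := horner_alg x.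

Let evM x p q : ev x (p * q) = ev x p * ev x q. Proof. exact: rmorphM. Qed.
Let evD x p q : ev x (p + q) = ev x p + ev x q. Proof. exact: rmorphD. Qed.
Let evB x p q : ev x (p - q) = ev x p - ev x q. Proof. exact: rmorphB. Qed.
Let ev0 x : ev x 0 = 0. Proof. exact: rmorph0. Qed.
Let ev1 x : ev x 1 = 1. Proof. exact: rmorph1. Qed.
Let evX x : ev x 'X = x. Proof. exact: horner_algX. Qed.
Let evXn x k : ev x 'X^k = x ^+ k. Proof. by rewrite -{2}(evX x); exact: rmorphXn. Qed.
Let evXX x p k : ev x (p ^+ k) = ev x p ^+ k. Proof. exact: rmorphXn. Qed.
Let evC x c : ev x c%:P = c%:A. Proof. exact: horner_algC. Qed.
Let ev_comm x p q : ev x p * ev x q = ev x q * ev x p.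
Proof. by rewrite -!evM mulrC. Qed.

Let sev x p : s (ev x p) = ev (s x) p.
Proof.
elim/poly_ind: p => [|p c IH]; first by rewrite !ev0 s0.
by rewrite !evD !evM !evX !evC sD sM IH sZ s1 -{1}(evX (s x)) ev_comm evX.
Qed.

Lemma annihilating_poly (x : B) : exists2 p : {poly R}, p != 0 & horner_alg x p = 0.
Proof.
case: N f f' tdata => [|n] g g' td.
  by have := casimir1 td; rewrite big_ord0 => /esym/eqP; rewrite oner_eq0.
have rD y z : regmx t g g' (y + z) = regmx t g g' y + regmx t g g' z.
  by have := regmx_linear td 1 y z; rewrite !scale1r.
have r0 : regmx t g g' 0 = 0 by apply: (addrI (regmx t g g' 0)); rewrite -rD !addr0.
have rZ a y : regmx t g g' (a *: y) = a *: regmx t g g' y.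
  by have := regmx_linear td a y 0; rewrite r0 !addr0.
(* The factor ['X] removes the constant term, on which the two sides may differ because [regmx 1]
   need not be the identity matrix. *)
have rE p : regmx t g g' (ev x (p * 'X)) = horner_mx (regmx t g g' x) (p * 'X).
  elim/poly_ind: p => [|p c IH]; first by rewrite !mul0r /ev !rmorph0 r0.
  rewrite mulrDl evD rD evM evX (regmxM td) IH evM evC evX mulr_algl rZ.
  rewrite [RHS]rmorphD; congr (_ + _).
    set M := regmx t g g' x; rewrite -[LHS]/(M * horner_mx M (p * 'X)).
    by rewrite -{1}(horner_mx_X M) -rmorphM mulrC.
  by rewrite rmorphM /= horner_mx_C horner_mx_X -mul_scalar_mx.
exists (char_poly (regmx t g g' x) * 'X).
  by rewrite mulf_neq0 ?polyX_eq0 // -size_poly_eq0 size_char_poly.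
by apply: (regmx_inj td); rewrite rE rmorphM /= Cayley_Hamilton mul0r.
Qed.

(** Write an annihilating polynomial as X^k q with q(0) nonzero; a Bezout relation between X^(k+1)
    and q gives the idempotent. *)
Lemma fitting (x : B) : exists (q : {poly R}) k, let g := x * horner_alg x q in
  g * g = g /\ x ^+ k * (1 - g) = 0.
Proof.
have [p p0 px] := annihilating_poly x.
have [k [q q0 pE]] := multiplicity_XsubC p 0; rewrite p0 /= in q0.
rewrite subr0 in pE.
have /Bezout_eq1_coprimepP[[u v] uv1] : coprimep ('X ^+ k.+1) q.
  by rewrite coprimep_expl // coprimep_sym -['X]subr0 coprimep_XsubC.
have uvx : ev x u * x ^+ k.+1 + ev x v * ev x q = 1.
  by rewrite -evXn -!evM -evD uv1 ev1.
have qx : x ^+ k * ev x q = 0 by rewrite -evXn ev_comm -evM -pE.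
exists (u * 'X^k), k => g.
have gE : g = ev x u * x ^+ k.+1.
  by rewrite /g -[X in X * _](evX x) -/(ev x _) -evM mulrCA evM -exprS evXn.
have gE' : 1 - g = ev x v * ev x q by rewrite gE -uvx addrC addKr.
have xg : x ^+ k * (1 - g) = 0.
  by rewrite gE' ev_comm mulrA qx mul0r.
split=> //; apply/eqP; rewrite eq_sym -subr_eq0 -[X in X - _]mulr1 -mulrBr.
by rewrite {1}gE exprS -!mulrA xg !mulr0.
Qed.
Definition corner (e x : B) : Prop := e * x = x /\ x * e = x.
Definition symidem (e : B) : Prop := e * e = e /\ s e = e.
Definition primitive_symidem (e : B) : Prop := [/\ symidem e, e != 0 &
  forall p, symidem p -> corner e p -> p = 0 \/ p = e].
Definition skew_type (e : B) : Prop := exists2 x, corner e x & s x * x = - e.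
(** Such corners turn out to be the reals, the complex numbers or the quaternions over [R], with
    their standard conjugation. *)
Definition positive_type (e : B) : Prop :=
  (forall x, corner e x -> s x = x -> exists c, x = c *: e) /\
  (forall x, corner e x -> exists c, [/\ 0 <= c, s x * x = c *: e & c = 0 -> x = 0]).

Lemma cornerM e x y : corner e x -> corner e y -> corner e (x * y).
Proof. by move=> [ex _] [_ ye]; split; rewrite ?mulrA ?ex // -mulrA ye. Qed.
Lemma cornerD e x y : corner e x -> corner e y -> corner e (x + y).
Proof. by move=> [ex xe] [ey ye]; split; rewrite (mulrDl, mulrDr) ?ex ?ey ?xe ?ye. Qed.
Lemma cornerZ e a x : corner e x -> corner e (a *: x).
Proof. by move=> [ex xe]; split; rewrite -(scalerAl, scalerAr) ?ex ?xe. Qed.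
Lemma cornerN e x : corner e x -> corner e (- x).
Proof. by rewrite -scaleN1r; apply: cornerZ. Qed.
Lemma corner_s e x : s e = e -> corner e x -> corner e (s x).
Proof. by move=> se [ex xe]; split; rewrite -{1}se -sM ?ex ?xe. Qed.
Lemma corner_id e : symidem e -> corner e e.
Proof. by case. Qed.

(* An isotropic element generates an idempotent [g] with [s g * g = 0]; by
   primitivity [g + s g - g * s g = e], and then [g - s g] has square [e]. *)
Lemma isotropic_skew_type e z : primitive_symidem e -> corner e z -> z != 0 ->
  s z * z = 0 -> skew_type e.
Proof.
move=> [[ee se] e0 prim] [ez ze] z0 zz.
have [b tb] : exists b, t (z * b) != 0.
  apply: contrapT => nb; case/eqP: z0; apply: (tr_nondegenerate tdata) => b.
  by apply/eqP/negPn/negP => tb; apply: nb; exists b.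
pose b' := b * e; have tb' : t (z * b') != 0.
  by rewrite /b' mulrA (trC tdata) mulrA ez.
pose y := z * b'; have [q [k /= [gg yk]]] := fitting y.
set g := y * horner_alg y q in gg yk.
(* Otherwise [y] is nilpotent, so its regular matrix has trace 0, whereas [t y] is not 0. The
   exponent k + 1 avoids [regmx 1]. *)
have g0 : g != 0.
  apply: contraNneq tb' => g0; move: yk; rewrite g0 subr0 mulr1 -/y => yk0.
  rewrite -(tr_regmx tdata); clear -yk0 tdata.
  case: N f f' tdata => [|n] h h' td; first by rewrite /mxtrace big_ord0.
  have r0 : regmx t h h' 0 = 0.
    by apply/matrixP => i j; rewrite !mxE mul0r mulr0 (tr0 td).
  apply/eqP/(@mxtrace_nilpotent _ _ _ k.+1).
  suff -> : regmx t h h' y ^+ k.+1 = regmx t h h' (y ^+ k.+1) by rewrite exprS yk0 mulr0.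
  elim: (k) => [|m IH]; first by rewrite !expr1.
  by rewrite exprS IH [in RHS]exprSr (regmxM td).
have eg : e * g = g by rewrite /g /y !mulrA ez.
have ge : g * e = g.
  have gE : g = horner_alg y q * y by rewrite /g -{1}(evX y) ev_comm evX.
  by rewrite gE /y /b' -!mulrA ee.
have sgg : s g * g = 0.
  have gE : g = z * (b' * horner_alg y q) by rewrite /g /y mulrA.
  by rewrite {1}gE sM gE -mulrA (mulrA (s z)) zz mul0r mulr0.
clearbody g.
have ss : s g * s g = s g by rewrite -sM gg.
have cg : corner e g by [].
have csg := corner_s se cg.
pose p := g + s g - g * s g.
have pg : p * g = g by rewrite mulrBl mulrDl gg -mulrA sgg mulr0 subr0 addr0.
have ps : p * s g = s g.
  by rewrite /p mulrBl mulrDl ss -mulrA ss addrAC subrr add0r.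
have sp : s p = p by rewrite sD sN sD sM sK (addrC (s g)).
have pp : p * p = p by rewrite {2}/p mulrBr mulrDr mulrA pg ps.
have pe : p = e.
  have [||p0|//] := prim p; first by split.
    by apply: cornerD; [apply: cornerD | apply/cornerN/cornerM].
  by rewrite -pg p0 mul0r eqxx in g0.
exists (g - s g); first by apply: cornerD => //; apply: cornerN.
rewrite sD sN sK mulrBr !mulrBl ss gg sgg sub0r -opprD -pe /p; congr (- _).
by rewrite addrA.
Qed.

Section NotSkew.
Variable e : B.
Hypothesis prim : primitive_symidem e.
Hypothesis notskew : ~ skew_type e.

Let ee : e * e = e. Proof. by case: prim => -[]. Qed.
Let se : s e = e. Proof. by case: prim => -[]. Qed.
Let e0 : e != 0. Proof. by case: prim. Qed.

Lemma anisotropic z : corner e z -> s z * z = 0 -> z = 0.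
Proof.
move=> ez zz; apply/eqP; apply: contrapT => /negP z0.
exact: notskew (isotropic_skew_type prim ez z0 zz).
Qed.

(** For symmetric y, y^2 = s y y, so anisotropy takes off one squaring at a time. *)
Lemma sym_nilpotent x k : corner e x -> s x = x -> x ^+ k = 0 -> x = 0.
Proof.
move=> ex sx xk; have {xk} : x ^+ (2 ^ k) = 0.
  by rewrite -(subnK (ltnW (ltn_expl k (isT : 1 < 2)%N))) exprD xk mulr0.
have cornerX m : corner e (x ^+ m.+1).
  by elim: m => [|m IH]; rewrite ?expr1 // exprS; apply: cornerM.
elim: k => [|k IH] //; rewrite expnSr exprM => xx; apply: IH.
apply: anisotropic; last by rewrite sX sx.
by rewrite -(prednK (n := 2 ^ k)) ?expn_gt0.
Qed.

(** By primitivity the Fitting idempotent of [x], which is symmetric, is 0 or [e]. In the first case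
    [x] is nilpotent; in the second [y] = g y = 0. *)
Lemma sym_zero_divisor x y : corner e x -> s x = x -> x * y = 0 -> e * y = y ->
  y != 0 -> x = 0.
Proof.
move=> ex sx xy ey y0; have [q [k /= [gg xk]]] := fitting x.
set g := x * horner_alg x q in gg xk.
have gE : g = horner_alg x q * x by rewrite /g -{1}(evX x) ev_comm evX.
have cg : corner e g.
  by split; [rewrite /g mulrA ex.1 | rewrite gE -mulrA ex.2].
have sg : s g = g by rewrite {1}/g sM sx [s _]sev sx gE.
case: prim => _ _ /(_ g (conj gg sg) cg) [] gE'.
  by apply: (sym_nilpotent (k := k)) => //; rewrite -xk gE' subr0 mulr1.
by rewrite -ey -gE' gE -mulrA xy mulr0 eqxx in y0.
Qed.

(** The corner has no symmetric zero divisors, so every nonconstant factor of the minimal polynomial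
    of [x] already kills [x]. A real root a gives x = a e. A root a + bi with b nonzero gives (x - a
    e)^2 = -b^2 e, hence an element of norm -e, which is excluded. *)
Lemma not_skew_type_sym x : corner e x -> s x = x -> exists c, x = c *: e.
Proof.
move=> cx sx; pose ann (p : {poly R}) := e * ev x p == 0.
have ev_e p : ev x p * e = e * ev x p.
  elim/poly_ind: p => [|p c IH]; first by rewrite ev0 mul0r mulr0.
  rewrite evD evM evX evC mulrDl mulrDr mulr_algl mulr_algr; congr (_ + _).
  by rewrite -mulrA cx.2 mulrA -IH -mulrA cx.1.
have corner_ev p : corner e (e * ev x p).
  by split; [rewrite mulrA ee | rewrite -mulrA ev_e mulrA ee].
have s_ev p : s (e * ev x p) = e * ev x p by rewrite sM sev sx se ev_e.
have ev_mul p q : e * ev x (p * q) = (e * ev x p) * (e * ev x q).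
  by rewrite evM [RHS]mulrA -(mulrA e _ e) ev_e !mulrA ee.
have [p p0 [annp minp]] : exists2 p, p != 0 & ann p /\
    forall q, q != 0 -> ann q -> (size p <= size q)%N.
  have [p0 p00 p0x] := annihilating_poly x.
  have ex_size : exists n, `[< exists2 p, p != 0 & ann p /\ size p = n >].
    by exists (size p0); apply/asboolP; exists p0 => //; rewrite /ann [ev _ _]p0x mulr0.
  case: (ex_minnP ex_size) => n /asboolP[p pn0 [annp <-]] minn.
  by exists p => //; split=> // q q0 annq; apply: minn; apply/asboolP; exists q.
have factor r q : p = r * q -> (1 < size r)%N -> e * ev x r = 0.
  move=> pE rs; have r0 : r != 0 by apply: contraNneq p0; rewrite pE => ->; rewrite mul0r.
  have q0 : q != 0 by apply: contraNneq p0; rewrite pE => ->; rewrite mulr0.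
  apply: (sym_zero_divisor (y := e * ev x q)) => //.
  - by rewrite -ev_mul -pE; apply/eqP.
  - by rewrite mulrA ee.
  apply: contraTneq rs => /eqP/(minp q q0); rewrite pE size_mul // -leqNgt.
  move: q0; rewrite -size_poly_gt0; case: (size q) => // m _.
  by rewrite addnS /= -(add1n m) leq_add2r.
have real_root a : root p a -> exists c, x = c *: e.
  case/factor_theorem => q pE; exists a; apply/eqP; rewrite -subr_eq0; apply/eqP.
  have := factor ('X - a%:P) q; rewrite mulrC size_XsubC => /(_ pE isT).
  by rewrite evB evX evC mulrBr mulr_algr cx.1.
have [size_p1|size_p1] := eqVneq (size p) 1%N.
  have /size_poly1P[c c0 pE] : size p == 1%N by apply/eqP.
  move: annp; rewrite /ann pE evC mulr_algr scaler_eq0 (negbTE c0) /=.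
  by rewrite (negbTE e0).
pose F := @real_complex R : {rmorphism R -> R[i]}.
have /closed_rootP[[a b]] : size (map_poly F p) != 1%N by rewrite size_map_poly.
set z := Complex a b => pz.
have [b0|b0] := eqVneq b 0.
  apply: (real_root a); move: pz; rewrite /z b0 -[Complex a 0]/(F a).
  by rewrite fmorph_root.
pose p2 : {poly R} := ('X - a%:P) ^+ 2 + (b ^+ 2)%:P.
have p2E x' : p2.[x'] = (x' - a) ^+ 2 + b ^+ 2 by rewrite /p2 !hornerE.
have size_p2 : size p2 = 3%N.
  rewrite size_addl size_exp_XsubC // size_polyC.
  by case: (_ != _).
have rootF (q : {poly R}) : (map_poly F q).[z] = \sum_(i < size q) F q`_i * z ^+ i.
  by rewrite horner_coef size_map_poly; apply: eq_bigr => i _; rewrite coef_map.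
have p2z : (map_poly F p2).[z] = 0.
  rewrite rmorphD rmorphXn rmorphB /= map_polyX !map_polyC /= !hornerE /z.
  by apply/eqP; rewrite eq_complex /=; apply/andP; split; apply/eqP => /=; ring.
have pE := divp_eq p p2.
have r0 : p %% p2 = 0.
  have szr : (size (p %% p2)%R <= 2)%N.
    by rewrite -ltnS -size_p2 ltn_modp -size_poly_eq0 size_p2.
  have : (map_poly F (p %% p2)).[z] = 0.
    move/rootP: pz; rewrite {1}pE rmorphD rmorphM /= hornerD hornerM p2z.
    by rewrite mulr0 add0r.
  move: szr; move: (p %% p2) => r szr.
  rewrite (horner_coef_wide _ (n := 2)) ?size_map_poly // !big_ord_recl big_ord0.
  rewrite !coef_map /= /z /real_complex_def => /eqP.
  rewrite eq_complex /= => /andP[/eqP H1 /eqP H2].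
  have r1 : r`_1 = 0.
    by apply: (mulIf b0); rewrite mul0r -[RHS]H2 /=; ring.
  apply/polyP => -[|[|i]]; rewrite coef0.
  - by move: H1; rewrite -[bump 0 0]/1%N r1 => H1; rewrite -[RHS]H1; ring.
  - by [].
  - by rewrite nth_default // (leq_trans szr).
rewrite r0 addr0 mulrC in pE.
have := factor _ _ pE; rewrite size_p2 => /(_ isT).
rewrite evD evC evXX evB evX evC mulrDr mulr_algr => ye.
pose y := x - a *: e.
have cy : corner e y by apply: cornerD => //; apply/cornerN/cornerZ/corner_id.
have yE : e * (x - a%:A) = y by rewrite mulrBr cx.1 mulr_algr.
have sy : s y = y by rewrite sD sN sZ se sx.
case: notskew; exists (b^-1 *: y); first exact: cornerZ.
rewrite sZ -scalerAl -scalerAr sy scalerA.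
have -> : y * y = - (b ^+ 2 *: e).
  by move: ye => /eqP; rewrite expr2 mulrA yE -{1}cy.2 -mulrA yE addr_eq0 => /eqP.
by rewrite scalerN scalerA -invfM -expr2 mulVf ?scale1r // expf_neq0.
Qed.

Lemma not_skew_type : positive_type e.
Proof.
split; first exact: not_skew_type_sym.
move=> x cx; have csx := corner_s se cx.
have [c xx] : exists c, s x * x = c *: e.
  by apply: not_skew_type_sym; [apply: cornerM | rewrite sM sK].
exists c; split=> // [|c0]; last by apply: anisotropic; rewrite // xx c0 scale0r.
rewrite leNgt; apply/negP => c0; case: notskew.
have Nc0 : 0 < - c by rewrite oppr_gt0.
exists ((Num.sqrt (- c))^-1 *: x); first exact: cornerZ.
rewrite sZ -scalerAl -scalerAr scalerA xx scalerA -invfM -expr2 sqr_sqrtr ?ltW //.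
by rewrite invrN mulNr mulVf ?scaleN1r // lt_eqF.
Qed.
End NotSkew.

(** A substitute for simplicity: the ideal generated by [e] and [s e] contains a nonzero scalar. Its
    trace is 2 t(e b). *)
Lemma idempotent_generates e : e != 0 ->
  exists b c, c != 0 /\ casimir f f' (e * b) + s (casimir f f' (e * b)) = c%:A.
Proof.
move=> e0; have [b tb] : exists b, t (e * b) != 0.
  apply: contrapT => nb; case/eqP: e0; apply: (tr_nondegenerate tdata) => b.
  by apply/eqP/negPn/negP => tb; apply: nb; exists b.
have [c zc] := s_central (e * b); exists b, c; split=> //.
apply: contraNneq tb => c0; move/(congr1 t): zc; rewrite c0 scale0r (tr0 tdata).
rewrite (trD tdata) (tr_invol tdata sl sM sK) !(tr_casimir tdata) -mulr2n => /eqP.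
by rewrite mulrn_eq0.
Qed.

(* If [u * s u = 0] for every [u] in [e1 B e2], polarization makes every
   [u * s v] skew; applied to [(q * v)] for [q = u * s v] this gives
   [q * s q = 0], hence [e1 B e2 B e1 = 0]. *)
Lemma positive_type_link e1 e2 : symidem e1 -> e1 != 0 -> positive_type e1 ->
  primitive_symidem e2 -> exists u (c : R), [/\ e1 * u = u, u * e2 = u,
    c = 1 \/ c = -1, u * s u = c *: e1 & s u * u = c *: e2].
Proof.
move=> [e11 se1] e10 [sym1 pos1] [[e22 se2] e20 prim2].
have cuv u v : e1 * u = u -> e1 * v = v -> corner e1 (u * s v).
  move=> e1u e1v; split; first by rewrite mulrA e1u.
  by rewrite -mulrA -{1}se1 -sM e1v.
have [[u [e1u ue2 uu]]|all0] := pselect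
    (exists u, [/\ e1 * u = u, u * e2 = u & u * s u != 0]).
  have [c uE] : exists c, u * s u = c *: e1.
    by apply: sym1; [apply: cuv | rewrite sM sK].
  have c0 : c != 0 by apply: contraNneq uu => c0; rewrite uE c0 scale0r.
  have e2su : e2 * s u = s u by rewrite -{1}se2 -sM ue2.
  (* A nonzero symmetric idempotent in the corner of [e2], hence equal to [e2] by primitivity. *)
  pose p := c^-1 *: (s u * u).
  have up : u * p = u.
    by rewrite /p -scalerAr mulrA uE -scalerAl scalerA mulVf // scale1r e1u.
  have pe : p = e2.
    have [||p0|//] := prim2 p.
    - split; last by rewrite sZ sM sK.
      by rewrite {1}/p -scalerAl -mulrA up.
    - by split; rewrite /p -(scalerAl, scalerAr) ?mulrA ?e2su // -mulrA ue2.
    - have u0 : u = 0 by rewrite -up p0 mulr0.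
      by case/eqP: uu; rewrite u0 mul0r.
  have suu : s u * u = c *: e2 by rewrite -pe /p scalerA mulfV // scale1r.
  pose r := Num.sqrt `|c|; pose sg : R := Num.sg c.
  have r0 : r != 0 by rewrite sqrtr_eq0 -ltNge normr_gt0.
  have cr : r^-1 * (r^-1 * c) = sg.
    rewrite mulrA -invfM -expr2 sqr_sqrtr ?normr_ge0 // /sg.
    by rewrite {2}[c]numEsg mulrCA mulVf ?mulr1 // normr_eq0.
  exists (r^-1 *: u), sg; split.
  - by rewrite -scalerAr e1u.
  - by rewrite -scalerAl ue2.
  - rewrite /sg; case: (ltrgt0P c) => [c_gt0|c_lt0|/eqP].
    + by left; rewrite gtr0_sg.
    + by right; rewrite ltr0_sg.
    + by rewrite (negbTE c0).
  - by rewrite sZ -scalerAl -scalerAr uE !scalerA -mulrA cr.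
  - by rewrite sZ -scalerAl -scalerAr suu !scalerA -mulrA cr.
have uu0 u : e1 * u = u -> u * e2 = u -> u * s u = 0.
  by move=> e1u ue2; apply/eqP; apply: contrapT => /negP uu; apply: all0; exists u.
have uv0 u v : e1 * u = u -> u * e2 = u -> e1 * v = v -> v * e2 = v -> u * s v = 0.
  move=> e1u ue2 e1v ve2.
  have skew x y : e1 * x = x -> x * e2 = x -> e1 * y = y -> y * e2 = y ->
      x * s y = - (y * s x).
    move=> e1x xe2 e1y ye2; apply/eqP; rewrite -addr_eq0.
    have := uu0 (x + y); rewrite mulrDr mulrDl e1x e1y xe2 ye2 sD mulrDl !mulrDr.
    by rewrite !uu0 // addr0 add0r => ->.
  pose q := u * s v; have cq : corner e1 q by apply: cuv.
  have sq : s q = - q by rewrite /q sM sK -skew.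
  have qq : q * s q = 0.
    have qv : e1 * (q * v) = q * v by rewrite mulrA cq.1.
    have qve : q * v * e2 = q * v by rewrite -mulrA ve2.
    have vu : v * s u = s q by rewrite /q sM sK.
    have := skew u (q * v) e1u ue2 qv qve; rewrite sM mulrA -(mulrA q) vu => /eqP.
    by rewrite -addr_eq0 -mulr2n -scaler_nat scaler_eq0 pnatr_eq0 => /eqP.
  have [c [_ qc c0]] := pos1 _ (corner_s se1 cq).
  rewrite sK qq in qc; move/esym/eqP: qc; rewrite scaler_eq0 (negbTE e10) orbF.
  by move/eqP/c0 => sq0; rewrite -/q -[q]sK sq0 s0.
(* Since e1 B e2 B e1 = 0, compressing this nonzero scalar by [e1] gives 0. *)
have [b [c [c0 zc]]] := idempotent_generates e20.
set z := casimir f f' (e2 * b) in zc.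
have ez : e1 * z * e1 = 0.
  rewrite /z /casimir mulr_sumr mulr_suml big1 // => k _.
  have -> : e1 * (f k * (e2 * b) * f' k) * e1
      = (e1 * f k * e2) * s (e1 * s (b * f' k) * e2).
    by rewrite sM (sM e1) sK se1 se2 !mulrA -(mulrA _ e2 e2) e22.
  by apply: uv0; rewrite ?mulrA ?e11 // -mulrA e22.
have := congr1 (fun x => e1 * x * e1) zc.
rewrite /= mulrDr mulrDl ez add0r mulr_algr -scalerAl e11.
have -> : e1 * s z * e1 = s (e1 * z * e1) by rewrite !sM se1 mulrA.
by rewrite ez s0 => /esym/eqP; rewrite scaler_eq0 (negbTE c0) (negbTE e10).
Qed.

(** By induction on the rank of left multiplication by [e], which drops for every proper symmetric
    idempotent of the corner. *)
Lemma primitive_decomposition e : symidem e -> exists (I : finType) (v : I -> B),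
  [/\ forall i, primitive_symidem (v i), forall i j, i != j -> v i * v j = 0
    & \sum_i v i = e].
Proof.
have [n] := ubnP (\rank (regmx t f f' e)); elim: n e => // n IHn e; rewrite ltnS => le_en ide.
have [-> |e0] := eqVneq e 0.
  exists void, (fun i : void => match i with end).
  by split; [case | case | by rewrite big1 // => -[]].
have [prime|] := pselect (primitive_symidem e).
  exists unit, (fun=> e); split=> [//|[] []//|].
  by rewrite (big_pred1 tt) // => -[].
move=> nprim; have [p [idp cp p0 pe]] : exists p, [/\ symidem p, corner e p, p != 0 & p != e].
  apply: contrapT => nop; apply: nprim; split=> // p idp cp.
  have [->|p0] := eqVneq p 0; [by left | right].
  by apply/eqP; apply: contrapT => /negP pe; apply: nop; exists p.
have rank_lt q : symidem q -> corner e q -> q != e ->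
    (\rank (regmx t f f' q) < \rank (regmx t f f' e))%N.
  move=> [qq _] [eq qe] qne.
  have sub : (regmx t f f' q <= regmx t f f' e)%MS.
    by rewrite -eq (regmxM tdata) submxMl.
  rewrite ltn_neqAle mxrankS // andbT; apply: contra qne => /eqP rk.
  have /andP[_ /submxP[Y YE]] : (regmx t f f' q == regmx t f f' e)%MS.
    by rewrite -(mxrank_leqif_eq sub).2 rk.
  have eqM : regmx t f f' e = regmx t f f' q.
    by rewrite -[in RHS]qe (regmxM tdata) YE -mulmxA -(regmxM tdata) qq.
  rewrite -subr_eq0; apply/eqP/(regmx_inj tdata); rewrite -scaleN1r addrC.
  by rewrite (regmx_linear tdata) eqM scaleN1r addNr.
have idq : symidem (e - p).
  case: ide idp cp => ee se [pp sp] [ep pe'].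
  by rewrite /symidem sD sN se sp mulrBr !mulrBl ee ep pe' pp subrr subr0.
have cq : corner e (e - p) by apply: cornerD; [apply: corner_id | apply: cornerN].
have qe : e - p != e by rewrite -subr_eq0 addrAC subrr add0r oppr_eq0.
have [|I [v [pv ov vp]]] := IHn p _ idp; first exact: leq_trans (rank_lt p idp cp pe) le_en.
have [|J [w [pw ow wq]]] := IHn (e - p) _ idq.
  exact: leq_trans (rank_lt _ idq cq qe) le_en.
have vpE i : p * v i = v i /\ v i * p = v i.
  have [[vv _] _ _] := pv i; rewrite -vp mulr_suml mulr_sumr; split.
    by rewrite (bigD1 i) //= vv big1 ?addr0 // => j ji; rewrite ov.
  by rewrite (bigD1 i) //= vv big1 ?addr0 // => j ji; rewrite ov // eq_sym.
have wqE i : (e - p) * w i = w i /\ w i * (e - p) = w i.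
  have [[ww _] _ _] := pw i; rewrite -wq mulr_suml mulr_sumr; split.
    by rewrite (bigD1 i) //= ww big1 ?addr0 // => j ji; rewrite ow.
  by rewrite (bigD1 i) //= ww big1 ?addr0 // => j ji; rewrite ow // eq_sym.
have pq0 : p * (e - p) = 0 by rewrite mulrBr cp.2 idp.1 subrr.
have qp0 : (e - p) * p = 0 by rewrite mulrBl cp.1 idp.1 subrr.
exists (I + J)%type, (fun k => match k with inl i => v i | inr j => w j end).
split=> [[]//|[i|i] [j|j] ij|].
- exact: ov.
- by rewrite -(vpE i).2 -(wqE j).1 mulrA -(mulrA (v i)) pq0 mulr0 mul0r.
- by rewrite -(vpE j).1 -(wqE i).2 mulrA -(mulrA (w i)) qp0 mulr0 mul0r.
- exact: ow.
by rewrite big_sumType /= vp wq addrC subrK.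
Qed.

(** If all primitive summands of 1 are of skew type, their witnesses add up to [x]. Otherwise one of
    them is positive and is linked to each of the others; the [u i] then act as a row of matrix
    units, up to the signs [c i]. *)
Theorem skew_or_hermitian : (exists x, s x * x = - 1) \/
  exists e1, [/\ symidem e1, e1 != 0, positive_type e1 &
    exists (I : finType) (u : I -> B) (c : I -> R),
    [/\ forall i, e1 * u i = u i, forall i, c i = 1 \/ c i = -1,
        forall i j, u i * s (u j) = (if i == j then c i else 0) *: e1
      & \sum_i c i *: (s (u i) * u i) = 1]].
Proof.
have id1 : symidem 1 by rewrite /symidem mulr1.
have [I [v [pv ov v1]]] := primitive_decomposition id1.
have [[i0 nskew]|all_skew] := pselect (exists i, ~ skew_type (v i)).
  right; exists (v i0); have [ide v0 _] := pv i0.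
  have posv := not_skew_type (pv i0) nskew; split=> //.
  have /choice[u /choice[c uc]] i := positive_type_link ide v0 posv (pv i).
  exists I, u, c; split=> [i|i|i j|].
  - by case: (uc i).
  - by case: (uc i).
  - have [_ _ _ uu _] := uc i; case: eqP => [<- //|/eqP ij]; rewrite scale0r.
    have [_ uvi _ _ _] := uc i; have [_ uvj _ _ _] := uc j.
    have [[_ sv] _ _] := pv j.
    by rewrite -uvi -uvj sM sv mulrA -(mulrA (u i)) ov // mulr0 mul0r.
  rewrite -v1; apply: eq_bigr => i _; have [_ _ ci _ ->] := uc i.
  by rewrite scalerA -expr2; case: ci => ->; rewrite ?sqrrN expr1n scale1r.
left; have /choice[x xv] i : exists x, corner (v i) x /\ s x * x = - v i.
  have [|x] := @contrapT (skew_type (v i)); last by exists x.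
  by move=> nskew; apply: all_skew; exists i.
exists (\sum_i x i).
have s_sum : s (\sum_i x i) = \sum_i s (x i) by rewrite (big_morph s sD s0).
rewrite s_sum mulr_suml -v1 -sumrN; apply: eq_bigr => i _.
have [[vx xv'] xx] := xv i; rewrite mulr_sumr (bigD1 i) //= xx big1 ?addr0 // => j ji.
have [[vxj _] _] := xv j; have [[_ sv] _ _] := pv i.
by rewrite -vx -vxj sM sv mulrA -(mulrA _ (v i)) ov 1?eq_sym // mulr0 mul0r.
Qed.
End Structure.

(** * Extension of scalars *)

Section RegularTrace.
Variables (F : fieldType) (A : falgType F).

Definition abasis (i : 'I_(\dim {:A})) : A := (vbasis {:A})`_i.
Definition acoord (i : 'I_(\dim {:A})) (x : A) : F := coord (vbasis {:A}) i x.

Lemma acoordE x : x = \sum_i acoord i x *: abasis i.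
Proof. exact/coord_vbasis/memvf. Qed.

Lemma acoord_sum (c : 'I_(\dim {:A}) -> F) k : acoord k (\sum_i c i *: abasis i) = c k.
Proof. by apply: coord_sum_free; apply/basis_free/vbasisP. Qed.

Lemma acoord_basis k i : acoord k (abasis i) = (i == k)%:R.
Proof. by apply: coord_free; apply/basis_free/vbasisP. Qed.

Lemma acoordD i x y : acoord i (x + y) = acoord i x + acoord i y.
Proof. exact: linearD. Qed.
Lemma acoordZ i a x : acoord i (a *: x) = a * acoord i x.
Proof. exact: linearZ. Qed.
Lemma acoord_lsum i (I : finType) (g : I -> A) :
  acoord i (\sum_k g k) = \sum_k acoord i (g k).
Proof. exact: linear_sum. Qed.

Definition regtr (x : A) : F := \sum_i acoord i (x * abasis i).

Lemma regtr_linear : linear (regtr : A -> F^o).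
Proof.
move=> a x y; rewrite /regtr scaler_sumr -big_split; apply: eq_bigr => i _ /=.
by rewrite mulrDl -scalerAl acoordD acoordZ.
Qed.

Lemma regtrD x y : regtr (x + y) = regtr x + regtr y.
Proof. by have := regtr_linear 1 x y; rewrite !scale1r. Qed.
Lemma regtr0 : regtr 0 = 0.
Proof. by apply: (addrI (regtr 0)); rewrite -regtrD !addr0. Qed.
Lemma regtrZ a x : regtr (a *: x) = a * regtr x.
Proof. by have := regtr_linear a x 0; rewrite regtr0 !addr0. Qed.
Lemma regtr_sum (I : finType) (g : I -> A) : regtr (\sum_i g i) = \sum_i regtr (g i).
Proof. exact: (big_morph regtr regtrD regtr0). Qed.

Lemma regtrC x y : regtr (x * y) = regtr (y * x).
Proof.
have E z t : regtr (z * t) = \sum_i \sum_k acoord k (t * abasis i) * acoord i (z * abasis k).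
  apply: eq_bigr => i _; rewrite -mulrA {1}(acoordE (t * abasis i)) mulr_sumr.
  by rewrite acoord_lsum; apply: eq_bigr => k _; rewrite -scalerAr acoordZ.
rewrite !E exchange_big; apply: eq_bigr => i _; apply: eq_bigr => k _.
by rewrite mulrC.
Qed.

Lemma regtr1 : regtr 1 = (\dim {:A})%:R.
Proof.
rewrite /regtr; under eq_bigr do rewrite mul1r acoord_basis eqxx.
by rewrite sumr_const card_ord.
Qed.

Hypothesis A_simple : simple_algebra A.
Hypothesis F0 : [pchar F] =i pred0.

(** The radical is a two-sided ideal. It omits 1, whose trace is the dimension, nonzero in
    characteristic 0. *)
Lemma regtr_nondegenerate x : (forall y, regtr (x * y) = 0) -> x = 0.
Proof.
pose h x := \row_j regtr (x * abasis j) : 'rV[F]_(\dim {:A}).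
have hl : linear h.
  by move=> a y z; apply/rowP => j; rewrite !mxE mulrDl -scalerAl regtrD regtrZ.
pose L := GRing.isLinear.Build F A 'rV[F]_(\dim {:A}) _ h hl.
pose hL : {linear A -> 'rV[F]_(\dim {:A})} := HB.pack h L.
pose I := lker (linfun hL).
have memI z : reflect (forall y, regtr (z * y) = 0) (z \in I).
  rewrite memv_ker lfunE; apply: (iffP eqP) => [h0 y|z0].
    rewrite [y]acoordE mulr_sumr regtr_sum big1 // => j _.
    have /rowP/(_ j) : h z = 0 by [].
    by rewrite !mxE -scalerAr regtrZ => ->; rewrite mulr0.
  by apply/rowP => j; rewrite !mxE z0.
have [||I0|I1] := A_simple (I := I).
- apply/prodvP => a b aI _; apply/memI => y; rewrite -mulrA.
  by move/memI: aI.
- apply/prodvP => a b _ bI; apply/memI => y; rewrite -mulrA regtrC -mulrA.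
  by move/memI: bI.
- by move=> x0; have /memI : forall y, regtr (x * y) = 0 by []; rewrite I0 memv0 => /eqP.
have /memI/(_ 1) : 1 \in I by rewrite I1 memvf.
rewrite mulr1 regtr1 => /eqP; move/pcharf0P: F0 => ->; rewrite dimv_eq0 => /eqP A0.
by have := memvf (1 : A); rewrite A0 memv0 oner_eq0.
Qed.

Lemma regular_trace_data_exists : exists N (f f' : 'I_N -> A),
  regular_trace_data regtr f f'.
Proof.
pose G := \matrix_(i, j) regtr (abasis i * abasis j).
have Gunit : G \in unitmx.
  rewrite -row_free_unit -kermx_eq0; apply/rowV0P => v /sub_kermxP vG.
  have x0 : \sum_i v 0 i *: abasis i = 0.
    apply: regtr_nondegenerate => y; rewrite [y]acoordE mulr_sumr regtr_sum big1 // => j _.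
    have E : regtr ((\sum_i v 0 i *: abasis i) * abasis j) = (v *m G) 0 j.
      rewrite mulr_suml regtr_sum mxE; apply: eq_bigr => i _.
      by rewrite -scalerAl regtrZ mxE.
    by rewrite -scalerAr regtrZ E vG mxE mulr0.
  by apply/rowP => i; rewrite mxE -(acoord_sum (v 0) i) x0 /acoord linear0.
pose e' k := \sum_j invmx G k j *: abasis j.
have dual k l : regtr (e' k * abasis l) = (k == l)%:R.
  rewrite /e' mulr_suml regtr_sum; have /matrixP/(_ k l) := mulVmx Gunit.
  by rewrite !mxE => <-; apply: eq_bigr => j _; rewrite -scalerAl regtrZ mxE.
have coordE k x : regtr (e' k * x) = acoord k x.
  rewrite {1}[x]acoordE mulr_sumr regtr_sum (bigD1 k) //= -scalerAr regtrZ dual eqxx mulr1.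
  by rewrite big1 ?addr0 // => l /negbTE lk; rewrite -scalerAr regtrZ dual eq_sym lk mulr0.
exists (\dim {:A}), abasis, e'; split.
- exact: regtr_linear.
- exact: regtrC.
- by move=> x; rewrite {1}[x]acoordE; apply: eq_bigr => k _; rewrite coordE.
(* Paired with [y], the Casimir element gives the sum of the traces of [e' k * y * abasis k], which
   is the definition of [regtr y]. *)
apply/eqP; rewrite -subr_eq0; apply/eqP/regtr_nondegenerate => y.
rewrite mulrBl mul1r regtrD -scaleN1r regtrZ mulN1r mulr_suml regtr_sum.
apply/eqP; rewrite subr_eq0; apply/eqP/eq_bigr => k _.
by rewrite -mulrA regtrC -mulrA coordE.
Qed.
End RegularTrace.

Section ScalarExtension.
Variables (F : fieldType) (A : falgType F) (R : fieldType).

(* The multiplication on the coordinate space depends on [g], which therefore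
   has to be a parameter of the type. *)
Definition scalar_ext (_ : {rmorphism F -> R}) : Type := 'rV[R]_(\dim {:A}).
HB.instance Definition _ g := GRing.Lmodule.on (scalar_ext g).

Variable g : {rmorphism F -> R}.
Local Notation scext := (scalar_ext g).

Definition scin (a : A) : scext := \row_k g (acoord k a).

Definition scext_mul (x y : scext) : scext :=
  locked (\sum_i \sum_j (x 0 i * y 0 j) *: scin (abasis i * abasis j)).
Lemma scext_mulE x y :
  scext_mul x y = \sum_i \sum_j (x 0 i * y 0 j) *: scin (abasis i * abasis j).
Proof. by rewrite /scext_mul -lock. Qed.

Lemma scinD a b : scin (a + b) = scin a + scin b.
Proof. by apply/rowP => k; rewrite !mxE acoordD rmorphD. Qed.
Lemma scinZ c a : scin (c *: a) = g c *: scin a.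
Proof. by apply/rowP => k; rewrite !mxE acoordZ rmorphM. Qed.
Lemma scin0 : scin 0 = 0.
Proof. by have := scinZ 0 0; rewrite rmorph0 !scale0r. Qed.
Lemma scin_sum (I : finType) (h : I -> A) : scin (\sum_i h i) = \sum_i scin (h i).
Proof. exact: (big_morph scin scinD scin0). Qed.
Lemma scin_inj : injective scin.
Proof.
move=> a b /rowP ab; rewrite (acoordE a) (acoordE b); apply: eq_bigr => k _.
by move: (ab k); rewrite !mxE => /fmorph_inj->.
Qed.

Lemma scext_expand (x : scext) : x = \sum_i x 0 i *: scin (abasis i).
Proof.
apply/rowP => k; rewrite summxE (bigD1 k) //= big1 ?addr0 => [|i ik].
  by rewrite !mxE acoord_basis eqxx rmorph1 mulr1.
by rewrite !mxE acoord_basis (negbTE ik) rmorph0 mulr0.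
Qed.

Lemma scext_ind (P : scext -> Prop) : (forall a, P (scin a)) ->
  (forall x y, P x -> P y -> P (x + y)) -> (forall c x, P x -> P (c *: x)) ->
  forall x, P x.
Proof.
move=> Pin PD PZ x; rewrite (scext_expand x).
by apply: (big_ind P) => [||i _]; [rewrite -scin0 | | apply: PZ].
Qed.

Lemma scext_mulDl : left_distributive scext_mul +%R.
Proof.
move=> x y z; rewrite !scext_mulE -big_split; apply: eq_bigr => i _ /=.
by rewrite -big_split; apply: eq_bigr => j _; rewrite /= mxE mulrDl scalerDl.
Qed.
Lemma scext_mulDr : right_distributive scext_mul +%R.
Proof.
move=> x y z; rewrite !scext_mulE -big_split; apply: eq_bigr => i _ /=.
by rewrite -big_split; apply: eq_bigr => j _; rewrite /= mxE mulrDr scalerDl.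
Qed.
Lemma scext_mulZl c x y : scext_mul (c *: x) y = c *: scext_mul x y.
Proof.
rewrite !scext_mulE scaler_sumr; apply: eq_bigr => i _; rewrite scaler_sumr.
by apply: eq_bigr => j _; rewrite mxE scalerA mulrA.
Qed.
Lemma scext_mulZr c x y : scext_mul x (c *: y) = c *: scext_mul x y.
Proof.
rewrite !scext_mulE scaler_sumr; apply: eq_bigr => i _; rewrite scaler_sumr.
by apply: eq_bigr => j _; rewrite mxE scalerA mulrCA.
Qed.
Lemma scext_mul_in a b : scext_mul (scin a) (scin b) = scin (a * b).
Proof.
rewrite scext_mulE {2}(acoordE a) {2}(acoordE b) mulr_suml scin_sum; apply: eq_bigr => i _.
rewrite mulr_sumr scin_sum; apply: eq_bigr => j _.
by rewrite -scalerAl -scalerAr !scinZ scalerA !mxE.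
Qed.
Lemma scext_mulA : associative scext_mul.
Proof.
move=> x y z; elim/scext_ind: x => [a|x x' IH IH'|c x IH].
- elim/scext_ind: y => [b|y y' IH IH'|c y IH].
  + elim/scext_ind: z => [d|z z' IH IH'|c z IH].
    * by rewrite !scext_mul_in mulrA.
    * by rewrite !scext_mulDr IH IH'.
    * by rewrite !scext_mulZr IH.
  + by rewrite !(scext_mulDl, scext_mulDr) IH IH'.
  + by rewrite !(scext_mulZl, scext_mulZr) IH.
- by rewrite !scext_mulDl IH IH'.
- by rewrite !scext_mulZl IH.
Qed.
Lemma scext_mul1 : left_id (scin 1) scext_mul.
Proof.
elim/scext_ind => [a|x x' IH IH'|c x IH]; first by rewrite scext_mul_in mul1r.
  by rewrite scext_mulDr IH IH'.
by rewrite scext_mulZr IH.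
Qed.
Lemma scext_1mul : right_id (scin 1) scext_mul.
Proof.
elim/scext_ind => [a|x x' IH IH'|c x IH]; first by rewrite scext_mul_in mulr1.
  by rewrite scext_mulDl IH IH'.
by rewrite scext_mulZl IH.
Qed.
Lemma scext_1neq0 : scin 1 != 0.
Proof. by rewrite -scin0 (inj_eq scin_inj) oner_eq0. Qed.
HB.instance Definition _ := GRing.Zmodule_isNzRing.Build scext
  scext_mulA scext_mul1 scext_1mul scext_mulDl scext_mulDr scext_1neq0.
HB.instance Definition _ := GRing.Lmodule_isLalgebra.Build R scext
  (fun c x y => esym (scext_mulZl c x y)).
HB.instance Definition _ := GRing.Lalgebra_isAlgebra.Build R scext
  (fun c x y => esym (scext_mulZr c x y)).

Lemma scinM a b : scin (a * b) = scin a * scin b.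
Proof. exact: esym (scext_mul_in a b). Qed.
Lemma scin1 : scin 1 = 1. Proof. by []. Qed.

Section SemilinearExtension.
Variables (V : lmodType R) (theta : A -> V).
Hypothesis thetaD : {morph theta : x y / x + y}.
Hypothesis thetaZ : forall c x, theta (c *: x) = g c *: theta x.

Definition scext_lift (x : scext) : V := locked (\sum_i x 0 i *: theta (abasis i)).
Lemma scext_liftE x : scext_lift x = \sum_i x 0 i *: theta (abasis i).
Proof. by rewrite /scext_lift -lock. Qed.

Lemma scext_lift_in a : scext_lift (scin a) = theta a.
Proof.
have theta0 : theta 0 = 0 by have := thetaZ 0 0; rewrite rmorph0 !scale0r.
rewrite scext_liftE {2}(acoordE a) (big_morph theta thetaD theta0).
by apply: eq_bigr => i _; rewrite mxE thetaZ.
Qed.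

Lemma scext_lift_linear : linear scext_lift.
Proof.
move=> c x y; rewrite !scext_liftE scaler_sumr -big_split; apply: eq_bigr => i _.
by rewrite /= !mxE scalerDl scalerA.
Qed.
End SemilinearExtension.

Lemma scext_linear_eq (V : lmodType R) (h h' : scext -> V) : linear h -> linear h' ->
  (forall a, h (scin a) = h' (scin a)) -> h =1 h'.
Proof.
move=> hl h'l hh'; elim/scext_ind => // [x y hx hy|c x hx].
  by have := hl 1 x y; have := h'l 1 x y; rewrite !scale1r hx hy => -> ->.
have l0 (k : scext -> V) : linear k -> k 0 = 0.
  by move=> kl; have := kl (-1) 0 0; rewrite scaler0 addr0 scaleN1r addNr.
by have := hl c x 0; have := h'l c x 0; rewrite !l0 // !addr0 hx => -> ->.
Qed.

Section Involution.
Variable sigma : A -> A.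
Hypothesis sigmaD : {morph sigma : x y / x + y}.
Hypothesis sigmaZ : forall (c : F) x, sigma (c *: x) = c *: sigma x.
Hypothesis sigmaM : forall x y, sigma (x * y) = sigma y * sigma x.
Hypothesis sigmaK : involutive sigma.

Definition scext_sigma : scext -> scext := scext_lift (scin \o sigma).

Let inD : {morph scin \o sigma : x y / x + y}.
Proof. by move=> x y; rewrite /= sigmaD scinD. Qed.
Let inZ c x : (scin \o sigma) (c *: x) = g c *: (scin \o sigma) x.
Proof. by rewrite /= sigmaZ scinZ. Qed.

Lemma scext_sigma_in a : scext_sigma (scin a) = scin (sigma a).
Proof. exact: scext_lift_in. Qed.
Lemma scext_sigma_linear : linear scext_sigma.
Proof. exact: scext_lift_linear. Qed.
Lemma scext_sigmaD x y : scext_sigma (x + y) = scext_sigma x + scext_sigma y.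
Proof. by have := scext_sigma_linear 1 x y; rewrite !scale1r. Qed.
Lemma scext_sigma0 : scext_sigma 0 = 0.
Proof. by apply: (addrI (scext_sigma 0)); rewrite -scext_sigmaD !addr0. Qed.
Lemma scext_sigmaZ c x : scext_sigma (c *: x) = c *: scext_sigma x.
Proof. by have := scext_sigma_linear c x 0; rewrite scext_sigma0 !addr0. Qed.
Lemma scext_sigmaK : involutive scext_sigma.
Proof.
elim/scext_ind => [a|x y IH IH'|c x IH]; first by rewrite !scext_sigma_in sigmaK.
  by rewrite !scext_sigmaD IH IH'.
by rewrite !scext_sigmaZ IH.
Qed.
Lemma scext_sigmaM x y : scext_sigma (x * y) = scext_sigma y * scext_sigma x.
Proof.
elim/scext_ind: x => [a|x x' IH IH'|c x IH].
- elim/scext_ind: y => [b|y y' IH IH'|c y IH].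
  + by rewrite -scinM !scext_sigma_in sigmaM scinM.
  + by rewrite mulrDr !scext_sigmaD mulrDl IH IH'.
  + by rewrite -scalerAr !scext_sigmaZ -scalerAl IH.
- by rewrite mulrDl !scext_sigmaD mulrDr IH IH'.
- by rewrite -scalerAl !scext_sigmaZ -scalerAr IH.
Qed.

Variables (t : A -> F) (N : nat) (f f' : 'I_N -> A).
Hypothesis tdata : regular_trace_data t f f'.

Lemma scext_regular_trace_data :
  regular_trace_data (scext_lift (g \o t : A -> R^o)) (scin \o f) (scin \o f').
Proof.
set tB := scext_lift _; have tl : linear tB by apply: scext_lift_linear.
have tin a : tB (scin a) = g (t a).
  apply: scext_lift_in => [x y|c x] /=; first by rewrite (trD tdata) rmorphD.
  by rewrite (trZ tdata) rmorphM.
have tD x y : tB (x + y) = tB x + tB y by have := tl 1 x y; rewrite !scale1r.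
have t0 : tB 0 = 0 by apply: (addrI (tB 0)); rewrite -tD !addr0.
have tZ c x : tB (c *: x) = c * tB x by have := tl c x 0; rewrite t0 !addr0.
split=> [//|x y|x|].
- elim/scext_ind: x => [a|x x' IH IH'|c x IH].
  + elim/scext_ind: y => [b|y y' IH IH'|c y IH].
    * by rewrite -!scinM !tin (trC tdata).
    * by rewrite mulrDl mulrDr !tD IH IH'.
    * by rewrite -scalerAl -scalerAr !tZ IH.
  + by rewrite mulrDl mulrDr !tD IH IH'.
  + by rewrite -scalerAl -scalerAr !tZ IH.
- elim/scext_ind: x => [a|x x' IH IH'|c x IH].
  + rewrite {1}(dual_expand tdata a) scin_sum; apply: eq_bigr => k _.
    by rewrite /= -scinM tin scinZ.
  + rewrite {1}IH {1}IH' -big_split; apply: eq_bigr => k _ /=.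
    by rewrite mulrDr tD scalerDl.
  + rewrite {1}IH scaler_sumr; apply: eq_bigr => k _.
    by rewrite -scalerAr tZ scalerA.
under eq_bigr => k _ do rewrite /= -scinM.
by rewrite -scin_sum (casimir1 tdata).
Qed.

Hypothesis sigma_central : forall z, (forall b, b * z = z * b) -> sigma z = z ->
  exists c : F, z = c%:A.

Lemma scext_sigma_central (y : scext) : exists c,
  casimir (scin \o f) (scin \o f') y
    + scext_sigma (casimir (scin \o f) (scin \o f') y) = c%:A.
Proof.
have casD x x' : casimir (scin \o f) (scin \o f') (x + x')
    = casimir (scin \o f) (scin \o f') x + casimir (scin \o f) (scin \o f') x'.
  by rewrite -big_split; apply: eq_bigr => k _; rewrite /= mulrDr mulrDl.
have casZ c x : casimir (scin \o f) (scin \o f') (c *: x)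
    = c *: casimir (scin \o f) (scin \o f') x.
  by rewrite scaler_sumr; apply: eq_bigr => k _; rewrite -scalerAr -scalerAl.
elim/scext_ind: y => [a|x x' [c IH] [c' IH']|c x [c' IH]].
- have -> : casimir (scin \o f) (scin \o f') (scin a) = scin (casimir f f' a).
    by rewrite scin_sum; apply: eq_bigr => k _; rewrite /= !scinM.
  have [||c zE] := @sigma_central (casimir f f' a + sigma (casimir f f' a)).
  + move=> b; rewrite mulrDr mulrDl (casimir_central tdata); congr (_ + _).
    by rewrite -[b]sigmaK -!sigmaM (casimir_central tdata).
  + by rewrite sigmaD sigmaK addrC.
  by exists (g c); rewrite scext_sigma_in -scinD zE scinZ scin1.
- by exists (c + c'); rewrite casD scext_sigmaD addrACA IH IH' scalerDl.
- by exists (c * c'); rewrite casZ scext_sigmaZ -scalerDr IH scalerA.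
Qed.
End Involution.
End ScalarExtension.

(** * Local isomorphisms and vanishing signatures *)

Lemma divalg_norm (R : rcfType) k (d : divalg R k) : exists n,
  divalg_bar d * d = divalg_in k n /\ (n = 0 -> d = 0).
Proof.
case: k d => [x|[a b]|[a b c d]] /=.
- by exists (x * x); split=> // /eqP; rewrite mulf_eq0 orbb => /eqP.
- exists (a ^+ 2 + b ^+ 2); split.
    by apply/eqP; rewrite eq_complex /=; apply/andP; split; apply/eqP; ring.
  by move/eqP; rewrite paddr_eq0 ?sqr_ge0 // !sqrf_eq0 => /andP[/eqP-> /eqP->].
exists (a ^+ 2 + b ^+ 2 + c ^+ 2 + d ^+ 2); split.
  by congr Quat => /=; ring.
move/eqP; rewrite !paddr_eq0 ?addr_ge0 ?sqr_ge0 // !sqrf_eq0.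
by case/andP => /andP[/andP[/eqP-> /eqP->] /eqP->] /eqP->.
Qed.

(** * Positive corners and the Frobenius theorem *)

Section PositiveCorner.
Variables (R : rcfType) (B : algType R) (s : B -> B) (e : B).
Hypothesis sl : linear s.
Hypothesis sM : forall x y, s (x * y) = s y * s x.
Hypothesis sK : involutive s.
Hypothesis ide : symidem s e.
Hypothesis e0 : e != 0.
Hypothesis pos : positive_type s e.

Let sD x y : s (x + y) = s x + s y.
Proof. by have := sl 1 x y; rewrite !scale1r. Qed.
Let s0 : s 0 = 0.
Proof. by apply: (addrI (s 0)); rewrite -sD !addr0. Qed.
Let sZ a x : s (a *: x) = a *: s x.
Proof. by have := sl a x 0; rewrite s0 !addr0. Qed.
Let sN x : s (- x) = - s x.
Proof. by rewrite -scaleN1r sZ scaleN1r. Qed.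
Let ee : e * e = e := ide.1.
Let se : s e = e := ide.2.

Definition skew x := corner e x /\ s x = - x.

Let skewZ a x : skew x -> skew (a *: x).
Proof. by move=> [cx sx]; split; [apply: cornerZ | rewrite sZ sx scalerN]. Qed.
Let skewD x y : skew x -> skew y -> skew (x + y).
Proof. by move=> [cx sx] [cy sy]; split; [apply: cornerD | rewrite sD sx sy opprD]. Qed.

Let unit_skew x : skew x -> x != 0 -> exists a, a != 0 /\ (a *: x) * (a *: x) = - e.
Proof.
move=> [cx sx] x0; have [c [c0 xx cx0]] := pos.2 x cx.
have {}c0 : 0 < c by rewrite lt_def c0 andbT; apply: contraNneq x0 => /cx0->.
exists (Num.sqrt c)^-1; rewrite invr_eq0 sqrtr_eq0 -ltNge; split=> //.
rewrite -scalerAl -scalerAr scalerA -invfM -expr2 sqr_sqrtr ?ltW //.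
have -> : x * x = - (c *: e) by rewrite -xx sx mulNr opprK.
by rewrite scalerN scalerA mulVf ?scale1r // gt_eqF.
Qed.

Let anticomm x y : skew x -> skew y -> exists a, x * y + y * x = a *: e.
Proof.
move=> [cx sx] [cy sy]; apply: pos.1.
  by apply: cornerD; apply: cornerM.
by rewrite sD !sM sx sy !mulrNN addrC.
Qed.

(** Orthogonalization: half of the scalar x y + y x is the coefficient of [x] to be removed from
    [y]. *)
Let reduce x y : skew x -> x * x = - e -> skew y ->
  exists a, x * (y + a *: x) = - ((y + a *: x) * x).
Proof.
move=> skx xx sky; have [a xy] := anticomm skx sky; exists (a / 2%:R).
apply/eqP; rewrite -addr_eq0 mulrDr mulrDl -scalerAr -scalerAl xx addrACA xy.
have half : a / 2%:R + a / 2%:R = a by field.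
by rewrite !scalerN -opprD -scalerDl half subrr.
Qed.

Let sym_skew x : corner e x -> exists a y, skew y /\ x = a *: e + y.
Proof.
move=> cx; have csx := corner_s sM se cx.
have [a xa] : exists a, x + s x = a *: e.
  by apply: pos.1; [apply: cornerD | rewrite sD sK addrC].
have h2 : (2%:R^-1 : R) *+ 2 = 1 by rewrite mulr2n; field.
exists (2%:R^-1 * a), (2%:R^-1 *: (x - s x)); split.
  by apply: skewZ; split; [apply: cornerD => //; apply: cornerN | rewrite sD sN sK opprB].
rewrite -scalerA -xa -scalerDr addrACA subrr addr0 -mulr2n.
by rewrite -scalerMnr scalerMnl h2 scale1r.
Qed.

Definition positive_coordinates (k : division_kind) (th : divalg R k -> B) : Prop :=
  [/\ {morph th : x y / x + y}, forall x y, th (x * y) = th x * th y,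
      forall c, th (divalg_in k c) = c *: e,
      forall x, th (divalg_bar x) = s (th x)
    & forall x, corner e x -> exists d, th d = x].

Let real_coordinates : (forall y, skew y -> y = 0) ->
  @positive_coordinates RealKind (fun c => c *: e).
Proof.
move=> sk0; split=> [x y|x y|//|x|x cx].
- by rewrite scalerDl.
- by rewrite -scalerAl -scalerAr ee scalerA.
- by rewrite /= sZ se.
by have [a [y [/sk0-> ->]]] := sym_skew cx; exists a; rewrite addr0.
Qed.

Let complex_coordinates i : skew i -> i * i = - e ->
  (forall y, skew y -> exists a, y = a *: i) ->
  @positive_coordinates ComplexKind (fun z => complex.Re z *: e + complex.Im z *: i).
Proof.
move=> [[ei ie] si] ii sk; split=> [[a b] [c d]|[a b] [c d]|c|[a b]|x cx] /=.
- by rewrite !scalerDl addrACA.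
- rewrite mulrDl !mulrDr -!scalerAl -!scalerAr ee ei ie ii !scalerA !scalerN.
  by rewrite scalerBl scalerDl [RHS](AC (2*2) ((1*4)*(2*3))).
- by rewrite scale0r addr0.
- by rewrite sD !sZ se si scalerN scaleNr.
have [a [y [/sk[b ->] ->]]] := sym_skew cx.
by exists (Complex a b).
Qed.

Let quaternion_coordinates i j : skew i -> i * i = - e -> skew j -> j * j = - e ->
  i * j = - (j * i) ->
  @positive_coordinates QuaternionKind
    (fun q => qre q *: e + qi q *: i + qj q *: j + qk q *: (i * j)).
Proof.
move=> ski ii skj jj ij; have [[ei ie] si] := ski; have [[ej je] sj] := skj.
pose k := i * j; have ji : j * i = - k by rewrite /k ij opprK.
have ik : i * k = - j by rewrite mulrA ii mulNr ej.
have kj : k * j = - i by rewrite -mulrA jj mulrN ie.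
have ki : k * i = j by rewrite -mulrA ji mulrN ik opprK.
have jk : j * k = i by rewrite mulrA ji mulNr kj opprK.
have kk : k * k = - e by rewrite {2}/k mulrA ki jj.
have sk : s k = - k by rewrite sM si sj mulrNN ji.
have ck : corner e k by apply: cornerM.
have [ek ke] := ck; have skk : skew k by [].
pose L a b c d := a *: e + b *: i + c *: j + d *: k.
have LD a b c d a' b' c' d' : L a b c d + L a' b' c' d'
    = L (a + a') (b + b') (c + c') (d + d').
  by rewrite /L !scalerDl; rewrite [LHS](AC (4*4) ((1*5)*(2*6)*(3*7)*(4*8))).
have LZ x a b c d : x *: L a b c d = L (x * a) (x * b) (x * c) (x * d).
  by rewrite /L !scalerDr !scalerA.
have Le a b c d : L a b c d * e = L a b c d.
  by rewrite /L !mulrDl -!scalerAl ee ie je ke.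
have Li a b c d : L a b c d * i = L (- b) a d (- c).
  rewrite /L !mulrDl -!scalerAl ei ii ji ki !scalerN !scaleNr.
  by rewrite [LHS](AC 4 (2*1*4*3)).
have Lj a b c d : L a b c d * j = L (- c) (- d) a b.
  rewrite /L !mulrDl -!scalerAl ej jj kj -/k !scalerN !scaleNr.
  by rewrite [LHS](AC 4 (3*4*1*2)).
have Lk a b c d : L a b c d * k = L (- d) c (- b) a.
  rewrite /L !mulrDl -!scalerAl ek ik jk kk !scalerN !scaleNr.
  by rewrite [LHS](AC 4 (4*3*2*1)).
split=> [[a b c d] [a' b' c' d']|[a b c d] [a' b' c' d']|x|[a b c d]|x cx];
  rewrite -/k /=.
- by rewrite -!/(L _ _ _ _) LD.
- rewrite -!/(L _ _ _ _) [in RHS]/(L a' b' c' d').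
  by rewrite !mulrDr -!scalerAr Le Li Lj Lk !LZ !LD; congr L; ring.
- by rewrite !scale0r !addr0.
- by rewrite !sD !sZ se si sj sk !scalerN !scaleNr.
have [a [y [sky ->]]] := sym_skew cx.
have [b yi] := reduce ski ii sky.
have [c yj] := reduce skj jj (skewD sky (skewZ b ski)).
have [d yk] := reduce skk kk (skewD (skewD sky (skewZ b ski)) (skewZ c skj)).
set z := _ + d *: k in yk.
have xya (v : B) (m : R) p q : v * p = - (p * v) -> v * q = - (q * v) ->
    v * (p + m *: q) = - ((p + m *: q) * v).
  by move=> xp xq; rewrite mulrDr mulrDl -scalerAr -scalerAl xp xq scalerN opprD.
have zk : k * z = - (z * k) by [].
have zj : j * z = - (z * j) by apply: (xya); rewrite // jk kj opprK.
have zi : i * z = - (z * i).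
  by apply: (xya); [apply: (xya); rewrite // ij ji opprK | rewrite ik ki].
(* As [z] anticommutes with [i] and [j], it commutes with [k = i * j]; it also anticommutes with
   [k]. *)
have z0 : z = 0.
  have cz : corner e z by have [] : skew z by do !apply: skewD; rewrite //; apply: skewZ.
  have zk' : k * z = z * k.
    by rewrite {1}/k -mulrA zj mulrN mulrA zi mulNr opprK -mulrA.
  have kz0 : k * z = 0.
    have /eqP : (2%:R : R) *: (k * z) = 0.
      by rewrite scaler_nat mulr2n {1}zk' zk addrN.
    by rewrite scaler_eq0 pnatr_eq0 => /eqP.
  by rewrite -[z]opprK -{1}cz.1 -mulNr -kk -mulrA kz0 mulr0 oppr0.
exists (Quat a (- b) (- c) (- d)) => /=; rewrite -/k !scaleNr -!addrA; congr (_ + _).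
apply/eqP; rewrite eq_sym -subr_eq0 -z0 /z !opprD !opprK !addrA addrAC.
by apply/eqP; congr (_ + _).
Qed.

(** Nonzero skew elements can be scaled to have square -e, and anticommutators of skew elements are
    scalars. Hence the space of skew elements has an orthogonal basis that is empty, [i], or [i],
    [j], [i * j]. *)
Theorem positive_type_coordinates : exists k (th : divalg R k -> B), positive_coordinates th.
Proof.
have [sk0|] := pselect (forall y, skew y -> y = 0).
  by exists RealKind; eexists; apply: real_coordinates.
move=> /existsNP[y /not_implyP[sky /eqP y0]].
have [a [a0 ii]] := unit_skew sky y0; set i := a *: y in ii.
have ski : skew i by apply: skewZ.
clearbody i.
have [ski1|] := pselect (forall y, skew y -> exists a, y = a *: i).
  by exists ComplexKind; eexists; apply: complex_coordinates ski ii ski1.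
move=> /existsNP[z /not_implyP[skz zi]]; have [b izb] := reduce ski ii skz.
have skzb : skew (z + b *: i) by apply: skewD => //; apply: skewZ.
have [|c [c0 jj]] := unit_skew skzb.
  apply: contra_not_neq zi => zb0; exists (- b); apply/eqP.
  by rewrite scaleNr -addr_eq0 zb0.
set j := c *: _ in jj; have skj : skew j by apply: skewZ.
exists QuaternionKind; eexists; apply: (quaternion_coordinates ski ii skj jj).
by rewrite /j -scalerAr -scalerAl izb scalerN.
Qed.

Lemma positive_coordinates_inj k (th : divalg R k -> B) :
  positive_coordinates th -> injective th.
Proof.
move=> [thD thM thc ths _] x y xy.
have th0 : th 0 = 0 by apply: (addrI (th 0)); rewrite -thD !addr0.
have thN z : th (- z) = - th z by apply: (addrI (th z)); rewrite -thD !subrr.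
apply/eqP; rewrite -subr_eq0; apply/eqP.
have [n [nE]] := divalg_norm (x - y); apply; apply/eqP.
have : th (divalg_in k n) = 0 by rewrite -nE thM thD thN xy subrr mulr0.
by rewrite thc => /eqP; rewrite scaler_eq0 (negbTE e0) orbF.
Qed.

Lemma positive_coordinates_scale k (th : divalg R k -> B) c x :
  positive_coordinates th -> e * th x = th x /\ th (divalg_in k c * x) = c *: th x.
Proof.
move=> [thD thM thc ths _]; have ex : e * th x = th x.
  rewrite -[e in LHS]scale1r -thc -thM; congr th.
  by case: k x {th thD thM thc ths} => x; rewrite ?mul1r // [LHS]mul1r.
by rewrite thM thc -scalerAl ex.
Qed.
End PositiveCorner.

Lemma scext_scalar_extension (F : fieldType) (A : falgType F) (R : fieldType)
    (g : {rmorphism F -> R}) (N : zmodType) (sN : R -> N -> N)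
    (L : scalar_ext A g -> N) (L' : N -> scalar_ext A g) :
    {morph L : x y / x + y} -> (forall c x, L (c *: x) = sN c (L x)) ->
    cancel L L' -> cancel L' L ->
  scalar_extension g *:%R sN (L \o scin g).
Proof.
move=> LD LZ LK L'K.
have L'D y z : L' (y + z) = L' y + L' z by rewrite -{1}[y]L'K -{1}[z]L'K -LD LK.
have L'Z c y : L' (sN c y) = c *: L' y by rewrite -{1}[y]L'K -LZ LK.
split=> [x y|c x|V th thD thZ].
- by rewrite /= scinD LD.
- by rewrite /= scinZ LZ.
have l : linear (scext_lift th : scalar_ext A g -> V) by apply: scext_lift_linear.
have liftD (x y : scalar_ext A g) : scext_lift th (x + y) = scext_lift th x + scext_lift th y.
  by have := l 1 x y; rewrite !scale1r.
have lift0 : scext_lift th (0 : scalar_ext A g) = 0.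
  by apply: (addrI (scext_lift th (0 : scalar_ext A g))); rewrite -liftD !addr0.
have liftZ c (x : scalar_ext A g) : scext_lift th (c *: x) = c *: scext_lift th x.
  by have := l c x 0; rewrite lift0 !addr0.
exists (scext_lift th \o L'); split.
  split=> [y z|c y|x] /=; first by rewrite L'D liftD.
    by rewrite L'Z liftZ.
  by rewrite LK (scext_lift_in thD thZ).
move=> h [hD hZ hth]; apply/funext => y; rewrite -[y in RHS]L'K /=.
apply: (@scext_linear_eq F A R g V (scext_lift th) (h \o L)) => //.
  by move=> c x z; rewrite /= LD LZ hD hZ.
by move=> a; rewrite (scext_lift_in thD thZ) -hth.
Qed.

Section LocalIso.
Variables (F : fieldType) (A : falgType F) (sigma : A -> A).
Variables (R : rcfType) (g : {rmorphism F -> R}).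
Hypothesis sigmaD : {morph sigma : x y / x + y}.
Hypothesis sigmaZ : forall (c : F) x, sigma (c *: x) = c *: sigma x.
Hypothesis sigmaM : forall x y, sigma (x * y) = sigma y * sigma x.
Hypothesis sigmaK : involutive sigma.

Local Notation B := (scalar_ext A g).
Local Notation s := (@scext_sigma F A R g sigma).

(** The corner of [e1] is identified with the division algebra by [th]. Relative to it, the [v i]
    and the [d j *: s (v j)] are a row and a column of matrix units, so [L] reads off matrix
    entries. *)
Lemma local_iso_of_matrix_units (e1 : B) (I : finType) (u : I -> B) (c : I -> R) :
    symidem s e1 -> e1 != 0 -> positive_type s e1 ->
    (forall i, e1 * u i = u i) -> (forall i, c i = 1 \/ c i = -1) ->
    (forall i j, u i * s (u j) = (if i == j then c i else 0) *: e1) ->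
    \sum_i c i *: (s (u i) * u i) = 1 ->
  inhabited (local_iso sigma g).
Proof.
move=> ide e10 pos e1u c1 uu u1.
have sl : linear s := @scext_sigma_linear F A R g sigma.
have sD := @scext_sigmaD F A R g sigma; have sZ := @scext_sigmaZ F A R g sigma.
have sM := @scext_sigmaM F A R g sigma sigmaD sigmaZ sigmaM.
have sK := @scext_sigmaK F A R g sigma sigmaD sigmaZ sigmaK.
have [k [th thP]] := positive_type_coordinates sl sM sK ide pos.
have thI := positive_coordinates_inj e10 thP.
have [thD thM thc thbar thsurj] := thP.
have e1th x : e1 * th x = th x := (positive_coordinates_scale 0 x thP).1.
have thZ a x : th (divalg_in k a * x) = a *: th x := (positive_coordinates_scale a x thP).2.
have [ee se] := ide.
have the1 x : th x * e1 = th x.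
  have [y yx] : exists y, th y = s (th x) by exists (divalg_bar x).
  by rewrite -[LHS]sK sM se -yx e1th yx sK.
have th0 : th 0 = 0 by apply: (addrI (th 0)); rewrite -thD !addr0.
have in1 : divalg_in k (1 : R) = 1 by case: (k).
have th1 : th 1 = e1 by rewrite -in1 thc scale1r.
have th_sum n (h : 'I_n -> divalg R k) : th (\sum_i h i) = \sum_i th (h i).
  exact: (big_morph th thD th0).
have cc i : c i * c i = 1 by case: (c1 i) => ->; rewrite ?mulrNN mulr1.
have /choice[ta taP] (x : B) : exists d, th d = e1 * x * e1.
  by apply: thsurj; split; [rewrite !mulrA ee | rewrite -(mulrA _ e1 e1) ee].
have su_e1 i : s (u i) * e1 = s (u i) by rewrite -{1}se -sM e1u.
pose n := #|I|; pose v (i : 'I_n) := u (enum_val i); pose d (i : 'I_n) := c (enum_val i).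
have vv i j : v i * s (v j) = (if i == j then d i else 0) *: e1.
  by rewrite /v uu (inj_eq enum_val_inj).
have v1 : \sum_i d i *: (s (v i) * v i) = 1.
  by rewrite -u1 [RHS](reindex _ (onW_bij _ (enum_val_bij I))).
have dd i : d i * d i = 1 := cc (enum_val i).
have e1v i : e1 * v i = v i := e1u (enum_val i).
have sve1 i : s (v i) * e1 = s (v i) := su_e1 (enum_val i).
pose L (x : B) : 'M[divalg R k]_n := \matrix_(i, j) ta (d j *: (v i * x * s (v j))).
have LE x i j : th (L x i j) = d j *: (v i * x * s (v j)).
  by rewrite mxE taP -scalerAr -scalerAl !mulrA e1v -(mulrA _ (s (v j))) sve1.
pose L' (M : 'M[divalg R k]_n) : B := \sum_i \sum_j d i *: (s (v i) * th (M i j) * v j).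
have LD : {morph L : x y / x + y}.
  move=> x y; apply/matrixP => i j; apply: thI.
  by rewrite [in RHS]mxE thD !LE mulrDr mulrDl scalerDr.
have LZ a x : L (a *: x) = scale_divalg a (L x).
  apply/matrixP => i j; apply: thI; rewrite [in RHS]mxE thZ !LE.
  by rewrite -scalerAr -scalerAl !scalerA mulrC.
have LM x y : L (x * y) = L x *m L y.
  apply/matrixP => i j; apply: thI; rewrite [in RHS]mxE th_sum LE.
  rewrite -[in LHS](mul1r y) -v1 mulr_suml mulr_sumr mulr_sumr mulr_suml scaler_sumr.
  apply: eq_bigr => l _; rewrite thM !LE -!(scalerAl, scalerAr) !scalerA !mulrA.
  by rewrite mulrC.
have LK : cancel L L'.
  move=> x; rewrite -[RHS]mul1r -[RHS]mulr1 -{1}v1 -v1 mulr_suml mulr_suml.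
  apply: eq_bigr => i _; rewrite mulr_sumr; apply: eq_bigr => j _.
  by rewrite LE -!(scalerAl, scalerAr) !scalerA !mulrA mulrC.
have L'K : cancel L' L.
  move=> M; apply/matrixP => i j; apply: thI; rewrite LE /L'.
  rewrite mulr_sumr mulr_suml scaler_sumr (bigD1 i) //= [X in _ + X]big1 ?addr0; last first.
    move=> l li; rewrite mulr_sumr mulr_suml scaler_sumr big1 // => m _.
    by rewrite -!(scalerAl, scalerAr) !mulrA vv eq_sym (negbTE li) scale0r !mul0r !scaler0.
  rewrite mulr_sumr mulr_suml scaler_sumr (bigD1 j) //= [X in _ + X]big1 ?addr0; last first.
    move=> m mj; rewrite -!(scalerAl, scalerAr) -!mulrA vv (negbTE mj) scale0r !mulr0.
    by rewrite !scaler0.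
  rewrite -!(scalerAl, scalerAr) !mulrA vv eqxx -!mulrA vv eqxx -!(scalerAl, scalerAr).
  by rewrite the1 e1th !scalerA dd mulr1 dd scale1r.
(* The diagonal matrix of the signs; it is its own inverse. *)
pose Phi : 'M[divalg R k]_n := \matrix_(i, j) if i == j then divalg_in k (d i) else 0.
have PhiE (M : 'M[divalg R k]_n) i j : th ((Phi *m M) i j) = d i *: th (M i j).
  rewrite mxE th_sum (bigD1 i) //= mxE eqxx thZ big1 ?addr0 // => l li.
  by rewrite mxE eq_sym (negbTE li) mul0r th0.
have EPhi (M : 'M[divalg R k]_n) i j : th ((M *m Phi) i j) = d j *: th (M i j).
  rewrite mxE th_sum (bigD1 j) //= mxE eqxx thM thc -scalerAr the1 big1 ?addr0 // => l lj.
  by rewrite mxE (negbTE lj) mulr0 th0.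
have PhiK : Phi *m Phi = 1%:M.
  apply/matrixP => i j; apply: thI; rewrite PhiE [Phi i j]mxE [1%:M i j]mxE.
  case: eqP => _; last by rewrite th0 scaler0.
  by rewrite thc scalerA dd scale1r th1.
have Lin_sigma a : L (scin g (sigma a)) = Phi *m conj_tr (L (scin g a)) *m Phi.
  apply/matrixP => i j; apply: thI; rewrite EPhi PhiE [conj_tr _ i j]mxE.
  rewrite [map_mx _ _ _ _]mxE thbar !LE sZ !sM sK (scext_sigma_in g sigmaD sigmaZ).
  by rewrite !scalerA -(mulrA (d j)) dd mulr1 mulrA.
have conjPhi : conj_tr Phi = Phi.
  have bar_in (x : R) : divalg_bar (divalg_in k x) = divalg_in k x.
    by case: (k) => //=; [rewrite /real_complex_def /= oppr0 | rewrite /conjq /scalarq /= oppr0].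
  have bar0 : divalg_bar (0 : divalg R k) = 0.
    by apply: thI; rewrite thbar th0 (@scext_sigma0 F A R g sigma).
  apply/matrixP => i j; rewrite !mxE eq_sym; case: eqP => [->|_] //.
have L1 : L (scin g 1) = 1%:M.
  apply/matrixP => i j; apply: thI; rewrite LE scin1 mulr1 vv [1%:M i j]mxE.
  by case: eqP => [->|_]; rewrite ?scale0r ?scaler0 ?th0 // scalerA dd scale1r th1.
constructor; apply: (@LocalIso _ _ _ _ _ k n (L \o scin g) Phi Phi) => //.
- exact: (scext_scalar_extension LD LZ LK L'K).
- by move=> a b /=; rewrite scinM LM.
Qed.

Hypothesis F0 : [pchar F] =i pred0.
Hypothesis A_simple : simple_algebra A.
Hypothesis sigma_central : forall z, (forall b, b * z = z * b) -> sigma z = z ->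
  exists c : F, z = c%:A.

Lemma no_local_iso_skew : ~ inhabited (local_iso sigma g) -> exists x : B, s x * x = - 1.
Proof.
have [N [f [f' tdata]]] := regular_trace_data_exists A_simple F0.
have sl : linear s := @scext_sigma_linear F A R g sigma.
have sM := @scext_sigmaM F A R g sigma sigmaD sigmaZ sigmaM.
have sK := @scext_sigmaK F A R g sigma sigmaD sigmaZ sigmaK.
have td := scext_regular_trace_data g tdata.
have sc := @scext_sigma_central F A R g sigma sigmaD sigmaZ sigmaM sigmaK _ _ _ _ tdata sigma_central.
have [//|[e1 [ide e10 pos [I [u [c [e1u c1 uu u1]]]]]]] := skew_or_hermitian td sl sM sK sc.
by case; apply: (local_iso_of_matrix_units ide e10 pos e1u c1 uu u1).
Qed.
End LocalIso.

Section DivalgMatrices.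
Variables (R : rcfType) (t : division_kind).
Notation D := (divalg R t).
Implicit Types (x y : D) (a b : R).

Lemma divalg_inD a b : divalg_in t (a + b) = divalg_in t a + divalg_in t b.
Proof.
by case: t => //=; [exact: (rmorphD (@real_complex R)) | congr Quat; rewrite /= addr0].
Qed.
Lemma divalg_inM a b : divalg_in t (a * b) = divalg_in t a * divalg_in t b.
Proof. by case: t => //=; [exact: (rmorphM (@real_complex R)) | congr Quat => /=; ring]. Qed.
Lemma divalg_in1 : divalg_in t (1 : R) = 1.
Proof. by case: t. Qed.
Lemma divalg_in0 : divalg_in t (0 : R) = 0.
Proof. by case: t. Qed.
Lemma divalg_inN a : divalg_in t (- a) = - divalg_in t a.
Proof. by apply/eqP; rewrite -addr_eq0 -divalg_inD addNr divalg_in0. Qed.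
Lemma divalg_in_comm a x : divalg_in t a * x = x * divalg_in t a.
Proof.
case: t x => [x|x|[q i j k]] /=.
- exact: (mulrC (a : R)).
- exact: (mulrC (real_complex R a)).
- by congr Quat => /=; ring.
Qed.
Lemma divalg_barD x y : divalg_bar (x + y) = divalg_bar x + divalg_bar y.
Proof.
case: t x y => [//|x y|[? ? ? ?] [? ? ? ?]] /=; first exact: (rmorphD (@conjc R)).
by congr Quat => /=; rewrite opprD.
Qed.
Lemma divalg_barM x y : divalg_bar (x * y) = divalg_bar y * divalg_bar x.
Proof.
case: t x y => [x y|x y|[? ? ? ?] [? ? ? ?]] /=.
- exact: (mulrC (x : R)).
- by rewrite (rmorphM (@conjc R)); exact: (mulrC (conjc (x : R[i]))).
- by congr Quat => /=; ring.
Qed.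
Lemma divalg_bar_in a : divalg_bar (divalg_in t a) = divalg_in t a.
Proof.
by case: t => //=; [rewrite /real_complex_def /= oppr0 | rewrite /conjq /scalarq /= oppr0].
Qed.
Lemma divalg_bar0 : divalg_bar (0 : D) = 0.
Proof. by rewrite -divalg_in0 divalg_bar_in. Qed.

Lemma divalg_bar_sum (I : finType) (h : I -> D) :
  divalg_bar (\sum_i h i) = \sum_i divalg_bar (h i).
Proof. exact: (big_morph _ divalg_barD divalg_bar0). Qed.

Lemma conj_trM m n p (X : 'M[D]_(m, n)) (Y : 'M[D]_(n, p)) :
  conj_tr (X *m Y) = conj_tr Y *m conj_tr X.
Proof.
apply/matrixP => i j; rewrite !mxE divalg_bar_sum; apply: eq_bigr => k _.
by rewrite divalg_barM !mxE.
Qed.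
Lemma conj_tr1 n : conj_tr (1%:M : 'M[D]_n) = 1%:M.
Proof.
apply/matrixP => i j; rewrite !mxE eq_sym; case: eqP => _ /=.
  by rewrite -divalg_in1 divalg_bar_in.
exact: divalg_bar0.
Qed.
Lemma conj_trD m n (X Y : 'M[D]_(m, n)) : conj_tr (X + Y) = conj_tr X + conj_tr Y.
Proof. by apply/matrixP => i j; rewrite !mxE divalg_barD. Qed.
Lemma conj_trZ m n a (X : 'M[D]_(m, n)) :
  conj_tr (scale_divalg a X) = scale_divalg a (conj_tr X).
Proof.
apply/matrixP => i j; rewrite !mxE divalg_barM divalg_bar_in.
by rewrite divalg_in_comm.
Qed.
Lemma scale_divalgAl m n p a (X : 'M[D]_(m, n)) (Y : 'M[D]_(n, p)) :
  scale_divalg a X *m Y = scale_divalg a (X *m Y).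
Proof. by rewrite /scale_divalg -scalemxAl. Qed.
Lemma scale_divalgAr m n p a (X : 'M[D]_(m, n)) (Y : 'M[D]_(n, p)) :
  X *m scale_divalg a Y = scale_divalg a (X *m Y).
Proof.
apply/matrixP => i j; rewrite !mxE mulr_sumr; apply: eq_bigr => k _.
by rewrite !mxE !mulrA divalg_in_comm.
Qed.

Definition divalg_mx m n : Type := 'M[D]_(m, n).
HB.instance Definition _ m n := GRing.Zmodule.on (divalg_mx m n).
Section Lmodule.
Variables m n : nat.
Let scaleM a b (X : divalg_mx m n) :
  scale_divalg a (scale_divalg b X) = scale_divalg (a * b) X.
Proof. by rewrite /scale_divalg scalerA divalg_inM. Qed.
Let scale1 : left_id 1 (@scale_divalg R t m n).
Proof. by move=> X; rewrite /scale_divalg divalg_in1 scale1r. Qed.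
Let scaleDr : right_distributive (@scale_divalg R t m n) +%R.
Proof. by move=> a X Y; rewrite /scale_divalg scalerDr. Qed.
Let scaleDl (X : divalg_mx m n) :
  {morph (@scale_divalg R t m n)^~ X : a b / a + b}.
Proof. by move=> a b; rewrite /scale_divalg divalg_inD scalerDl. Qed.
HB.instance Definition _ := GRing.Zmodule_isLmodule.Build R (divalg_mx m n)
  scaleM scale1 scaleDr scaleDl.
End Lmodule.

(** Balanced signs give an injection [pi] that reverses them and keeps zeros. Column [b] of [W]
    sends the basis vector [b] to a multiple of the one at [pi b], scaled to match absolute values;
    for a zero entry the quotient is 0 by convention. *)
Lemma sign_swapping_matrix k (d : 'rV[R]_k) :
    #|[pred i | 0 < d 0 i]| = #|[pred i | d 0 i < 0]| ->
  exists W : 'M[D]_k, conj_tr W *m map_mx (divalg_in t) (diag_mx d) *m W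
    = - map_mx (divalg_in t) (diag_mx d).
Proof.
move=> balanced.
have [pi [piI sgpi]] : exists f : 'I_k -> 'I_k, injective f /\
    forall i, Num.sg (d 0 (f i)) = - Num.sg (d 0 i).
  apply: (label_preserving_injection (l := fun i => - Num.sg (d 0 i))
    (l' := fun i => Num.sg (d 0 i))) => b.
  have cardP : #|[pred i | Num.sg (d 0 i) == 1]| = #|[pred i | 0 < d 0 i]|.
    by apply: eq_card => i; rewrite !inE sgr_cp0.
  have cardN : #|[pred i | Num.sg (d 0 i) == -1]| = #|[pred i | d 0 i < 0]|.
    by apply: eq_card => i; rewrite !inE sgr_cp0.
  have [->|b1] := eqVneq b 1.
    rewrite cardP balanced -cardN; apply: subset_leq_card; apply/fintype.subsetP => i.
    by rewrite !inE eqr_oppLR.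
  have [->|b2] := eqVneq b (-1).
    rewrite cardN -balanced -cardP; apply: subset_leq_card; apply/fintype.subsetP => i.
    by rewrite !inE eqr_opp.
  apply: subset_leq_card; apply/fintype.subsetP => i; rewrite !inE.
  case: sgrP => _; rewrite ?oppr0 ?opprK // eq_sym ?(negbTE b1) ?(negbTE b2) //.
pose W : 'M[D]_k := \matrix_(a, b)
  if a == pi b then divalg_in t (Num.sqrt (`|d 0 b| / `|d 0 a|)) else 0.
exists W; apply/matrixP => i j; rewrite -mulmxA mxE (bigD1 (pi i)) //= big1 ?addr0; last first.
  by move=> a ai; rewrite !mxE (negbTE ai) divalg_bar0 mul0r.
rewrite !mxE eqxx divalg_bar_in (bigD1 (pi i)) //= [X in _ + X]big1 ?addr0; last first.
  by move=> a ai; rewrite !mxE eq_sym (negbTE ai) mulr0n divalg_in0 mul0r.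
rewrite !mxE eqxx mulr1n (inj_eq piI) eq_sym; case: eqP => [->|_]; last first.
  by rewrite mulr0n divalg_in0 oppr0 !mulr0.
rewrite mulr1n -!divalg_inM -divalg_inN; congr divalg_in.
rewrite mulrCA -expr2 sqr_sqrtr ?divr_ge0 ?normr_ge0 //.
rewrite {1}[d 0 (pi i)]numEsg sgpi; have [di0|di0] := eqVneq (d 0 i) 0.
  by rewrite di0 sgr0 normr0 !mul0r oppr0 ?mul0r.
have dpi0 : `|d 0 (pi i)| != 0.
  by rewrite normr_eq0 -sgr_eq0 sgpi oppr_eq0 sgr_eq0.
by rewrite -mulrA [X in _ * X]mulrC divfK // mulNr -numEsg.
Qed.
End DivalgMatrices.

(** * Vanishing signature of the form <1> *)

Section SignatureZero.
Variables (F : fieldType) (A : falgType F) (sigma : A -> A).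
Variables (R : rcfType) (g : {rmorphism F -> R}).
Hypothesis sigma1 : sigma 1 = 1.
Hypothesis sigmaD : {morph sigma : x y / x + y}.
Hypothesis sigmaZ : forall (c : F) x, sigma (c *: x) = c *: sigma x.
Hypothesis sigmaM : forall x y, sigma (x * y) = sigma y * sigma x.
Hypothesis sigmaK : involutive sigma.

Local Notation B := (scalar_ext A g).
Local Notation s := (@scext_sigma F A R g sigma).

Let one_fg : exists n (e : 'I_n -> (A^c)^o),
  forall m : (A^c)^o, exists c : 'I_n -> A, m = \sum_i ract (e i) (c i).
Proof.
exists 1%N, (fun=> (1 : A)) => m; exists (fun=> m).
by rewrite big_ord1; apply: esym; exact: (mul1r (m : A)).
Qed.

Let one_nonsingular (phi : A -> A) : {morph phi : x y / x + y} ->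
  (forall x a, phi (x * a) = phi x * a) -> exists! x, forall y, phi y = sigma x * y.
Proof.
move=> phiD phiM; exists (sigma (phi 1)); split=> [y|x phix].
  by rewrite sigmaK -phiM mul1r.
by rewrite phix mulr1 sigmaK.
Qed.

Lemma unit_form_exists : exists h : nonsingular_form sigma,
  exists (E : hmod h -> A) (E' : A -> hmod h),
  [/\ cancel E E', cancel E' E, {morph E : x y / x + y},
     forall x a, E (ract x a) = E x * a & forall x y, hval x y = sigma (E x) * E y].
Proof.
pose M : lmodType A^c := (A^c)^o.
have hD (x y z : M) : sigma x * (y + z : M) = sigma x * (y : A) + sigma x * (z : A).
  exact: (mulrDr (sigma x) (y : A)).
have hM (x y : M) (a : A) : sigma x * (ract y a : A) = sigma x * (y : A) * a.
  exact: (mulrA (sigma x) (y : A)).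
have hH (x y : M) : sigma y * (x : A) = sigma (sigma x * (y : A)).
  by rewrite sigmaM sigmaK.
have hN (phi : M -> A) : {morph phi : x y / x + y} ->
    (forall x a, phi (ract x a) = phi x * a) ->
    exists! x : M, forall y : M, phi y = sigma x * (y : A).
  exact: one_nonsingular.
exists (NonsingularForm one_fg hD hM hH hN), id, id; split=> // x a.
Qed.

(* Both universal properties are used to identify [B] with a matrix space. *)
Lemma scalar_extension_inverse (N : zmodType) (sM : F -> N -> N) t m n
    (psi : N -> 'M[divalg R t]_(m, n)) (E : N -> A) (L : B -> 'M[divalg R t]_(m, n)) :
    scalar_extension g sM (@scale_divalg R t m n) psi ->
    {morph E : x y / x + y} -> (forall c x, E (sM c x) = c *: E x) ->
    {morph L : x y / x + y} -> (forall c x, L (c *: x) = scale_divalg c (L x)) ->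
    (forall x, L (scin g (E x)) = psi x) ->
  exists T : 'M[divalg R t]_(m, n) -> B,
    [/\ cancel T L, {morph T : x y / x + y}, forall c y, T (scale_divalg c y) = c *: T y
      & forall x, T (psi x) = scin g (E x)].
Proof.
move=> [psiD psiZ psiU] ED EZ LD LZ Lpsi.
have [|c x|T [[TD TZ Tpsi] _]] := psiU (B : lmodType R) (scin g \o E).
- by move=> x y; rewrite /= ED scinD.
- by rewrite /= EZ scinZ.
exists T; split=> //.
have [|c x|h [_ hU]] := psiU (divalg_mx R t m n : lmodType R) (psi : N -> divalg_mx R t m n).
- exact: psiD.
- exact: psiZ.
have h1 : h = (L \o T : _ -> divalg_mx R t m n).
  apply: hU; split=> [x y|c y|x] /=; first by rewrite TD LD.
    by rewrite TZ LZ.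
  by rewrite Tpsi Lpsi.
have h2 : h = (id : _ -> divalg_mx R t m n) by apply: hU.
by move=> y; rewrite -[RHS]/((id : _ -> divalg_mx R t m n) y) -h2 h1.
Qed.

(** The form <1> becomes Phi^-1, which the signature data present as Q^* Dg Q with balanced diagonal
    [Dg]. Conjugating the sign swap [W] gives X with X^* Phi^-1 X = -Phi^-1, that is, s x x = -1
    under the isomorphism. *)
Lemma signature_zero_skew (mu : local_iso sigma g) (h : nonsingular_form sigma)
    (E : hmod h -> A) (E' : A -> hmod h) :
    cancel E E' -> cancel E' E -> {morph E : x y / x + y} ->
    (forall x a, E (ract x a) = E x * a) -> (forall x y, hval x y = sigma (E x) * E y) ->
    local_signature mu h 0 ->
  exists x : B, s x * x = - 1.
Proof.
move=> EK E'K ED EM hE [k [psi [Bm [psi_ext psiM psi_h Bm_herm [G [G' [d [GG' G'G GBG nd]]]]]]]].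
set t := lkind mu in psi Bm psi_ext psiM psi_h Bm_herm G G' GG' G'G GBG *.
set r := ldeg mu in psi psi_ext psiM psi_h *.
have [lisoD lisoZ _] := liso_ext mu.
pose liso' : A -> divalg_mx R t r r := liso mu.
have lift_linear : linear (scext_lift liso' : B -> _) := @scext_lift_linear F A R g _ liso'.
pose L : B -> 'M[divalg R t]_r := scext_lift liso'.
have LD : {morph L : x y / x + y}.
  by move=> x y; have := lift_linear 1 x y; rewrite !scale1r.
have LZ c x : L (c *: x) = scale_divalg c (L x).
  have L0 : L 0 = 0 by apply: (addrI (L 0)); rewrite -LD !addr0.
  by have := lift_linear c x 0; rewrite [scext_lift _ 0]L0 !addr0.
have Lin a : L (scin g a) = liso mu a by apply: (@scext_lift_in F A R g _ liso' lisoD lisoZ a).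
have LM x y : L (x * y) = L x *m L y.
  elim/scext_ind: x => [a|x x' IH IH'|c x IH].
  - elim/scext_ind: y => [b|y y' IH IH'|c y IH].
    + by rewrite -scinM !Lin lisoM.
    + by rewrite mulrDr !LD IH IH' mulmxDr.
    + by rewrite -scalerAr !LZ IH scale_divalgAr.
  - by rewrite mulrDl !LD IH IH' mulmxDl.
  - by rewrite -scalerAl !LZ IH scale_divalgAl.
have Ls x : L (s x) = lPhi mu *m conj_tr (L x) *m lPhi_inv mu.
  elim/scext_ind: x => [a|x x' IH IH'|c x IH].
  - by rewrite (scext_sigma_in g sigmaD sigmaZ) !Lin liso_sigma.
  - by rewrite (@scext_sigmaD F A R g sigma) !LD IH IH' conj_trD mulmxDr mulmxDl.
  - by rewrite (@scext_sigmaZ F A R g sigma) !LZ IH conj_trZ scale_divalgAr scale_divalgAl.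
have [T [TK TD TZ Tliso]] := @scalar_extension_inverse A *:%R t r r (liso mu) id L
  (liso_ext mu) (fun _ _ => erefl) (fun _ _ => erefl) LD LZ Lin.
have LK : cancel L T.
  apply: (@scext_linear_eq F A R g B (T \o L) id) => // [c x y|a].
    by rewrite /= LD LZ TD TZ.
  by rewrite /= Lin Tliso.
pose C := psi (E' 1).
have psiE m : psi m = C *m liso mu (E m).
  by rewrite -psiM; congr psi; apply: (can_inj EK); rewrite EM E'K mul1r.
have [T2 [T2K _ _ _]] := @scalar_extension_inverse (hmod h) _ t k r psi E (fun x => C *m L x)
  psi_ext ED (fun c x => etrans (EM _ _) (mulr_algr _ _))
  (fun x y => etrans (congr1 (mulmx C) (LD x y)) (mulmxDr _ _ _))
  (fun c x => etrans (congr1 (mulmx C) (LZ c x)) (scale_divalgAr _ _ _))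
  (fun x => etrans (congr1 (mulmx C) (Lin (E x))) (esym (psiE x))).
have PhiE : lPhi_inv mu = conj_tr C *m Bm *m C.
  by rewrite -psi_h hE E'K sigma1 mulr1 liso1 mulmx1.
have r0 : (0 < r)%N.
  rewrite lt0n; apply/eqP => r0; case/eqP: (oner_neq0 B).
  rewrite -(LK 1) -(LK 0); congr T; apply/matrixP => i.
  by have := ltn_ord i; rewrite {2}r0.
(* The map x -> C L(x) has the section [T2]. A single column of the preimages of the [delta_mx i j0]
   suffices; it exists because [r] is positive. *)
have [Q'' CQ''] : exists Q'' : 'M_(r, k), C *m Q'' = 1%:M.
  pose j0 := Ordinal r0.
  exists (\matrix_(a, i) L (T2 (delta_mx i j0)) a j0); apply/matrixP => a i.
  have /matrixP/(_ a j0) := T2K (delta_mx i j0); rewrite !mxE eqxx andbT => <-.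
  by apply: eq_bigr => b _; rewrite mxE.
have balanced : #|[pred i | 0 < d 0 i]| = #|[pred i | d 0 i < 0]|.
  by move/eqP: nd; rewrite eq_sym subr_eq0 => /eqP[].
have [W WE] := sign_swapping_matrix t balanced.
set Dg := map_mx _ _ in GBG WE.
pose Q := G' *m C; pose Q' := Q'' *m G.
have QQ' : Q *m Q' = 1%:M by rewrite /Q /Q' mulmxA -(mulmxA G') CQ'' mulmx1 G'G.
have QDQ : conj_tr Q *m Dg *m Q = lPhi_inv mu.
  have GBE : conj_tr G' *m Dg *m G' = Bm.
    by rewrite -GBG !mulmxA -conj_trM GG' conj_tr1 mul1mx -mulmxA GG' mulmx1.
  by rewrite /Q conj_trM PhiE -GBE !mulmxA.
clearbody Q Q'; pose X := Q' *m W *m Q.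
have XE : conj_tr X *m lPhi_inv mu *m X = - lPhi_inv mu.
  have QX : Q *m X = W *m Q by rewrite /X !mulmxA QQ' mul1mx.
  clearbody X.
  rewrite -QDQ !mulmxA -conj_trM QX conj_trM -(mulmxA _ Q X) QX.
  transitivity (conj_tr Q *m (conj_tr W *m Dg *m W) *m Q); first by rewrite !mulmxA.
  by rewrite WE mulmxN mulNmx.
exists (T X); apply: (can_inj LK); rewrite LM Ls !TK -!mulmxA (mulmxA (conj_tr X)) XE.
have LN x : L (- x) = - L x.
  have L0 : L 0 = 0 by apply: (addrI (L 0)); rewrite -LD !addr0.
  by apply: (addrI (L x)); rewrite -LD !subrr.
by rewrite mulmxN lPhiK LN -scin1 Lin liso1.
Qed.
End SignatureZero.

(** * Descent from a real closure *)

Section PrimitiveElement.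
Variables (F : fieldType) (L : fieldType) (g : {rmorphism F -> L}).
Hypothesis F0 : [pchar F] =i pred0.
Hypothesis L_alg : forall y : L, algebraicOver g y.

Lemma primitive_element n (x : 'I_n -> L) : exists (a : L) (p : 'I_n -> {poly F}),
  forall i, x i = (map_poly g (p i)).[a].
Proof.
elim: n x => [|n IH] x; first by exists 0, (fun=> 0) => -[].
have [a [p xE]] := IH (fun i => x (lift ord0 i)).
have [qa qa0 qaa] := L_alg a; have [q0 q00 q0x] := L_alg (x ord0).
have [m [[u ua] [v vx]]] := pchar0_PET qa0 qaa q00 q0x F0.
set z := (x ord0) *+ m - a in ua vx.
exists z, (fun i => if unlift ord0 i is Some j then p j \Po u else v) => i.
case: unliftP => [j ->|->]; last by rewrite vx.
by rewrite map_comp_poly horner_comp ua xE.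
Qed.

Lemma minimal_polynomial (a : L) : exists f : {poly F},
  [/\ (1 < size f)%N, separable_poly f, root (map_poly g f) a
    & forall p, root (map_poly g p) a -> f %| p].
Proof.
have ex : exists n, `[< exists2 p : {poly F}, p != 0 & root (map_poly g p) a /\ size p = n >].
  by have [p p0 pa] := L_alg a; exists (size p); apply/asboolP; exists p.
case: (ex_minnP ex) => n /asboolP[f f0 [fa fn]] minn.
have min_f p : p != 0 -> root (map_poly g p) a -> (size f <= size p)%N.
  by move=> p0 pa; rewrite fn; apply: minn; apply/asboolP; exists p.
have f_dvd p : root (map_poly g p) a -> f %| p.
  move=> pa; apply/modp_eq0P; apply: contrapT => /eqP r0.
  have : root (map_poly g (p %% f)) a.
    move: pa; rewrite {1}(divp_eq p f) /root rmorphD rmorphM /= hornerD hornerM.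
    by rewrite (rootP fa) mulr0 add0r.
  by move/(min_f _ r0); rewrite leqNgt ltn_modp f0.
have size_f : (1 < size f)%N.
  rewrite ltnNge; apply/negP => /size1_polyC fE.
  move: fa f0; rewrite fE map_polyC /root hornerC polyC_eq0 fmorph_eq0.
  by move=> ->.
exists f; split=> //; rewrite unlock /separable_poly /coprimep.
set h := gcdp f f^`(); have h0 : h != 0 by rewrite gcdp_eq0 negb_and f0.
have hf : f = f %/ h * h by rewrite divpK ?dvdp_gcdl.
have fh0 : f %/ h != 0 by apply: contraNneq f0 => fh0; rewrite hf fh0 mul0r.
have : root (map_poly g (f %/ h)) a || root (map_poly g h) a.
  by rewrite -rootM -rmorphM -hf.
case/orP => [/(min_f _ fh0)|/f_dvd fdh].
  have : (0 < size h)%N by rewrite size_poly_gt0.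
  have : (0 < size (f %/ h)%R)%N by rewrite size_poly_gt0.
  move=> q_gt0 h_gt0; rewrite {1}hf size_mul //.
  case: (size h) h_gt0 => // m _.
  by rewrite addnS /= -[X in (_ <= X)%N]addn0 leq_add2l leqn0 eqSS.
have f'0 : f^`() != 0.
  apply/eqP => f'0; have := coef_deriv f (size f).-2; rewrite f'0 coef0.
  have -> : (size f).-2.+1 = (size f).-1 by case: (size f) size_f => [|[]].
  move/pcharf0P: F0 => F0'; rewrite -mulr_natr => /esym/eqP.
  rewrite mulf_eq0 F0' -/(lead_coef f) lead_coef_eq0 (negbTE f0) /=.
  by case: (size f) size_f => [|[]].
have := dvdp_trans fdh (dvdp_gcdr f f^`()).
by rewrite gtNdvdp // lt_size_deriv.
Qed.
End PrimitiveElement.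

Lemma powers_unitmx (K : fieldType) n (b : 'I_n -> K) : injective b ->
  \matrix_(j < n, m < n) (b m ^+ j) \in unitmx.
Proof.
move=> b_inj; set V := matrix_of_fun _ _.
have -> : V = Vandermonde n (\row_m b m) by apply/matrixP => k m; rewrite !mxE.
rewrite unitmxE unitfE det_Vandermonde; apply/prodf_neq0 => k _.
apply/prodf_neq0 => m km; rewrite !mxE subr_eq0 (inj_eq b_inj).
by rewrite gt_eqF.
Qed.

(** * The trace form of F[X]/(f) *)

Section MultiplicationMatrices.
Variables (F : fieldType) (R : rcfType) (g : {rmorphism F -> R}).
Variables (f : {poly F}) (a : R).
Hypothesis f_size : (1 < size f)%N.
Hypothesis f_sep : separable_poly f.
Hypothesis f_root : root (map_poly g f) a.

Let l := (size f).-1.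
Let size_f : size f = l.+1.
Proof. by rewrite /l; case: (size f) f_size. Qed.
Let f0 : f != 0. Proof. by rewrite -size_poly_gt0 size_f. Qed.

(** Multiplication by [p] on F[X]/(f), in the basis of powers of X and with rows as images. *)
Definition mulpmx (p : {poly F}) : 'M[F]_l :=
  \matrix_(i, j) (('X^i * p) %% f)`_j.

Let Cg : {rmorphism F -> R[i]} := real_complex R \o g.

Let roots_exist : exists b : 'I_l -> R[i], [/\ injective b,
  forall m, root (map_poly Cg f) (b m) & forall z, root (map_poly Cg f) z -> exists m, z = b m].
Proof.
have [rs fE] := closed_field_poly_normal (map_poly Cg f).
have lc0 : lead_coef (map_poly Cg f) != 0.
  by rewrite lead_coef_map fmorph_eq0 lead_coef_eq0.
have rsu : uniq rs.
  rewrite -separable_prod_XsubC -(eqp_separable (eqp_scale _ lc0)) -fE.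
  by rewrite separable_map.
have size_rs : size rs = l.
  have := size_map_poly Cg f; rewrite fE size_scale // size_prod_XsubC size_f.
  by case.
have rootE z : root (map_poly Cg f) z = (z \in rs).
  by rewrite fE rootZ // root_prod_XsubC.
exists (fun m => rs`_m); split=> [m m' /eqP|m|z].
- by rewrite nth_uniq ?size_rs // => /eqP/val_inj.
- by rewrite rootE mem_nth // size_rs.
rewrite rootE => zrs; have lt_z : (index z rs < l)%N by rewrite -size_rs index_mem.
by exists (Ordinal lt_z); rewrite /= nth_index.
Qed.

(** Over [R[i]] the algebra splits: the Vandermonde matrix of the roots diagonalizes all
    multiplications at once, with the values of [p] at the roots as eigenvalues. Traces of powers
    are therefore power sums. *)
Lemma mulpmx_trace_form : exists H : 'M[F]_l, exists b : 'I_l -> R[i],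
  [/\ forall i j, Cg (H i j) = \sum_m b m ^+ (i + j),
      forall p i m, \sum_j Cg (mulpmx p i j) * b m ^+ j = (map_poly Cg p).[b m] * b m ^+ i,
      injective b,
      forall m, root (map_poly Cg f) (b m)
    & forall z, root (map_poly Cg f) z -> exists m, z = b m].
Proof.
have [b [b_inj b_root rootb]] := roots_exist.
have mulE p i m : \sum_j Cg (mulpmx p i j) * b m ^+ j = (map_poly Cg p).[b m] * b m ^+ i.
  transitivity (map_poly Cg (('X^i * p) %% f)).[b m].
    rewrite (horner_coef_wide (n := l)); last first.
      by rewrite size_map_poly -ltnS -size_f ltn_modp.
    by apply: eq_bigr => j _; rewrite coef_map mxE.
  have /(congr1 (fun q => (map_poly Cg q).[b m])) := divp_eq ('X^i * p) f.
  rewrite !rmorphD !rmorphM /= hornerD !hornerM (rootP (b_root m)) mulr0 add0r => <-.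
  by rewrite map_polyXn hornerXn mulrC.
exists (\matrix_(i, j) \tr (mulpmx 'X^(i + j))), b; split=> // i j.
rewrite mxE; pose V := \matrix_(j, m) (b m ^+ j) : 'M[R[i]]_l.
have Vunit : V \in unitmx := powers_unitmx b_inj.
pose P := map_mx Cg (mulpmx 'X^(i + j)).
have PV : P *m V = V *m diag_mx (\row_m b m ^+ (i + j)).
  apply/matrixP => k m; rewrite mul_mx_diag !mxE.
  have := mulE 'X^(i + j) k m; rewrite map_polyXn hornerXn [RHS]mulrC => <-.
  by apply: eq_bigr => n _; rewrite !mxE.
transitivity (\tr P).
  by rewrite /mxtrace rmorph_sum; apply: eq_bigr => k _; rewrite [in RHS]mxE.
rewrite -[P](mulmxK Vunit) PV mxtrace_mulC mulmxA mulVmx // mul1mx mxtrace_diag.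
by apply: eq_bigr => m _; rewrite mxE.
Qed.

Lemma mulpmxD p q : mulpmx (p + q) = mulpmx p + mulpmx q.
Proof. by apply/matrixP => i j; rewrite !mxE mulrDr modpD coefD. Qed.

Lemma mulpmxZ c p : mulpmx (c *: p) = c *: mulpmx p.
Proof. by apply/matrixP => i j; rewrite !mxE -scalerAr modpZl coefZ. Qed.

Lemma mulpmx1 : mulpmx 1 = 1%:M.
Proof.
apply/matrixP => i j; rewrite !mxE mulr1 modp_small ?coefXn 1?eq_sym //.
by rewrite size_polyXn size_f !ltnS ltn_ord.
Qed.

Lemma mulpmx_dvd p : f %| p -> mulpmx p = 0.
Proof.
move=> fp; apply/matrixP => i j; rewrite !mxE.
by have /modp_eq0P-> : f %| 'X^i * p; rewrite ?coef0 ?dvdp_mull.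
Qed.

Lemma mulpmxM p q : mulpmx p *m mulpmx q = mulpmx (p * q).
Proof.
have [H [b [HE mulE b_inj _ _]]] := mulpmx_trace_form.
pose V := \matrix_(j, m) (b m ^+ j) : 'M[R[i]]_l.
have Vunit : V \in unitmx := powers_unitmx b_inj.
have mulV p' : map_mx Cg (mulpmx p') *m V = V *m diag_mx (\row_m (map_poly Cg p').[b m]).
  apply/matrixP => k m; rewrite mul_mx_diag !mxE [RHS]mulrC -mulE.
  by apply: eq_bigr => n _; rewrite !mxE.
have : map_mx Cg (mulpmx p *m mulpmx q) = map_mx Cg (mulpmx (p * q)).
  apply: (can_inj (mulmxK Vunit)); rewrite map_mxM -mulmxA !mulV mulmxA mulV -mulmxA.
  congr (_ *m _); apply/matrixP => i j; rewrite mul_mx_diag !mxE rmorphM hornerM.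
  by case: eqP => [->|_]; rewrite ?mulr1n ?mulr0n ?mul0r.
by move/matrixP => E; apply/matrixP => i j; have := E i j; rewrite !mxE; apply: fmorph_inj.
Qed.

(* If [2 * k >= l], some nonzero real combination [y] of the [q i] vanishes at
   the roots with positive imaginary part, hence is real at every root; then
   [\sum_m y(b m)^2] is both nonnegative and negative. *)
Let negative_card_bound (b : 'I_l -> R[i]) k (q : 'I_k -> {poly F}) (r : 'I_k -> F) :
    injective b -> (forall z, root (map_poly Cg f) z -> exists m, z = b m) ->
    (forall m, root (map_poly Cg f) (b m)) ->
    (forall i j, \sum_m (map_poly Cg (q i)).[b m] * (map_poly Cg (q j)).[b m]
      = if i == j then Cg (r i) else 0) ->
    (forall i, g (r i) < 0) ->
  (2 * k < l)%N.
Proof.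
move=> b_inj rootb b_root qE r_neg.
pose up := [pred m | 0 < complex.Im (b m)]; pose down := [pred m | complex.Im (b m) < 0].
have conj_poly (p : {poly F}) z : (map_poly Cg p).[conjc z] = conjc (map_poly Cg p).[z].
  rewrite !horner_coef rmorph_sum; apply: eq_bigr => i _ /=.
  by rewrite rmorphM rmorphXn /= !coef_map /= /real_complex_def /= oppr0.
have [ma ba] : exists m, real_complex R a = b m.
  apply: rootb; by rewrite /Cg map_poly_comp /= fmorph_root.
have /fin_all_exists[cj cjE] m : exists m', conjc (b m) = b m'.
  by apply: rootb; rewrite /root conj_poly (rootP (b_root m)) conjc0.
have cj_inj : injective cj.
  move=> m m' /(congr1 b); rewrite -!cjE => /(can_inj (@conjcK R)).
  exact: b_inj.
have up_down : (#|up| <= #|down|)%N.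
  rewrite -(card_image cj_inj); apply: subset_leq_card; apply/fintype.subsetP => m.
  case/mapP => m'; rewrite mem_enum => up_m ->; move: up_m; rewrite !inE -cjE.
  by case: (b m') => x y /=; rewrite oppr_lt0.
have card_l : (#|up| + #|down| < l)%N.
  have <- : #|[predU up & down]| = (#|up| + #|down|)%N.
    rewrite -cardUI [X in (_ + X)%N]eq_card0 ?addn0 // => m; rewrite !inE.
    by apply/negP => /andP[h1 h2]; have := lt_trans h1 h2; rewrite ltxx.
  have := cardC1 ma; rewrite card_ord => C1.
  have : (#|[predU up & down]| <= #|predC1 ma|)%N.
    apply: subset_leq_card; apply/fintype.subsetP => m; rewrite !inE.
    by apply: contraTneq => ->; rewrite -ba /= ltxx.
  by rewrite C1 -ltnS prednK // (leq_ltn_trans _ (ltn_ord ma)).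
rewrite ltnNge; apply/negP => le_lk.
(* The real root [a] lies in neither set and conjugation maps [up] into [down], so there are fewer
   conditions at roots of [up] than unknown coefficients. *)
have lt_upk : (#|up| < k)%N by lia.
pose M : 'M[R]_(k, #|up|) := \matrix_(i, j) complex.Im (map_poly Cg (q i)).[b (enum_val j)].
have [v v0 vM] : exists2 v : 'rV[R]_k, v != 0 & v *m M = 0.
  have : kermx M != 0.
    by rewrite -mxrank_eq0 mxrank_ker subn_eq0 -ltnNge (leq_ltn_trans (rank_leq_col M)).
  by case/rowV0Pn => v /sub_kermxP vM v0; exists v.
pose y m := \sum_i (v 0 i)%:C%C * (map_poly Cg (q i)).[b m].
have ImM (x : R) (z : R[i]) : complex.Im (x%:C%C * z) = x * complex.Im z.
  by case: z => z1 z2 /=; rewrite mul0r addr0.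
have Im_sum (h : 'I_k -> R[i]) : complex.Im (\sum_i h i) = \sum_i complex.Im (h i).
  exact: (raddf_sum (@complex.Im R)).
have y_up m : m \in up -> complex.Im (y m) = 0.
  move=> up_m; have /rowP/(_ (enum_rank_in up_m m)) := vM; rewrite !mxE => <-.
  by rewrite Im_sum; apply: eq_bigr => i _; rewrite ImM mxE enum_rankK_in.
have y_conj m : y (cj m) = conjc (y m).
  rewrite /y rmorph_sum; apply: eq_bigr => i _ /=.
  by rewrite -cjE conj_poly rmorphM /= /real_complex_def /= oppr0.
have y_real m : complex.Im (y m) = 0.
  have [gt0|lt0|eq0] := ltrgt0P (complex.Im (b m)); first exact: y_up.
    have : complex.Im (y (cj m)) = 0.
      by apply: y_up; rewrite inE -cjE; case: (b m) lt0 => x z /=; rewrite oppr_gt0.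
    by rewrite y_conj; case: (y m) => x z /= /eqP; rewrite oppr_eq0 => /eqP.
  have : y m = conjc (y m).
    rewrite -y_conj; congr y; apply: b_inj; rewrite -cjE.
    by case: (b m) eq0 => x z /= ->; rewrite oppr0.
  by case: (y m) => x z /= [/eqP]; rewrite -addr_eq0 -mulr2n mulrn_eq0 => /eqP.
have sum_y : \sum_m y m * y m = \sum_i ((v 0 i) ^+ 2 * g (r i))%:C%C.
  transitivity (\sum_i \sum_j (v 0 i)%:C%C * (v 0 j)%:C%C *
    \sum_m (map_poly Cg (q i)).[b m] * (map_poly Cg (q j)).[b m]).
    under eq_bigr => m _ do rewrite /y mulr_suml.
    rewrite exchange_big; apply: eq_bigr => i _ /=.
    under eq_bigr => m _ do rewrite mulr_sumr.
    rewrite exchange_big; apply: eq_bigr => j _ /=.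
    by rewrite mulr_sumr; apply: eq_bigr => m _; rewrite mulrACA.
  apply: eq_bigr => i _; rewrite (bigD1 i) //= qE eqxx big1 ?addr0 => [|j /negbTE ji].
    by rewrite -!rmorphM -expr2.
  by rewrite qE eq_sym ji mulr0.
have : 0 <= complex.Re (\sum_m y m * y m).
  rewrite (raddf_sum (@complex.Re R)) sumr_ge0 // => m _.
  by move: (y_real m); case: (y m) => x z /= ->; rewrite mulr0 subr0 -expr2 sqr_ge0.
rewrite sum_y (raddf_sum (@complex.Re R)) /= leNgt => /negP; apply.
have [i vi] : exists i, v 0 i != 0.
  apply: contrapT => nv; case/eqP: v0; apply/rowP => i; rewrite mxE.
  by apply/eqP/negPn/negP => vi; apply: nv; exists i.
rewrite (bigD1 i) //= ltr_nwDl //.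
  by rewrite pmulr_rlt0 // exprn_even_gt0.
by rewrite sumr_le0 // => j _; rewrite mulr_ge0_le0 ?sqr_ge0 // ltW.
Qed.

(* [H] is the Gram matrix of the trace form of [F[X]/(f)]; its signature is the
   number of real roots of [f], hence positive. *)
Lemma trace_form_diagonal : exists (H Q : 'M[F]_l) (r : 'I_l -> F),
  [/\ forall p, mulpmx p *m H = H *m (mulpmx p)^T, Q \in unitmx,
      Q *m H *m Q^T = diag_mx (\row_i r i), forall i, r i != 0
    & (#|[pred i | (g (r i) < 0)%R]| < #|[pred i | (0 < g (r i))%R]|)%N].
Proof.
have [H [b [HE mulE b_inj b_root rootb]]] := mulpmx_trace_form.
have CgM x y : Cg (x * y) = Cg x * Cg y by rewrite rmorphM.
have CgS (n : nat) (h : 'I_n -> F) : Cg (\sum_i h i) = \sum_i Cg (h i) by rewrite rmorph_sum.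
have CgHE i j : Cg (H i j) = \sum_m b m ^+ i * b m ^+ j.
  by rewrite HE; under eq_bigr do rewrite exprD.
have Hsym : H^T = H.
  by apply/matrixP => i j; rewrite mxE; apply: (fmorph_inj Cg); rewrite !HE addnC.
have mulH p : mulpmx p *m H = H *m (mulpmx p)^T.
  have PE i j : Cg ((mulpmx p *m H) i j) =
      \sum_m (map_poly Cg p).[b m] * b m ^+ i * b m ^+ j.
    rewrite mxE CgS; under eq_bigr => k _ do rewrite CgM CgHE mulr_sumr.
    rewrite exchange_big; apply: eq_bigr => m _ /=.
    by rewrite -mulE mulr_suml; apply: eq_bigr => k _; rewrite mulrA.
  rewrite -[RHS]trmxK trmx_mul trmxK Hsym; apply/matrixP => i j; rewrite [RHS]mxE.
  by apply: (fmorph_inj Cg); rewrite !PE; apply: eq_bigr => m _; rewrite mulrAC.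
have Hunit : H \in unitmx.
  pose V := \matrix_(j, m) (b m ^+ j) : 'M[R[i]]_l.
  have Vunit : V \in unitmx := powers_unitmx b_inj.
  rewrite -(map_unitmx Cg); have -> : map_mx Cg H = V *m V^T.
    apply/matrixP => i j; rewrite !mxE CgHE; apply: eq_bigr => m _.
    by rewrite !mxE.
  by rewrite unitmx_mul unitmx_tr Vunit.
have F2 : (2%:R : F) != 0 by rewrite -(fmorph_eq0 g) rmorph_nat pnatr_eq0.
pose B (x y : 'rV[F]_l) : F := (x *m H *m y^T) 0 0.
have B_linear x : linear (B x : _ -> F^o).
  by move=> c y z; rewrite /B linearP /= mulmxDr -scalemxAr !mxE.
have B_sym x y : B x y = B y x.
  rewrite /B -[in LHS](trmxK (x *m H *m y^T)) mxE !trmx_mul Hsym trmxK.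
  by rewrite mulmxA.
have [e [e_orth e_span]] := orthogonal_basis F2 B_linear B_sym.
have dimE : l = \dim {:'rV[F]_l} by rewrite dimvf /dim /= mul1n.
pose Q := \matrix_i e (cast_ord dimE i) : 'M[F]_l.
have /fin_all_exists[C CE] i : exists c : 'rV[F]_l, delta_mx 0 i = c *m Q.
  have [c ->] := e_span (delta_mx 0 i).
  exists (\row_j c (cast_ord dimE j)); rewrite mulmx_sum_row.
  rewrite (reindex (cast_ord dimE)) /=; last first.
    by exists (cast_ord (esym dimE)) => j _; rewrite ?cast_ordK ?cast_ordKV.
  by apply: eq_bigr => j _; rewrite !mxE rowK.
have Qunit : Q \in unitmx.
  suff /mulmx1_unit[] : (\matrix_i C i) *m Q = 1%:M by [].
  by apply/row_matrixP => i; rewrite row_mul rowK -CE row1.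
pose r i := B (row i Q) (row i Q).
have QHE i j : (Q *m H *m Q^T) i j = B (row i Q) (row j Q).
  by rewrite /B -row_mul mxE [RHS]mxE; apply: eq_bigr => k _; congr (_ * _); rewrite !mxE.
have QHQ : Q *m H *m Q^T = diag_mx (\row_i r i).
  apply/matrixP => i j; rewrite QHE !mxE; case: eqP => [->|/eqP ij]; rewrite ?mulr1n // mulr0n.
  by rewrite !rowK; apply: e_orth; rewrite (inj_eq (@cast_ord_inj _ _ _)).
have r0 i : r i != 0.
  have : diag_mx (\row_i r i) \in unitmx by rewrite -QHQ !unitmx_mul Qunit Hunit unitmx_tr.
  by rewrite unitmxE unitfE det_diag => /prodf_neq0/(_ i isT); rewrite mxE.
exists H, Q, r; split=> //.
set neg := [pred i | _ < 0]; set pos := [pred i | 0 < _].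
have card_l : (#|neg| + #|pos| = l)%N.
  rewrite -[RHS](card_ord l) -(cardC neg); congr (_ + _)%N; apply: eq_card => i.
  by rewrite !inE -leNgt le_eqVlt eq_sym fmorph_eq0 (negbTE (r0 i)).
pose q (k : 'I_#|neg|) := rVpoly (row (enum_val k) Q).
have qE (k : 'I_#|neg|) m :
    (map_poly Cg (q k)).[b m] = \sum_i Cg (Q (enum_val k) i) * b m ^+ i.
  rewrite (horner_coef_wide (n := l)) ?size_map_poly ?size_poly //.
  by apply: eq_bigr => i _; rewrite coef_map coef_rVpoly_ord mxE.
suff lt_l : (2 * #|neg| < l)%N by rewrite -(ltn_add2l #|neg|) card_l addnn -mul2n.
apply: (negative_card_bound (q := q) (r := r \o enum_val) b_inj rootb b_root); last first.
  by move=> k; have := enum_valP k; rewrite inE.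
move=> k k'; transitivity (Cg ((Q *m H *m Q^T) (enum_val k) (enum_val k'))); last first.
  rewrite QHQ !mxE (inj_eq enum_val_inj); case: eqP => _; rewrite ?mulr1n ?mulr0n ?rmorph0 //.
rewrite -mulmxA mxE CgS.
under eq_bigr => m _ do rewrite !qE mulr_suml.
rewrite exchange_big; apply: eq_bigr => i _.
rewrite CgM [X in _ = _ * Cg X]mxE CgS mulr_sumr.
under eq_bigr => m _ do rewrite mulr_sumr.
rewrite exchange_big; apply: eq_bigr => j _.
rewrite CgM CgHE [Q^T _ _]mxE mulr_suml mulr_sumr; apply: eq_bigr => m _.
by rewrite mulrACA -mulrA [X in Cg (Q (enum_val k) i) * X]mulrC.
Qed.
End MultiplicationMatrices.

Section Descent.
Variables (F : fieldType) (A : falgType F) (sigma : A -> A).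
Hypothesis sigmaD : {morph sigma : x y / x + y}.
Hypothesis sigmaZ : forall (c : F) x, sigma (c *: x) = c *: sigma x.
Hypothesis sigmaM : forall x y, sigma (x * y) = sigma y * sigma x.
Hypothesis F0 : [pchar F] =i pred0.
Local Notation embeds := (embeds sigma).

Lemma embeds_labels (I J : finType) (T : eqType) (c : T -> F) (l : I -> T) (l' : J -> T) :
    (forall b, #|[pred i | l i == b]| <= #|[pred j | l' j == b]|)%N ->
  embeds (c \o l) (c \o l').
Proof.
case/label_preserving_injection => phi [phi_inj phiE].
apply: (embeds_reindex sigmaD sigmaZ (s := fun=> 1) phi_inj) => i /=.
by rewrite phiE expr1n mulr1.
Qed.

Lemma embeds_dsum_dtensor (I J K : finType) (d : I -> F) (e : J -> F) (g : K -> F) :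
  embeds (dsum (dtensor d g) (dtensor e g)) (dtensor (dsum d e) g) /\
  embeds (dtensor (dsum d e) g) (dsum (dtensor d g) (dtensor e g)).
Proof.
pose phi (x : I * K + J * K) :=
  match x with inl p => (inl p.1, p.2) | inr p => (inr p.1, p.2) end.
pose psi (x : (I + J) * K) :=
  match x.1 with inl i => inl (i, x.2) | inr j => inr (j, x.2) end.
have phiK : cancel phi psi by move=> [[i k]|[j k]].
have psiK : cancel psi phi by move=> [[i|j] k].
split.
  apply: (embeds_reindex sigmaD sigmaZ (s := fun=> 1) (can_inj phiK)) => -[[i k]|[j k]];
  by rewrite expr1n mulr1.
apply: (embeds_reindex sigmaD sigmaZ (s := fun=> 1) (can_inj psiK)) => -[[i|j] k];
by rewrite expr1n mulr1.
Qed.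

(* Tensoring with the Pfister form of the [|r i|] makes the coefficients of
   equal absolute value up to squares, so that the negative ones cancel. *)
Lemma embeds_positive (I : finType) (r : I -> F) (neg : pred I) (P : F -> Prop) :
    P 1 -> (forall x y, P x -> P y -> P (x * y)) ->
    (forall i, r i != 0) -> (forall i, P (if neg i then - r i else r i)) ->
    (#|neg| < #|[predC neg]|)%N -> embeds (fun i => - r i) r ->
  exists (J : finType) (d : J -> F),
    [/\ inhabited J, forall j, P (d j) & embeds (fun j => - d j) d].
Proof.
move=> P1 PM r0 Pr lt_neg emb.
pose a i := if neg i then - r i else r i.
have a0 i : a i != 0 by rewrite /a; case: (neg i); rewrite ?oppr_eq0.
pose c (b : bool) : F := if b then - 1 else 1.
pose w (S : {set I}) := \prod_(i in S) a i.
(* [w] lists the entries of the Pfister form of the [a i], indexed by subsets. Multiplication by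
   [a i] toggles [i] in the subset, up to a square. *)
pose flip (p : I * {set I}) := (p.1, if p.1 \in p.2 then p.2 :\ p.1 else p.1 |: p.2).
have flipK : involutive flip.
  move=> [i S]; rewrite /flip /=; case: (boolP (i \in S)) => iS.
    by rewrite setD11 finset.setD1K.
  by rewrite setU11 setU1K.
have wflip i S : exists s, a i * w S = w (flip (i, S)).2 * s ^+ 2.
  rewrite /flip /=; case: (boolP (i \in S)) => iS.
    by exists (a i); rewrite /w (big_setD1 i) //= mulrA mulrC expr2.
  by exists 1; rewrite /w big_setU1 // expr1n mulr1.
have /fin_all_exists[s sE] (p : I * {set I}) : exists s, a p.1 * w p.2 = w (flip p).2 * s ^+ 2.
  by case: p => i S; apply: wflip.
have s0 p : s p != 0.
  apply/negP => /eqP sp; have /eqP := sE p; rewrite sp expr0n mulr0 mulf_eq0 (negbTE (a0 _)) /=.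
  by apply/negP/prodf_neq0.
have rE i : r i = c (neg i) * a i.
  by rewrite /c /a; case: (neg i); rewrite ?mulN1r ?opprK ?mul1r.
have flipE p : (flip p).1 = p.1 by [].
have embP (e : bool -> bool) :
   embeds (dtensor (c \o e \o neg) w) (dtensor (fun i => (c (e (neg i)) * a i)) w) /\
   embeds (dtensor (fun i => (c (e (neg i)) * a i)) w) (dtensor (c \o e \o neg) w).
  split.
    apply: (embeds_reindex sigmaD sigmaZ (s := fun p => (s (flip p))^-1) (can_inj flipK)) => p.
    transitivity (c (e (neg p.1)) * (a (flip p).1 * w (flip p).2) * (s (flip p))^-1 ^+ 2).
      by rewrite sE flipK -[RHS]mulrA -(mulrA (w _)) -exprMn divff ?expr1n ?mulr1.
    by congr (_ * _); rewrite /dtensor mulrA.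
  apply: (embeds_reindex sigmaD sigmaZ (s := s) (can_inj flipK)) => p.
  by rewrite /dtensor /= -mulrA sE mulrA.
have sgn_emb : embeds (dtensor (c \o negb \o neg) w) (dtensor (c \o neg) w).
  apply: embeds_trans (embP negb).1 _; apply: embeds_trans _ (embP id).2.
  apply: embeds_eq (embeds_dtensor w emb) => -[i S]; rewrite /dtensor /= rE //.
  by rewrite /c; case: (neg i); rewrite ?mulN1r ?opprK ?mul1r.
(* The signs of [r] form k<1> + m<1, -1> and those of -r form k<-1> + m<1, -1>. The common summand,
   tensored with [w], is what gets cancelled; [k] is positive because there are more positive
   entries. *)
pose k := (#|[predC neg]| - #|neg|)%N; pose m := #|neg|.
pose l b (j : 'I_k + 'I_m * bool) := match j with inl _ => b | inr p => p.2 end.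
have card_l b b' : #|[pred j | l b j == b']| = (k * (b == b') + m)%N.
  rewrite -sum1_card big_mkcond big_sumType /=; congr (_ + _)%N.
    by under eq_bigr do rewrite inE /=; rewrite sum_nat_const card_ord; case: eqP.
  transitivity (\sum_(i < m) \sum_(x : bool) (x == b'))%N.
    by rewrite pair_bigA; apply: eq_bigr => -[i x] _; rewrite inE /=; case: eqP.
  by rewrite big_bool sum_nat_const card_ord; case: b' => /=; rewrite muln1.
have card_neg b : #|[pred i | neg i == b]| = (if b then m else k + m)%N.
  rewrite /k subnK ?(ltnW lt_neg) //.
  by case: b; apply: eq_card => i; rewrite !inE ?eqb_id // eqbF_neg.
have card_neg' b : #|[pred i | ~~ neg i == b]| = (if b then k + m else m)%N.
  have := card_neg (~~ b); rewrite if_neg => <-; apply: eq_card => i; rewrite !inE.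
  by case: (neg i); case: b.
have cl b : c \o l b =1 dsum (fun _ : 'I_k => c b) (c \o snd : 'I_m * bool -> F) by case.
have e1 : embeds (dsum (fun _ : 'I_k => c true) (c \o snd : 'I_m * bool -> F))
    (c \o negb \o neg).
  apply: embeds_eq (cl true) (frefl _) _.
  apply: (@embeds_labels _ _ _ c (l true) (negb \o neg)) => b.
  by rewrite card_l card_neg'; case: b; rewrite /= ?muln1 ?muln0.
have e2 : embeds (c \o neg) (dsum (fun _ : 'I_k => c false) (c \o snd : 'I_m * bool -> F)).
  apply: embeds_eq (frefl _) (cl false) _; apply: (@embeds_labels _ _ _ c neg (l false)) => b.
  by rewrite card_l card_neg; case: b; rewrite /= ?muln1 ?muln0.
have := embeds_trans (embeds_dtensor w e1) (embeds_trans sgn_emb (embeds_dtensor w e2)).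
move/(embeds_trans (embeds_dsum_dtensor _ _ _).1).
move/embeds_trans/(_ (embeds_dsum_dtensor _ _ _).2) => /(embeds_cancel sigmaD sigmaZ F0) embk.
set d0 := dtensor (fun=> c false) w in embk.
have d0P p : P (d0 p).
  rewrite /d0 /dtensor /= mul1r /w; apply: (big_ind P) => // i _; exact: Pr.
exists _, (dsum d0 d0); split.
- have k0 : (0 < k)%N by rewrite subn_gt0.
  by constructor; left; exact: (Ordinal k0, finset.set0).
- by case.
by apply: embeds_eq embk => // -[p|p]; rewrite /= /d0 /dtensor /= mulN1r mul1r.
Qed.

(* [P k] are the multiplication matrices of the coordinates of an [x] with
   [sigma x * x = -1]; left multiplication by [x] is then the isometry. *)
Lemma embeds_of_action l (r : 'I_l -> F) (P : 'I_(\dim {:A}) -> 'M[F]_l) :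
    (forall k, P k *m diag_mx (\row_i r i) = diag_mx (\row_i r i) *m (P k)^T) ->
    (forall m, \sum_k \sum_k' acoord m (sigma (abasis k) * abasis k') *: (P k *m P k')
      = (- acoord m (1 : A))%:M) ->
  embeds (fun i => - r i) r.
Proof.
move=> Psym PE.
have symE k i j : P k i j * r j = r i * P k j i.
  by have /matrixP/(_ i j) := Psym k; rewrite mul_mx_diag mul_diag_mx !mxE.
have PEA i i' : \sum_k \sum_k' (P k *m P k') i i' *: (sigma (abasis k) * abasis k')
    = - (i == i')%:R *: (1 : A).
  rewrite (acoordE 1) scaler_sumr.
  under eq_bigr => k _ do under eq_bigr => k' _ do
    rewrite (acoordE (sigma (abasis k) * abasis k')) scaler_sumr.
  under eq_bigr => k _ do rewrite exchange_big.
  rewrite exchange_big; apply: eq_bigr => m _ /=.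
  have E : \sum_k \sum_k' (acoord m (sigma (abasis k) * abasis k') *: (P k *m P k')) i i'
      = (- acoord m (1 : A)) *+ (i == i').
    have /matrixP/(_ i i') := PE m; rewrite summxE mxE => <-.
    by apply: eq_bigr => k _; rewrite summxE.
  transitivity ((\sum_k \sum_k'
      (acoord m (sigma (abasis k) * abasis k') *: (P k *m P k')) i i') *: abasis m).
    rewrite scaler_suml; apply: eq_bigr => k _; rewrite scaler_suml; apply: eq_bigr => k' _.
    by rewrite scalerA [in RHS]mxE mulrC.
  rewrite scalerA E; congr (_ *: _).
  by rewrite -[LHS]mulr_natl mulNr mulrN.
exists (fun x => [ffun j => \sum_i \sum_k P k i j *: (abasis k * x i)]); split.
  move=> a x y; apply/ffunP => j; rewrite !ffunE scaler_sumr -big_split.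
  apply: eq_bigr => i _; rewrite /= scaler_sumr -big_split; apply: eq_bigr => k _.
  by rewrite !ffunE /= mulrDr -scalerAr scalerDr !scalerA mulrC.
move=> x y; rewrite /hform.
transitivity (\sum_j \sum_i \sum_i' \sum_k \sum_k'
    (r j * (P k i j * P k' i' j)) *: (sigma (x i) * (sigma (abasis k) * abasis k') * y i')).
  apply: eq_bigr => j _; rewrite !ffunE (sigma_sum sigmaD sigmaZ) mulr_suml scaler_sumr.
  apply: eq_bigr => i _; rewrite mulr_sumr scaler_sumr; apply: eq_bigr => i' _.
  rewrite (sigma_sum sigmaD sigmaZ) mulr_suml scaler_sumr; apply: eq_bigr => k _.
  rewrite mulr_sumr scaler_sumr; apply: eq_bigr => k' _.
  by rewrite sigmaZ sigmaM -scalerAl -scalerAr !scalerA !mulrA.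
transitivity (\sum_i \sum_i' sigma (x i) * ((- (i == i')%:R * r i') *: y i')).
  rewrite exchange_big; apply: eq_bigr => i _ /=.
  rewrite exchange_big; apply: eq_bigr => i' _ /=.
  have := congr1 (fun z => sigma (x i) * (z * (r i' *: y i'))) (PEA i i').
  rewrite -!scalerAl mul1r scalerA => <-.
  rewrite mulr_suml mulr_sumr exchange_big; apply: eq_bigr => k _ /=.
  rewrite mulr_suml mulr_sumr exchange_big; apply: eq_bigr => k' _ /=.
  rewrite -scaler_suml -!scalerAl -!scalerAr !scalerA !mulrA; congr (_ *: _).
  rewrite [X in _ = X * _]mxE mulr_suml; apply: eq_bigr => j _.
  by rewrite -[in RHS]mulrA symE mulrCA.
apply: eq_bigr => i _; rewrite (bigD1 i) //= eqxx big1 => [|i' /negbTE ii'].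
  by rewrite addr0 mulN1r -scalerAr.
by rewrite eq_sym ii' oppr0 mul0r scale0r mulr0.
Qed.

Lemma descent (R : rcfType) (g : {rmorphism F -> R}) (x : scalar_ext A g) :
    (forall y : R, algebraicOver g y) -> scext_sigma sigma x * x = - 1 ->
  exists (J : finType) (d : J -> F),
    [/\ inhabited J, forall j, 0 < g (d j) & embeds (fun j => - d j) d].
Proof.
move=> R_alg sxx.
have [a [p xE]] := primitive_element F0 R_alg (fun k => x 0 k).
have [f [f_size f_sep f_root f_dvd]] := minimal_polynomial F0 R_alg a.
have [H [Q [r [mulH Qunit QHQ r0 lt_neg]]]] := trace_form_diagonal f_size f_sep f_root.
have sxxE m : \sum_k \sum_k' g (acoord m (sigma (abasis k) * abasis k')) * (x 0 k * x 0 k')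
    = - g (acoord m (1 : A)).
  have /rowP/(_ m) : scext_sigma sigma x * x = - scin g 1 by [].
  rewrite {1 2}(scext_expand x) [RHS]mxE [X in _ = - X]mxE => <-.
  have -> : scext_sigma sigma (\sum_i x 0 i *: scin g (abasis i))
      = \sum_i x 0 i *: scin g (sigma (abasis i)).
    rewrite (big_morph (scext_sigma sigma) (@scext_sigmaD F A R g sigma)
      (@scext_sigma0 F A R g sigma)).
    by apply: eq_bigr => k _; rewrite scext_sigmaZ scext_sigma_in.
  rewrite mulr_suml summxE; apply: eq_bigr => k _.
  rewrite mulr_sumr summxE; apply: eq_bigr => k' _.
  by rewrite -scalerAl -scalerAr -scinM scalerA !mxE mulrC.
pose P k := Q *m mulpmx f (p k) *m invmx Q.
have emb : embeds (fun i => - r i) r.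
  apply: (embeds_of_action (P := P)) => [k|m].
    rewrite -QHQ /P !trmx_mul trmx_inv !mulmxA mulmxKV // -(mulmxA Q) mulH !mulmxA.
    by rewrite mulmxK ?unitmx_tr.
  pose G := \sum_k \sum_k' acoord m (sigma (abasis k) * abasis k') *: (p k * p k').
  have GE : mulpmx f G = (- acoord m (1 : A))%:M.
    (* The [m]-th coordinate of the relation for [x] is a polynomial identity at [a], hence a
       congruence modulo [f]. *)
    have : mulpmx f (G + (acoord m (1 : A)) *: 1) = 0.
      apply/mulpmx_dvd/f_dvd; rewrite /root rmorphD /= hornerD; apply/eqP.
      have /eqP := sxxE m; rewrite -addr_eq0 => /eqP<-.
      rewrite alg_polyC map_polyC hornerC; congr (_ + _).
      rewrite /G rmorph_sum horner_sum; apply: eq_bigr => k _.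
      rewrite rmorph_sum horner_sum; apply: eq_bigr => k' _.
      by rewrite /= map_polyZ hornerZ rmorphM hornerM -!xE.
    rewrite mulpmxD mulpmxZ (mulpmx1 f_size) => /eqP; rewrite addr_eq0 => /eqP->.
    by rewrite scale_scalar_mx mulr1 -raddfN.
  transitivity (Q *m mulpmx f G *m invmx Q); last first.
    by rewrite GE scalar_mxC mulmxK.
  have mulpmx_sum (n : nat) (h : 'I_n -> {poly F}) :
      mulpmx f (\sum_i h i) = \sum_i mulpmx f (h i).
    exact: (big_morph _ (mulpmxD f) (mulpmx_dvd (dvdp0 f))).
  rewrite mulpmx_sum mulmx_sumr mulmx_suml; apply: eq_bigr => k _.
  rewrite mulpmx_sum mulmx_sumr mulmx_suml; apply: eq_bigr => k' _.
  rewrite mulpmxZ -(mulpmxM g f_size f_sep) -scalemxAr -scalemxAl; congr (_ *: _).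
  by rewrite /P !mulmxA mulmxKV.
apply: (embeds_positive (neg := fun i => g (r i) < 0) (P := fun y => 0 < g y)) emb => //.
- by rewrite rmorph1.
- by move=> y z y0 z0; rewrite rmorphM mulr_gt0.
- move=> i; have [h|h] := ltrP (g (r i)) 0; first by rewrite rmorphN oppr_gt0.
  by rewrite lt_neqAle h eq_sym fmorph_eq0 r0.
apply: leq_trans lt_neg _; apply: subset_leq_card; apply/fintype.subsetP => i.
by rewrite !inE -leNgt; apply: ltW.
Qed.
End Descent.

(** * Nil-orderings, reduced traces and sums of hermitian squares *)

Section OrderingTheory.
Variables (F : fieldType) (P : set F).
Hypothesis XP : X_F P.

Lemma orderingD x y : P x -> P y -> P (x + y).
Proof. by case: XP => + _ _ _; apply. Qed.
Lemma orderingM x y : P x -> P y -> P (x * y).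
Proof. by case: XP => _ + _ _; apply. Qed.
Lemma ordering_anti x : P x -> P (- x) -> x = 0.
Proof. by case: XP => _ _ _ +; apply. Qed.
Lemma ordering_sqr x : P (x ^+ 2).
Proof.
rewrite expr2; case: XP => _ PM Pt _; have [Px|Px] := Pt x; first exact: PM.
by rewrite -mulrNN; apply: PM.
Qed.
Lemma ordering0 : P 0.
Proof. by have := ordering_sqr 0; rewrite expr0n. Qed.
Lemma ordering1 : P 1.
Proof. by have := ordering_sqr 1; rewrite expr1n. Qed.
Lemma orderingV x : P x -> P x^-1.
Proof.
have [->|x0] := eqVneq x 0; first by rewrite invr0.
move=> Px; have -> : x^-1 = x * x^-1 ^+ 2 by rewrite expr2 mulrA divff ?mul1r.
by apply: orderingM (ordering_sqr _).
Qed.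
Lemma ordering_sum (I : Type) (r : seq I) (p : pred I) (h : I -> F) :
  (forall i, p i -> P (h i)) -> P (\sum_(i <- r | p i) h i).
Proof. by move=> Ph; apply: (big_ind P) => //; [exact: ordering0 | exact: orderingD]. Qed.
Lemma ordering_nat n : P n%:R.
Proof. by rewrite -[n]card_ord -sumr_const; apply: ordering_sum => i _; apply: ordering1. Qed.

Lemma ordering_char0 : [pchar F] =i pred0.
Proof.
move=> p; apply/negP; rewrite inE => /andP[p_prime /eqP p0].
have PN1 : P (- 1).
  have -> : - 1 = p.-1%:R :> F; last exact: ordering_nat.
  by apply/eqP; rewrite eq_sym -addr_eq0 natr1 prednK ?prime_gt0 // p0.
by have /eqP := ordering_anti ordering1 PN1; rewrite oner_eq0.
Qed.
End OrderingTheory.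

Section HermitianSums.
Variables (F : fieldType) (A : falgType F) (sigma : A -> A).

Lemma hermitian_sum0 : hermitian_sum sigma 0.
Proof. by exists 'I_0, (fun=> 0); rewrite big_ord0. Qed.

Lemma hermitian_sumD u v : hermitian_sum sigma u -> hermitian_sum sigma v ->
  hermitian_sum sigma (u + v).
Proof.
move=> [I [x ->]] [J [y ->]].
exists (I + J)%type, (fun k => match k with inl i => x i | inr j => y j end).
by rewrite big_sumType.
Qed.

Lemma hermitian_sum_sum (I : Type) (r : seq I) (p : pred I) (h : I -> A) :
  (forall i, p i -> hermitian_sum sigma (h i)) ->
  hermitian_sum sigma (\sum_(i <- r | p i) h i).
Proof.
move=> hS; apply: (big_ind (hermitian_sum sigma)) => //; first exact: hermitian_sum0.
exact: hermitian_sumD.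
Qed.

Lemma hermitian_sum1 x : hermitian_sum sigma (sigma x * x).
Proof. by exists 'I_1, (fun=> x); rewrite big_ord1. Qed.

Lemma represented_copies_form1 u :
  (exists s, represented (copies (r := (2 ^ s)%N) (form1 sigma)) u) <->
  hermitian_sum sigma u.
Proof.
split=> [[s [x ->]]|[I [x ->]]]; first by exists 'I_(2 ^ s), x.
(* Padding with zeros fills the 2^s copies, with s = #|I|. *)
pose y n := if insub n is Some k then x (enum_val (k : 'I_#|I|)) else 0.
exists #|I|, (fun j => y j); rewrite /copies /form1.
pose G n := sigma (y n) * y n.
transitivity (\sum_(n < #|I|) G n).
  rewrite -[LHS]/(\sum_(i in I) _) big_enum_val; apply: eq_bigr => k _.
  by rewrite /G /y valK.
rewrite (big_ord_widen _ G (ltnW (ltn_expl #|I| (isT : 1 < 2)%N))) big_mkcond.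
apply: eq_bigr => n _; rewrite /G /y; case: insubP => [k -> //|/negbTE ->].
by rewrite mulr0.
Qed.
End HermitianSums.

Section AlgebraWithInvolutionTheory.
Variables (F : fieldType) (A : falgType F) (sigma : A -> A).
Hypothesis A_inv : algebra_with_involution sigma.

Let A_simple : simple_algebra A. Proof. by case: A_inv. Qed.
Let sigmaD : {morph sigma : x y / x + y}. Proof. by case: A_inv => _ _ []. Qed.
Let sigmaM x y : sigma (x * y) = sigma y * sigma x.
Proof. by case: A_inv => _ _ []. Qed.
Let sigmaK : involutive sigma. Proof. by case: A_inv => _ _ []. Qed.
Let sigma_alg (c : F) : sigma c%:A = c%:A.
Proof. by case: A_inv => _ _ _ /(_ c%:A)[_ /(_ (ex_intro _ c erefl))[]]. Qed.
Let sigma1 : sigma 1 = 1. Proof. by have := sigma_alg 1; rewrite scale1r. Qed.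
Let sigmaZ (c : F) x : sigma (c *: x) = c *: sigma x.
Proof. by rewrite -[x in LHS]mul1r scalerAl sigmaM sigma_alg -scalerAr mulr1. Qed.
Let sigmal : linear sigma.
Proof. by move=> a x y; rewrite sigmaD sigmaZ. Qed.
Let centerP (z : A) : (forall b, b * z = z * b) -> z \in 'Z({:A})%VS.
Proof. by move=> zC; rewrite memv_cap memvf; apply/centvP => b _. Qed.
Let sigma_central z : (forall b, b * z = z * b) -> sigma z = z -> exists c : F, z = c%:A.
Proof. by case: A_inv => _ _ _ symE zC zs; apply/symE; split=> //; apply: centerP. Qed.

Lemma dim_neq0 : [pchar F] =i pred0 -> (\dim {:A})%:R != 0 :> F.
Proof.
move=> F0; have : (0 < \dim {:A})%N.
  rewrite lt0n dimv_eq0 -subv0; apply/negP => /subvP/(_ 1 (memvf _)).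
  by rewrite memv0 oner_eq0.
by case: (\dim _) => // n _; apply: char0_natf_neq0.
Qed.

(** If a local isomorphism exists, the vanishing of the signature is needed only for the form <1>;
    if none exists, the structure theorem supplies [x]. *)
Lemma nil_embeds_neg P : Defs.Nil sigma P -> exists (I : finType) (d : I -> F),
  [/\ inhabited I, forall i, P (d i) /\ d i != 0 & embeds sigma (fun i => - d i) d].
Proof.
case=> XP [s [[R [g [[gP R_alg] s_sig]]] s0]].
have F0 := ordering_char0 XP.
have [x sxx] : exists x : scalar_ext A g, scext_sigma sigma x * x = - 1.
  case: s_sig => [[mu mu_s]|[no_mu _]]; last exact: no_local_iso_skew no_mu.
  have [h [E [E' [EK E'K ED EM hE]]]] := unit_form_exists sigmaM sigmaK.
  have := mu_s h; rewrite s0; exact: signature_zero_skew EK E'K ED EM hE.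
have [I [d [I0 d0 demb]]] := descent sigmaD sigmaZ sigmaM F0 R_alg sxx.
exists I, d; split=> // i; split; first by apply/gP/Order.POrderTheory.ltW.
by have := d0 i; apply: contraTneq => ->; rewrite rmorph0 Order.POrderTheory.ltxx.
Qed.

Lemma regtr_positive_not_embeds_neg P (I : finType) (d : I -> F) : X_F P ->
    (forall x, P (regtr (sigma x * x))) -> inhabited I ->
    (forall i, P (d i) /\ d i != 0) -> ~ embeds sigma (fun i => - d i) d.
Proof.
move=> XP psd [i0] dP [T [_ hT]]; have F0 := ordering_char0 XP.
pose e : {ffun I -> A} := [ffun i => (i == i0)%:R].
have := congr1 (@regtr F A) (hT e e); rewrite /hform.
rewrite [RHS](_ : _ = - (d i0 * (\dim {:A})%:R)); last first.
  rewrite (bigD1 i0) //= big1 => [|i /negbTE ii0].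
    by rewrite addr0 !ffunE eqxx sigma1 mulr1 regtrZ regtr1 mulNr.
  by rewrite !ffunE ii0 mulr0 scaler0.
rewrite regtr_sum => E; have [di0 d0] := dP i0.
have PN : P (- (d i0 * (\dim {:A})%:R)).
  rewrite -E; apply: ordering_sum => // i _; rewrite regtrZ.
  by apply: orderingM => //; case: (dP i).
have /eqP := ordering_anti XP (orderingM XP di0 (ordering_nat XP _)) PN.
by rewrite mulf_eq0 (negbTE d0) (negbTE (dim_neq0 F0)).
Qed.

Variable Trd : A -> centre A.
Hypothesis Trd_red : reduced_trace Trd.

(** The Casimir projection preserves both traces. For symmetric [y] its value is central and
    symmetric, hence a scalar [c] of [F], on which the two traces are multiplication by [n] and by
    the dimension. *)
Lemma reduced_trace_regtr : [pchar F] =i pred0 -> exists n, (0 < n)%N /\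
  forall y, sigma y = y -> exists c : F,
    Trd y = (n%:R * c)%:A /\ regtr y = (\dim {:A})%:R * c.
Proof.
move=> F0; have [N [f [f' tdata]]] := regular_trace_data_exists A_simple F0.
have [L [g [n [phi [[phiD phiZ phiU] phi1 phiM phiT]]]]] := Trd_red.
pose E := casimir f f'.
have EC y b : b * E y = E y * b by apply: casimir_central tdata _ _.
have vsval1 : vsval (1 : centre A) = 1.
  apply/eqP; rewrite -[vsval 1]/(algid 'Z({:A})%AS) algid_eq1.
  by apply: centerP => b; rewrite mulr1 mul1r.
pose zc y : centre A := vsproj _ (E y).
have zcE y : vsval (zc y) = E y by rewrite vsprojK //; apply: centerP.
have phi_sum (h : 'I_N -> A) : phi (\sum_k h k) = \sum_k phi (h k).
  have phi0 : phi 0 = 0 by apply: (addrI (phi 0)); rewrite -phiD !addr0.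
  exact: (big_morph phi phiD phi0).
have TrdE y : g (Trd y) = n%:R * g (zc y).
  transitivity (\tr (phi (E y))).
    rewrite phiT /E /casimir phi_sum raddf_sum /= -[y in LHS]mulr1 -(casimir1' tdata).
    rewrite mulr_sumr phi_sum raddf_sum; apply: eq_bigr => k _ /=.
    by rewrite !phiM mxtrace_mulC -!mulmxA mxtrace_mulC mulmxA.
  by rewrite -zcE -[vsval _]mulr1 phiZ phi1 linearZ /= mxtrace1 mulrC.
have n_gt0 : (0 < n)%N.
  rewrite lt0n; apply/eqP => n0.
  (* If [n] were 0, the universal property would factor [zc] through the zero module, although
     [zc 1] is 1. *)
  have zcD : {morph zc : x y / x + y}.
    move=> x y; rewrite /zc -linearD /E /casimir -big_split; congr (vsproj _ _).
    by apply: eq_bigr => k _; rewrite /= mulrDr mulrDl.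
  have zcZ z a : zc (vsval z * a) = z * zc a.
    apply: val_inj; rewrite /= zcE zcE /E /casimir mulr_sumr.
    apply: eq_bigr => k _; have := subvsP z; rewrite memv_cap => /andP[_ /centvP zC].
    by rewrite !mulrA zC ?memvf.
  have [|c x|thetaN [[ND _ Nphi] _]] := phiU L^o (g \o zc).
  - by move=> x y; rewrite /= zcD rmorphD.
  - by rewrite /= zcZ rmorphM.
  have N0 : thetaN 0 = 0 by apply: (addrI (thetaN 0)); rewrite -ND !addr0.
  have := Nphi 1; have -> : phi 1 = 0.
    by apply/matrixP => i; have := ltn_ord i; rewrite [X in (_ < X)%N]n0.
  have zc1 : zc 1 = 1.
    by apply: val_inj; rewrite /= zcE /E (casimir_one tdata); exact: esym vsval1.
  by rewrite N0 /= zc1 rmorph1 => /esym/eqP; rewrite oner_eq0.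
(* [centre] is not declared as a field, so injectivity comes from invertibility in [A] of nonzero
   central elements. *)
have g_inj : injective g.
  move=> x y gxy; apply/eqP; rewrite -subr_eq0; set z := x - y.
  have gz : g z = 0 by rewrite rmorphB /= gxy subrr.
  apply: contraT => z0; have zU : vsval z \is a GRing.unit.
    case: A_inv => _ centreU _ _.
    by apply: centreU; [exact: subvsP | rewrite -(inj_eq val_inj) /= in z0].
  have := phi1; rewrite -(divrr zU) phiZ gz scale0r.
  move=> /matrixP/(_ (Ordinal n_gt0) (Ordinal n_gt0)).
  by rewrite !mxE eqxx => /esym/eqP; rewrite oner_eq0.
exists n; split=> // y ys.
have [c cE] : exists c : F, E y = c%:A.
  apply: sigma_central => [b|]; first exact: EC.
  by rewrite /E (casimir_invol tdata sigmal sigmaM sigmaK) ys.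
exists c; split.
  apply: g_inj; rewrite TrdE.
  have -> : zc y = c%:A by apply: val_inj; rewrite /= zcE cE -[in LHS]vsval1.
  by rewrite -scalerA scaler_nat rmorphMn /= mulr_natl.
by rewrite -(tr_casimir tdata) -/(E y) cE regtrZ regtr1 mulrC.
Qed.

Lemma psd_at_regtr P u : X_F P -> sigma u = u ->
  psd_at P (trace_form_u sigma Trd u) <-> forall x, P (regtr (sigma x * u * x)).
Proof.
move=> XP us; have F0 := ordering_char0 XP.
have [n [n_gt0 TrdE]] := reduced_trace_regtr F0.
have n0 : n%:R != 0 :> F by case: n n_gt0 {TrdE} => // n _; apply: char0_natf_neq0.
have inC_inj (a b : F) : a%:A = b%:A :> centre A -> a = b.
  move/eqP; rewrite -subr_eq0 -scalerBl scaler_eq0 oner_eq0 orbF subr_eq0.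
  exact: eqP.
have sym x : sigma (sigma x * u * x) = sigma x * u * x.
  by rewrite !sigmaM sigmaK us mulrA.
have iff_c (k k' : nat) (c : F) : k%:R != 0 :> F -> P (k%:R * c) -> P (k'%:R * c).
  move=> k0 Pc; have -> : k'%:R * c = k'%:R * (k%:R^-1 * (k%:R * c)) by rewrite mulKf.
  by apply: orderingM (ordering_nat XP _) (orderingM XP (orderingV XP (ordering_nat XP _)) Pc).
split=> [psd x|psd x]; have [c [Tc rc]] := TrdE _ (sym x).
  have [c' Tc' Pc'] := psd x; rewrite rc; apply: (iff_c n) => //.
  by move: Tc'; rewrite /trace_form_u Tc => /inC_inj->.
exists (n%:R * c) => //; apply: (iff_c (\dim {:A})); first exact: dim_neq0.
by rewrite -rc; apply: psd.
Qed.

Lemma X_sigma_regtr P : X_sigma sigma Trd P <->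
  X_F P /\ forall x, P (regtr (sigma x * x)).
Proof.
have E x : sigma x * x = sigma x * 1 * x by rewrite mulr1.
split=> -[XP psd]; split=> //.
  have /(psd_at_regtr XP sigma1) psd' : psd_at P (trace_form_u sigma Trd 1).
    by move=> x; have := psd x; rewrite /trace_form E.
  by move=> x; rewrite E.
have /(psd_at_regtr XP sigma1) psd' x : P (regtr (sigma x * 1 * x)) by rewrite -E.
by move=> x; have := psd' x; rewrite /trace_form_u -E.
Qed.

Lemma X_sigma_sub_X_tilde : (X_sigma sigma Trd `<=` X_tilde sigma)%classic.
Proof.
move=> P /X_sigma_regtr[XP psd]; split=> // /nil_embeds_neg[I [d [I0 dP]]].
exact: regtr_positive_not_embeds_neg XP psd I0 dP.
Qed.

Lemma PS'_X_sigma : PS' sigma Trd -> X_tilde sigma = X_sigma sigma Trd.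
Proof.
move=> ps; apply/seteqP; split; last exact: X_sigma_sub_X_tilde.
have [_ psd] := ps 1 sigma1; move=> P XtP; split; first by case: XtP.
have {}psd : psd_at P (trace_form_u sigma Trd 1).
  apply: psd => //; apply/represented_copies_form1 => //.
  by rewrite -[X in hermitian_sum _ X](mulr1 1) -[X in X * _]sigma1; apply: hermitian_sum1.
by move=> x; have := psd x; rewrite /trace_form_u mulr1.
Qed.

Lemma X_tilde_hermitian_sum w : X_tilde sigma = X_sigma sigma Trd ->
    [pchar F] =i pred0 -> w != 0 -> (forall P, X_sigma sigma Trd P -> P w) ->
  hermitian_sum sigma w%:A.
Proof.
move=> Xeq F0 w0 Pw; apply: contrapT => /(nonsimilar_ordering sigmaD sigmaZ sigma1 F0 w0).
case=> P [XP PNw no_emb].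
have [PX|PnX] := pselect (X_tilde sigma P).
  have /Pw Pw' : X_sigma sigma Trd P by rewrite -Xeq.
  by case/eqP: w0; apply: ordering_anti XP _ Pw' PNw.
apply: no_emb; apply: nil_embeds_neg; apply: contrapT => nNil; exact: PnX.
Qed.

Lemma psd_hermitian_sum u : X_tilde sigma = X_sigma sigma Trd ->
    [pchar F] =i pred0 -> sigma u = u ->
    (forall P, X_sigma sigma Trd P -> forall x, P (regtr (sigma x * u * x))) ->
  hermitian_sum sigma u.
Proof.
move=> Xeq F0 us psd; have F2 : (2%:R : F) != 0 := char0_natf_neq0 F0 1.
have [N [f [f' tdata]]] := regular_trace_data_exists A_simple F0.
pose b x y : F := regtr (sigma x * u * y).
have b_linear x : linear (b x : A -> F^o).
  by move=> a y z; rewrite /b mulrDr -scalerAr regtrD regtrZ.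
have b_sym x y : b x y = b y x.
  rewrite /b -(tr_invol tdata sigmal sigmaM sigmaK (sigma x * u * y)).
  by rewrite !sigmaM sigmaK us mulrA.
have [e [e_orth e_span]] := orthogonal_basis F2 b_linear b_sym.
rewrite (diagonal_trace_form_sum tdata sigmal sigmaM sigmaK us e_orth e_span).
apply: hermitian_sum_sum => i bi.
have [I [z zE]] : hermitian_sum sigma (regtr (sigma (e i) * u * e i))^-1%:A.
  apply: X_tilde_hermitian_sum; rewrite ?invr_neq0 // => P PX.
  by apply: orderingV; [case: PX | apply: psd].
exists I, (fun k => z k * sigma (u * e i)).
set c := _^-1 in zE *; set y := u * e i.
transitivity (y * c%:A * sigma y); first by rewrite -scalerAr mulr1 scalerAl.
rewrite zE mulr_sumr mulr_suml; apply: eq_bigr => k _.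
by rewrite sigmaM sigmaK !mulrA.
Qed.

Lemma pchar_hermitian_sum p u : p \in [pchar F] -> p != 2%N -> sigma u = u ->
  hermitian_sum sigma u.
Proof.
move=> p_char p2 us; have [p_prime p0] : prime p /\ p%:R = 0 :> F.
  by move: p_char; rewrite inE => /andP[? /eqP].
have F2 : (2%:R : F) != 0.
  by rewrite -(dvdn_pcharf p_char) dvdn_prime2.
have pN v : sigma v = v -> hermitian_sum sigma (- v ^+ 2).
  move=> vs; have -> : - v ^+ 2 = \sum_(i < p.-1) sigma v * v.
    rewrite sumr_const card_ord vs -expr2; apply/eqP.
    by rewrite eq_sym -addr_eq0 -mulrSr prednK ?prime_gt0 // -scaler_nat p0 scale0r.
  by apply: hermitian_sum_sum => i _; apply: hermitian_sum1.
(* Chosen so that (v + 1)^2 - v^2 = 2v + 1 = u. *)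
pose v := 2%:R^-1 *: (u - 1).
have vs : sigma v = v by rewrite /v sigmaZ sigmaD us -scaleN1r sigmaZ sigma1.
have -> : u = sigma (v + 1) * (v + 1) + - v ^+ 2.
  rewrite sigmaD vs sigma1 mulrDl mulrDr mul1r mulr1 expr2 -[X in X - _]addrA [RHS]addrC addKr.
  by rewrite addrA -mulr2n -scaler_nat scalerA divff // scale1r subrK.
by apply: hermitian_sumD; [exact: hermitian_sum1 | exact: pN].
Qed.
End AlgebraWithInvolutionTheory.

Theorem theorem4p18 (F : fieldType) (A : falgType F) (sigma : A -> A)
    (Trd : A -> centre A) :
  2%N \notin [pchar F] ->
  algebra_with_involution sigma ->
  reduced_trace Trd ->
  PS' sigma Trd <-> X_tilde sigma = X_sigma sigma Trd.
Proof.
move=> F2 A_inv Trd_red; split; first exact: PS'_X_sigma.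
move=> Xeq u us; have sigmaM x y : sigma (x * y) = sigma y * sigma x by case: A_inv => _ _ [].
split=> [psd|/represented_copies_form1 [I [z uE]] P XtP].
  apply/represented_copies_form1.
  have [F0|] := pselect ([pchar F] =i pred0).
    apply: (psd_hermitian_sum A_inv Xeq) => // P PX.
    by apply/(psd_at_regtr A_inv Trd_red) => //; [case: PX | apply: psd; rewrite Xeq].
  move=> nF0; have [p p_char] : exists p, p \in [pchar F].
    by apply: contrapT => no_p; apply: nF0 => p; apply/negP => p_char; apply: no_p; exists p.
  by apply: (pchar_hermitian_sum A_inv p_char); first by apply: contraNneq F2 => <-.
have [XP psd] : X_F P /\ forall x, P (regtr (sigma x * x)).
  by apply/(X_sigma_regtr A_inv Trd_red); rewrite -Xeq.
apply/(psd_at_regtr A_inv Trd_red) => // x.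
rewrite uE mulr_sumr mulr_suml regtr_sum; apply: ordering_sum => // i _.
by have := psd (z i * x); rewrite sigmaM !mulrA.
Qed.
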